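(* Let $E\subset\mathbb{C}^{\mathbb{Z}}$ be a Banach space of sequences such that: (i) the set $F(\mathbb{Z})$ of finitely supported sequences is contained in and dense in $E$; (ii) for every $n\in\mathbb{Z}$ the map $p_n:x\mapsto x(n)$ is continuous from $E$ into $\mathbb{C}$; (iii) $\psi_z(E)\subset E$ for all $z\in\mathbb{T}$ and $\sup_{z\in\mathbb{T}}\|\psi_z\|<+\infty$, where $\psi_z(x)=(x(n)z^n)_{n\in\mathbb{Z}}$. Suppose that at least one of the operators $S$ and $S^{-1}$ is bounded. Then: 1) If $S$ is not bounded, but $S^{-1}$ is bounded, then $\rho(S)=+\infty$; and if $S$ is bounded, but $S^{-1}$ is not bounded, then $\rho(S^{-1})=+\infty$. 2) $\operatorname{spec}(S)=\Bigl\{z\in\mathbb{C} : \frac{1}{\rho(S^{-1})}\leq |z|\leq \rho(S)\Bigr\}$. 3) Let $M$ be a multiplier on $E$. For every $r>0$ such that $C_r\subset \operatorname{spec}(S)$, we have $\widetilde{M}\in L^\infty(C_r)$ and $|\widetilde{M}(z)|\leq\|M\|$ for almost every $z\in C_r$. 4) If $\rho(S)>\frac{1}{\rho(S^{-1})}$, then for every multiplier $M$ on $E$ the function $\widetilde{M}$ is holomorphic on the interior of $\operatorname{spec}(S)$.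
   Context: $\mathbb{T}=\{z\in\mathbb{C}:|z|=1\}$ and $C_r=\{z\in\mathbb{C}:|z|=r\}$ for $r>0$. $F(\mathbb{Z})$ is the set of sequences on $\mathbb{Z}$ with finitely many non-zero coefficients. $e_k$ is the sequence with $e_k(k)=1$ and $e_k(n)=0$ for $n\neq k$. The shift $S:\mathbb{C}^{\mathbb{Z}}\to\mathbb{C}^{\mathbb{Z}}$ is $Sx=(x(n-1))_{n\in\mathbb{Z}}$, so $S^{-1}x=(x(n+1))_{n\in\mathbb{Z}}$. One says that $S$ (resp. $S^{-1}$) is bounded when $S(E)\subset E$ (resp. $S^{-1}(E)\subset E$); by the closed graph theorem its restriction to $E$ is then a bounded operator on $E$. If $S$ is bounded, $\operatorname{spec}(S)$ is the spectrum of $S|_E$ as an operator on $E$. If $S$ is not bounded, $\operatorname{spec}(S)$ is the spectrum of $\overline{S}$, the smallest closed extension of $S|_{F(\mathbb{Z})}$: its domain is the set of $x\in E$ for which there is a sequence $(x_n)\subset F(\mathbb{Z})$ with $x_n\to x$ in $E$ and $Sx_n\to y$ for some $y\in E$, and $\overline{S}x=y$. The spectrum $\operatorname{spec}(S^{-1})$ is defined in the same way. For a densely defined closed operator $A$, $\rho(A)=\sup\{|\lambda|:\lambda\in\operatorname{spec}(A)\}$; $\rho(S)$ and $\rho(S^{-1})$ are defined using the spectra just described. If $\rho(S^{-1})=+\infty$, then $\frac{1}{\rho(S^{-1})}$ denotes $0$; if $\rho(S^{-1})=0$, it denotes $+\infty$. A multiplier on $E$ is a bounded operator $M$ on $E$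 such that $MSa=SMa$ for every $a\in F(\mathbb{Z})$. Its symbol is the formal Laurent series $\widetilde{M}(z)=\sum_{n\in\mathbb{Z}}\widehat{M}(n)z^n$, where $\widehat{M}=M(e_0)$. The assertion ''$\widetilde{M}\in L^\infty(C_r)$ and $|\widetilde M|\le\|M\|$ a.e. on $C_r$'' means that there is a function $\nu_r\in L^\infty(\mathbb{T})$ whose Fourier coefficients are $\widehat{\nu_r}(n)=\widehat{M}(n)r^n$, $n\in\mathbb{Z}$ (so that $\widetilde{M}(rz)$ is identified with $\nu_r(z)$, $z\in\mathbb{T}$), and $|\nu_r|\leq\|M\|$ a.e. on $\mathbb{T}$. The assertion that $\widetilde{M}$ is holomorphic on an open set means that the Laurent series converges there and its sum is holomorphic.
   Formalization: When a spectrum is empty, its radius ρ is taken to be +∞ instead of the usual sup of the empty set; otherwise 1) and 2) fail (e.g. weighted ℓ²(Z) with weight exp(n|n|), where S⁻¹ is quasinilpotent and spec(S) is empty). *)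

(* Defs.v *)
From HB Require Import structures.
From mathcomp Require Import all_boot all_order all_algebra.
From mathcomp Require Import complex.
From mathcomp Require Import all_classical all_reals all_analysis.
Import Order.TTheory GRing.Theory Num.Theory.
Import numFieldNormedType.Exports.

Set Implicit Arguments.
Unset Strict Implicit.
Unset Printing Implicit Defensive.

Local Open Scope classical_set_scope.
Local Open Scope ring_scope.
Local Open Scope complex_scope.

(** Complex numbers are [R[i]] for [R : realType]; [R[i]^o] is the same type,
    with its structure of normed space over itself. Norms of normed spaces over
    [R[i]] take their values in [R[i]] (they are nonnegative reals there);
    [rnorm] is the same norm as an element of [R]. *)
Definition rnorm (R : realType) (V : normedModType R[i]) (x : V) : R :=
  complex.Re `|x|.

Definition circle (R : realType) (r : R) : set R[i] := [set z | `|z| = r%:C].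

Section Sequences.
Variable R : realType.
Implicit Types (a : int -> R[i]^o) (z : R[i]).

Definition finsupp a : Prop := finite_set [set n | a n != 0].

Definition delta (k : int) : int -> R[i]^o := fun n => (n == k)%:R.

Definition seq_shift a : int -> R[i]^o := fun n => a (n - 1).

Definition seq_unshift a : int -> R[i]^o := fun n => a (n + 1).

Definition psi z a : int -> R[i]^o := fun n => (a n : R[i]) * z ^ n.

End Sequences.

(** A Banach space of sequences is a complex Banach space [E] with an injective
    linear map [coord : E -> C^Z], which stands for the inclusion of [E] in the
    space of all sequences. An operator [A] on [E], with domain possibly smaller
    than [E], is given by its graph, a subset of [E * E]. *)
Section Operators.
Variables (R : realType) (E : completeNormedModType R[i]).
Implicit Types (f : E -> E) (A : set (E * E)).

Definition graph_of f : set (E * E) := [set p | p.2 = f p.1].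

(** Possibly [+oo], when [f] is not bounded. *)
Definition opnorm f : \bar R :=
  ereal_sup [set (rnorm (f x))%:E | x in [set x : E | rnorm x <= 1]].

(** [l] is in the resolvent set when [l - A], defined on the domain of [A], is
    a bijection onto [E] whose inverse [B] is bounded. *)
Definition resolvent_set A : set R[i] :=
  [set l | exists B : {linear E -> E}, continuous B /\
     forall x u : E, A (x, l *: x - u) <-> x = B u].

Definition spectrum A : set R[i] := ~` resolvent_set A.

(** The supremum of [|l|] over the spectrum. A bounded operator on [E] has a
    nonempty spectrum, but a closed unbounded one can have an empty spectrum, and
    then the radius is [+oo]: such an operator has infinity as its only point of
    the extended spectrum. For instance, if the inverse of [S] is bounded and
    quasinilpotent, then the spectrum of (the closure of) [S] is empty. *)
Definition specradius A : \bar R :=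
  if spectrum A == set0 then +oo%E
  else ereal_sup [set (rnorm (l : R[i]^o))%:E | l in spectrum A].

Variable coord : {linear E -> (int -> R[i]^o)}.
Implicit Type T : (int -> R[i]^o) -> (int -> R[i]^o).

(** The element of [E] with coordinates [a] ([0] if there is none). *)
Definition ofseq (a : int -> R[i]^o) : E := xget 0 [set x | coord x = a].

(** [T(E)] is contained in [E]. *)
Definition maps_into T : Prop := forall x : E, exists y : E, coord y = T (coord x).

(** The restriction of [T] to [E], of interest when [maps_into T]. *)
Definition restr T : E -> E := fun x => ofseq (T (coord x)).

(** The smallest closed extension of the restriction of [T] to the finitely
    supported sequences. *)
Definition min_closure T : set (E * E) :=
  [set p | exists u v : nat -> E,
     [/\ forall k, finsupp (coord (u k)) /\ coord (v k) = T (coord (u k)),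
         u @ \oo --> p.1 & v @ \oo --> p.2]].

Definition realization T : set (E * E) :=
  if `[< maps_into T >] then graph_of (restr T) else min_closure T.

Definition spec T : set R[i] := spectrum (realization T).

Definition rho T : \bar R := specradius (realization T).

Definition multiplier (M : {linear E -> E}) : Prop :=
  continuous M /\
  forall a sa : E, finsupp (coord a) -> coord sa = seq_shift (coord a) ->
    coord (M sa) = seq_shift (coord (M a)).

Definition symbol (M : {linear E -> E}) : int -> R[i]^o :=
  coord (M (ofseq (delta R 0))).

End Operators.

(** The unit circle is parametrised by [t] in [[0, 2 pi]], with the measure
    [dt / (2 pi)]; only the values of [nu] on the unit circle matter. *)
Section Circle.
Variable R : realType.
Implicit Types (nu : R[i] -> R[i]) (t : R).

Definition cis t : R[i] := cos t +i* sin t.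

Definition ae_circle (P : R[i] -> Prop) : Prop :=
  {ae (@lebesgue_measure R), forall t, `[0, 2 * pi]%classic t -> P (cis t)}.

Definition Linfty_circle nu : Prop :=
  [/\ measurable_fun `[0, 2 * pi]%classic (fun t => complex.Re (nu (cis t))),
      measurable_fun `[0, 2 * pi]%classic (fun t => complex.Im (nu (cis t))) &
      exists K : R, ae_circle (fun z => rnorm (nu z : R[i]^o) <= K)].

Definition fourier nu (n : int) : R[i] :=
  let f t := nu (cis t) * cis t ^ (- n) in
  ((2 * pi)^-1)%:C *
  ((\int[lebesgue_measure]_(t in `[0%R, (2 * pi)%R]) complex.Re (f t)) +i*
   (\int[lebesgue_measure]_(t in `[0%R, (2 * pi)%R]) complex.Im (f t))).

End Circle.

Section Laurent.
Variable R : realType.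
Implicit Types (c : int -> R[i]^o) (z : R[i]^o).

Definition laurent_pos c z : nat -> R[i]^o :=
  series (fun n : nat => (c n%:Z * z ^+ n : R[i]^o)).

Definition laurent_neg c z : nat -> R[i]^o :=
  series (fun n : nat => (c (- n.+1%:Z) * z ^- n.+1 : R[i]^o)).

(** As [0^-1 = 0], convergence at [0] has to be specified separately. *)
Definition laurent_cvg c z : Prop :=
  [/\ z = 0 -> forall n : int, n < 0 -> c n = 0,
      cvg (laurent_pos c z @ \oo) & cvg (laurent_neg c z @ \oo)].

Definition laurent_sum c z : R[i]^o :=
  lim (laurent_pos c z @ \oo) + lim (laurent_neg c z @ \oo).

(** For [U] open. *)
Definition laurent_holomorphic c (U : set R[i]^o) : Prop :=
  forall z, U z -> laurent_cvg c z /\ derivable (laurent_sum c) z 1.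

End Laurent.

(* Main.v *)
Require Import Defs.
From HB Require Import structures.
From mathcomp Require Import all_boot all_order all_algebra.
From mathcomp Require Import cyclic separable cyclotomic complex.
From mathcomp Require Import all_classical all_reals all_analysis.
From mathcomp Require Import measurable_realfun ring lra zify.
Import Order.TTheory GRing.Theory Num.Theory.
Import numFieldNormedType.Exports.

Set Implicit Arguments.
Unset Strict Implicit.
Unset Printing Implicit Defensive.

Local Open Scope classical_set_scope.
Local Open Scope ring_scope.
Local Open Scope complex_scope.

(** Rotation invariance enters through averages over the unit circle; for
    finite sums, these are averages over roots of unity of large order. The
    average of [z^-m psi_z x] is [x(m) e_m]. More generally, the average of
    [psi_z M psi_z^-1 a] against [u(z) conj (v(z))], for trigonometric
    polynomials [u] and [v], shows that the sum of the
    [u_i conj (v_j) M^(i - j) S^(i - j) a], with [M^] the sequence of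
    coefficients of a multiplier [M], has norm at most a constant times
    [|M| |a| (|u|^2 + |v|^2) / 2] ([mult_toeplitz]). In particular a nonzero
    coefficient of a multiplier at [m] makes [S^m] bounded ([mult_coef]).

    The spectrum. Let [R+] and [R-] be the rates of exponential growth of the
    powers of [S] and of its inverse ([shift_radius]). For [|z| > R+] and for
    [|z| < 1 / R-], Neumann's series in the powers of one of the two shifts gives
    the resolvent ([regular_outside], [regular_inside]). Conversely, the
    resolvent at [z] is a multiplier, because one of the two shifts is bounded,
    and the image [y] of [e_0] satisfies [y(n - 1) = z y(n)] for [n] nonzero and
    [y(-1) = z y(0) - 1]. If [y(0)] is not zero, then [mult_coef] bounds the
    powers of [S] by multiples of those of [|z|]; if [y(-1)] is not zero, then it
    bounds the powers of the inverse by multiples of those of [1 / |z|]. At a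
    point of the resolvent set in the closed annulus, continuity from both sides
    would make both vanish, contrary to [y(-1) = z y(0) - 1]
    ([regular_strict]). So the spectrum is the annulus [1 / R- <= |z| <= R+]
    ([shift_specP]), and the spectral radii are [R+] and [R-] ([shift_rho]); they
    are infinite exactly for unbounded shifts.

    The symbol on a circle. If [r] is in the spectrum, then either there are
    approximate eigenvectors of the bounded shift, or the evaluation of Laurent
    polynomials at [r] is continuous for the norm of [E]. In both cases
    [mult_toeplitz] becomes a scalar inequality: the Toeplitz matrices of the
    sequence [M^(n) r^n] are bounded by [C' |M|], with [C'] independent of [M]
    ([toeplitz_spec]). Then the Fejér means with these coefficients are uniformly
    bounded, and a subsequence converges almost everywhere to a function [nu]
    ([ex_symbol_function]). To replace [C' |M|] by [|M|], the same inequality is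
    used for all the powers of [M]: the coefficients of [nu^j] are those of [M^j]
    ([fourier_power]), so that the mean of [|nu|^(2j)] is at most
    [(C' |M|^j)^2] ([power_energy]), and [j] tends to infinity
    ([symbol_function_le]).

    Holomorphy. The scalar Toeplitz inequality bounds each [M^(n) r^n], so that
    the Laurent series converges between two circles of the spectrum
    ([symbol_holomorphic]). *)

(** * Real-valued norms and bounded operators *)

Section RealNorm.
Variables (R : realType) (V : normedModType R[i]).
Implicit Types (x y : V) (u v : nat -> V).

Lemma rnormE x : `|x| = (rnorm x)%:C.
Proof. by rewrite /rnorm RRe_real ?normr_real. Qed.

Lemma rnorm_ge0 x : 0 <= rnorm x.
Proof. by rewrite -ler0c -rnormE. Qed.

Lemma rnorm0 : rnorm (0 : V) = 0.
Proof. by rewrite /rnorm normr0. Qed.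

Lemma rnorm_eq0 x : (rnorm x == 0) = (x == 0).
Proof.
rewrite -[RHS]normr_eq0 rnormE; apply/eqP/eqP => [->//|].
by move/complexI.
Qed.

Lemma rnorm_gt0 x : (0 < rnorm x) = (x != 0).
Proof. by rewrite lt_def rnorm_ge0 rnorm_eq0 andbT. Qed.

Lemma ler_rnormD x y : rnorm (x + y) <= rnorm x + rnorm y.
Proof. by rewrite -lecR rmorphD /= -!rnormE ler_normD. Qed.

Lemma rnormN x : rnorm (- x) = rnorm x.
Proof. by rewrite /rnorm normrN. Qed.

Lemma rdistC x y : rnorm (x - y) = rnorm (y - x).
Proof. by rewrite /rnorm distrC. Qed.

Lemma ler_rnormB x y : rnorm (x - y) <= rnorm x + rnorm y.
Proof. by rewrite (le_trans (ler_rnormD _ _))// rnormN. Qed.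

Lemma ler_rdist z x y : rnorm (x - y) <= rnorm (x - z) + rnorm (z - y).
Proof. by rewrite -[x - y](subrKA z) ler_rnormD. Qed.

Lemma rnormZ (l : R[i]) x : rnorm (l *: x) = rnorm (l : R[i]^o) * rnorm x.
Proof.
by apply: complexI; rewrite rmorphM /= -!rnormE normrZ.
Qed.

Lemma rnorm_sum I (r : seq I) (P : pred I) (F : I -> V) :
  rnorm (\sum_(i <- r | P i) F i) <= \sum_(i <- r | P i) rnorm (F i).
Proof.
elim/big_ind2: _ => [|x a y b Ha Hb|//]; first by rewrite rnorm0.
by rewrite (le_trans (ler_rnormD _ _))// lerD.
Qed.

Lemma posc_real (e : R[i]) : 0 < e -> e = (complex.Re e)%:C /\ 0 < complex.Re e.
Proof.
move=> e0; have er : e = (complex.Re e)%:C by rewrite RRe_real// gtr0_real.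
by split=> //; rewrite -ltcR -er.
Qed.

Lemma inv_natS_small (e : R) : 0 < e -> exists N, forall n, (N <= n)%N -> n.+1%:R^-1 < e.
Proof.
move=> e0; have [N _ hN] := near_infty_natSinv_lt (PosNum e0).
by exists N => n /hN.
Qed.

Lemma cvg_rnormP u x :
  (u @ \oo --> x) <->
  (forall e : R, 0 < e -> exists N, forall n, (N <= n)%N -> rnorm (u n - x) < e).
Proof.
split=> [/cvgrPdistC_lt h e e0|h].
  have /h [N _ hN] : 0 < e%:C by rewrite ltcR.
  by exists N => n /hN /=; rewrite rnormE ltcR.
apply/cvgrPdistC_lt => e /posc_real[-> e0].
have [N hN] := h _ e0.
by exists N => // n /hN /=; rewrite rnormE ltcR.
Qed.

Lemma nbhs_rnormP x (P : set V) :
  nbhs x P <-> exists2 e : R, 0 < e & forall y, rnorm (x - y) < e -> P y.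
Proof.
rewrite -nbhs_nbhs_norm; split=> [[e /= /posc_real[-> e0] h]|[e e0 h]].
  by exists (complex.Re e) => // y hy; apply: h; rewrite /= rnormE ltcR.
by exists e%:C => /= [|y]; rewrite ?ltcR// /ball_ /= rnormE ltcR; apply: h.
Qed.

Lemma dense_rnorm (A : set V) : dense A ->
  forall x (e : R), 0 < e -> exists2 a, A a & rnorm (x - a) < e.
Proof.
move=> dA x e e0; have [||a [/= xa Aa]] := dA (ball x e%:C).
- by exists x; apply: ballxx; rewrite ltcR.
- by apply: ball_open; rewrite ltcR.
exists a => //.
by move: xa; rewrite -ball_normE /= rnormE ltcR.
Qed.

Lemma cvg_rnorm_unique u x y : (u @ \oo --> x) -> (u @ \oo --> y) -> x = y.
Proof. by move=> ux uy; apply: (cvg_unique _ ux uy). Qed.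

Lemma rnorm_cvg_le_near u x (K : R) : (u @ \oo --> x) ->
  (exists N, forall n, (N <= n)%N -> rnorm (u n) <= K) -> rnorm x <= K.
Proof.
move=> /cvg_rnormP h [N' hK]; apply/ler_addgt0Pr => e e0.
have [N /(_ _ (leq_maxl N N'))] := h _ e0.
have := hK _ (leq_maxr N N').
have := ler_rdist (u (maxn N N')) x 0; rewrite !subr0 rdistC; lra.
Qed.

Lemma rnorm_cvg_le u x (K : R) : (u @ \oo --> x) -> (forall n, rnorm (u n) <= K) ->
  rnorm x <= K.
Proof. by move=> ux h; apply: (rnorm_cvg_le_near ux); exists 0%N. Qed.

Lemma cvg_bounded u x : (u @ \oo --> x) -> exists N, forall n, (N <= n)%N -> rnorm (u n) <= rnorm x + 1.
Proof.
move=> /cvg_rnormP /(_ _ ltr01) [N hN]; exists N => n /hN.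
have := ler_rdist x (u n) 0; rewrite !subr0; lra.
Qed.

Lemma cvg_sumr I (r : seq I) (f : I -> nat -> V) (l : I -> V) :
  (forall i, f i @ \oo --> l i) ->
  (fun n => \sum_(i <- r) f i n) @ \oo --> \sum_(i <- r) l i.
Proof.
move=> fl; elim: r => [|i r IH].
  by under eq_fun do rewrite big_nil; rewrite big_nil; exact: cvg_cst.
by under eq_fun do rewrite big_cons; rewrite big_cons; apply: cvgD.
Qed.

Lemma cvg_scale (c : R[i]) u x : (u @ \oo --> x) -> (fun n => c *: u n) @ \oo --> c *: x.
Proof. exact: cvgZr. Qed.

Lemma rnorm_eq0_small x (K : R) : (forall e, 0 < e -> rnorm x <= K * e) -> x = 0.
Proof.
move=> h; apply/eqP; rewrite -rnorm_eq0 eq_le rnorm_ge0 andbT.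
apply/ler_addgt0Pr => e e0; rewrite add0r.
have K0 : 0 < `|K| + 1 by rewrite ltr_wpDl.
have := h (e / (`|K| + 1)); rewrite divr_gt0// => /(_ isT) /le_trans; apply.
rewrite mulrCA -[leRHS]mulr1 ler_pM2l// ler_pdivrMr// mul1r.
have := ler_norm K; lra.
Qed.

End RealNorm.

Section RealNormComplete.
Variables (R : realType) (V : completeNormedModType R[i]).

Lemma cauchy_rnorm_cvg (u : nat -> V) :
  (forall e : R, 0 < e -> exists N, forall n m, (N <= n)%N -> (N <= m)%N ->
    rnorm (u n - u m) < e) -> exists x : V, u @ \oo --> x.
Proof.
move=> h; apply/cvg_ex/cauchy_cvgP/cauchy_ballP => e /posc_real[-> e0].
have [N hN] := h _ e0.
exists (u @` [set n | N <= n]%N, u @` [set n | N <= n]%N).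
  by split; exists N => // n Nn; exists n.
move=> -[_ _] /= [[n Nn <-] [m Nm <-]].
by rewrite -ball_normE /= rnormE ltcR; apply: hN.
Qed.

End RealNormComplete.

Section BoundedLinear.
Variables (R : realType) (V W : normedModType R[i]).

Lemma linear_continuousP (f : {linear V -> W}) :
  continuous f <-> exists K : R, forall x, rnorm (f x) <= K * rnorm x.
Proof.
split=> [cf|[K hK]].
  have /cvgrPdistC_lt/(_ _ (@ltr01 _)) : f x @[x --> 0] --> f 0 by exact: cf.
  rewrite linear0 => /nbhs_rnormP[e e0 h].
  exists (2 / e) => x.
  have [->|x0] := eqVneq x 0; first by rewrite linear0 !rnorm0 mulr0.
  have nx : 0 < rnorm x by rewrite rnorm_gt0.
  pose l := e / (2 * rnorm x).
  have l0 : 0 < l by rewrite /l divr_gt0 ?mulr_gt0.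
  have nl : rnorm (l%:C : R[i]^o) = l.
    by rewrite /rnorm ger0_norm// lecR ltW.
  have := h (l%:C *: x); rewrite sub0r rnormN rnormZ nl.
  have -> : l * rnorm x = e / 2.
    by rewrite /l; field; rewrite gt_eqF.
  rewrite subr0 rnormE linearZ /= rnormZ nl.
  rewrite -[1 : R[i]]/(1%:C) ltcR => /(_ ltac:(lra)) h2.
  rewrite -(ler_pM2l l0); apply: (le_trans (ltW h2)).
  rewrite /l le_eqVlt; apply/orP; left; apply/eqP; field.
  by rewrite !gt_eqF.
move=> x; apply/cvgrPdist_lt => e' /posc_real[-> ]; set e := complex.Re _ => e0.
apply/nbhs_rnormP; exists (e / (`|K| + 1)).
  by rewrite divr_gt0// ltr_wpDl.
move=> y; rewrite ltr_pdivlMr ?ltr_wpDl// => hy.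
rewrite -linearB rnormE ltcR; apply: le_lt_trans (hK _) _.
apply: le_lt_trans hy; rewrite mulrC; apply: ler_wpM2l; first exact: rnorm_ge0.
have := ler_norm K; lra.
Qed.

End BoundedLinear.

Section OperatorNorm.
Variables (R : realType) (E : completeNormedModType R[i]).

Lemma opnorm_le (f : {linear E -> E}) x (B : R) : (opnorm f <= B%:E)%E ->
  rnorm (f x) <= B * rnorm x.
Proof.
move=> fB; have [->|x0] := eqVneq x 0; first by rewrite linear0 !rnorm0 mulr0.
have nx : 0 < rnorm x by rewrite rnorm_gt0.
have nl : rnorm ((rnorm x)^-1%:C : R[i]^o) = (rnorm x)^-1.
  by rewrite /rnorm ger0_norm// lecR invr_ge0 ltW.
have : ((rnorm (f ((rnorm x)^-1%:C *: x)))%:E <= B%:E)%E.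
  apply: le_trans fB; apply: ereal_sup_ubound.
  by exists ((rnorm x)^-1%:C *: x) => //=; rewrite rnormZ nl mulVf// gt_eqF.
by rewrite lee_fin linearZ /= rnormZ nl mulrC ler_pdivrMr.
Qed.

Lemma opnorm_fin (f : {linear E -> E}) : continuous f ->
  exists2 B : R, 0 <= B & opnorm f = B%:E.
Proof.
move=> /linear_continuousP[K hK].
have h0 : (0 <= opnorm f)%E.
  apply: ereal_sup_ubound; exists 0; first by rewrite /= rnorm0.
  by rewrite linear0 rnorm0.
have h1 : (opnorm f <= `|K|%:E)%E.
  apply: ge_ereal_sup => _ [x /= x1 <-]; rewrite lee_fin (le_trans (hK x))//.
  apply: (@le_trans _ _ (`|K| * rnorm x)); first by rewrite ler_wpM2r ?rnorm_ge0 ?ler_norm.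
  by rewrite ler_piMr.
exists (fine (opnorm f)); first exact: fine_ge0.
rewrite fineK// ge0_fin_numE//; exact: le_lt_trans h1 (ltry _).
Qed.

End OperatorNorm.

(** * Complex numbers and roots of unity *)

Section ComplexModulus.
Variable R : realType.
Implicit Types (z w : R[i]) (r : R).
Local Notation cn z := (rnorm (z : R[i]^o)).

Lemma cnE z : `|z| = (cn z)%:C.
Proof. exact: (@rnormE R (R[i]^o)). Qed.

Lemma cnM z w : cn (z * w) = cn z * cn w.
Proof. exact: (@rnormZ R (R[i]^o)). Qed.

Lemma cn1 : cn (1 : R[i]) = 1.
Proof. by apply: complexI; rewrite -cnE normr1. Qed.

Lemma cn_real r : cn r%:C = `|r|.
Proof. by apply: complexI; rewrite -cnE normc_def /= expr0n addr0 sqrtr_sqr. Qed.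

Lemma cnV z : cn z^-1 = (cn z)^-1.
Proof. by apply: complexI; rewrite -cnE normfV cnE fmorphV. Qed.

Lemma cnX z n : cn (z ^+ n) = cn z ^+ n.
Proof. by elim: n => [|n IH]; rewrite ?expr0 ?cn1// !exprS cnM IH. Qed.

Lemma cnXz z (k : int) : cn (z ^ k) = cn z ^ k.
Proof. by case: k => n; rewrite ?NegzE -?exprnN -?exprnP ?cnV cnX. Qed.

Lemma cnC z : cn (conjc z) = cn z.
Proof. by apply: complexI; rewrite -!cnE normcJ. Qed.

Lemma circleE r z : circle r z <-> cn z = r.
Proof. by rewrite /circle /= cnE; split => [/complexI|->]. Qed.

Lemma cn_eq0 z : (cn z == 0) = (z == 0).
Proof. exact: (@rnorm_eq0 R (R[i]^o)). Qed.

Lemma unit_conj z : cn z = 1 -> conjc z = z^-1.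
Proof. by move=> z1; rewrite [RHS]invc_norm cnE z1 expr1n invr1 mul1r. Qed.

Lemma unit_neq0 z : cn z = 1 -> z != 0.
Proof. by rewrite -cn_eq0 => ->; rewrite oner_eq0. Qed.

Lemma conjcXz z (k : int) : conjc (z ^ k) = conjc z ^ k.
Proof. by rewrite -[LHS]/((@conjc R : {rmorphism _ -> _}) (z ^ k)) fmorphXz. Qed.

Lemma conjM z w : conjc (z * w) = conjc z * conjc w.
Proof. exact: (rmorphM (@conjc R)). Qed.

Lemma conj_sum I (r : seq I) (P : pred I) (f : I -> R[i]) :
  conjc (\sum_(i <- r | P i) f i) = \sum_(i <- r | P i) conjc (f i).
Proof. exact: (rmorph_sum (@conjc R)). Qed.

Lemma real_exprz r (k : int) : (r ^ k)%:C = r%:C ^ k.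
Proof. by rewrite fmorphXz. Qed.

Lemma sqr_cn z : z * conjc z = (cn z ^+ 2)%:C.
Proof. by rewrite -sqr_normc cnE rmorphXn. Qed.

Lemma cn_sqr z : cn z ^+ 2 = complex.Re z ^+ 2 + complex.Im z ^+ 2.
Proof. by apply: complexI; rewrite add_Re2_Im2 rmorphXn /= -cnE. Qed.

Lemma cn_natr n : cn (n%:R : R[i]) = n%:R.
Proof. by rewrite -(rmorph_nat (real_complex R)) cn_real ger0_norm. Qed.

Lemma sum_cn_delta K m : (m < K)%N ->
  \sum_(i < K) cn ((i == m :> nat)%:R : R[i]) ^+ 2 = 1.
Proof.
move=> mK; rewrite (bigD1 (Ordinal mK))//= eqxx cn1 expr1n big1 ?addr0// => i.
by rewrite -val_eqE /= => /negbTE ->; rewrite rnorm0 expr0n.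
Qed.

Lemma Re_le_cn z : `|complex.Re z| <= cn z.
Proof. by rewrite -lecR -cnE normc_ge_Re. Qed.

Lemma Im_le_cn z : `|complex.Im z| <= cn z.
Proof.
have := Re_le_cn ('i * z); rewrite cnM.
have -> : cn 'i = 1.
  by apply: complexI; rewrite -cnE normc_def /= expr0n expr1n add0r sqrtr1.
by rewrite mul1r; case: z => a b /=; rewrite !mul0r mul1r sub0r normrN.
Qed.

Lemma cn_le_ReIm z : cn z <= `|complex.Re z| + `|complex.Im z|.
Proof.
rewrite -(@ler_pXn2r _ 2)// ?nnegrE ?rnorm_ge0 ?addr_ge0// cn_sqr.
rewrite sqrrD !real_normK ?num_real//.
by rewrite lerD2r lerDl mulrn_wge0// mulr_ge0.
Qed.

Lemma ex_direction z : exists2 w, cn w = 1 & z = (cn z)%:C * w.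
Proof.
have [->|z0] := eqVneq z 0; first by exists 1; rewrite ?cn1// rnorm0 mul0r.
exists (z / (cn z)%:C); last by rewrite mulrC divfK// -cnE normr_eq0.
by rewrite cnM cnV cn_real ger0_norm ?rnorm_ge0// divff// cn_eq0.
Qed.

Lemma int_natB (n : int) : exists p q : nat, n = p%:Z - q%:Z.
Proof.
by case: n => n; [exists n, 0%N; rewrite subr0|exists 0%N, n.+1; rewrite sub0r NegzE].
Qed.

(** As [R[i]] is algebraically closed, [X^(n + 1) - 1] has [n + 1] distinct
    roots. *)
Lemma ex_prim_root n : exists z : R[i], n.+1.-primitive_root z.
Proof.
pose p : {poly R[i]} := ('X^(n.+1) - 1)%R; have [r Dp] := closed_field_poly_normal p.
rewrite (monicP _) ?monicXnsubC // scale1r in Dp.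
have rn1: all n.+1.-unity_root r by apply/allP=> z; rewrite -root_prod_XsubC -Dp.
have sz_r: (n.+1 < (size r).+1)%N.
  by rewrite -(size_prod_XsubC r id) -Dp size_XnsubC.
have [||z] := hasP (has_prim_root _ rn1 _ sz_r); [by []| |by exists z].
by rewrite -separable_prod_XsubC -Dp separable_Xn_sub_1 // pnatr_eq0 -lt0n.
Qed.

Definition uroot n : R[i] := xget 0 [set z : R[i] | n.+1.-primitive_root z].

Lemma urootP n : n.+1.-primitive_root (uroot n).
Proof.
have [z zP] := ex_prim_root n.
by apply: (@xgetPex _ 0 [set z : R[i] | n.+1.-primitive_root z]); exists z.
Qed.

Lemma cn_unity z n : z ^+ n.+1 = 1 -> cn z = 1.
Proof.
move=> /(congr1 (fun z => cn z)); rewrite cnX cn1 => h.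
by apply/eqP; rewrite -(@pexpr_eq1 _ _ n.+1) ?rnorm_ge0// h.
Qed.

Lemma cn_uroot n l : cn (uroot n ^+ l) = 1.
Proof. by rewrite cnX (cn_unity (prim_expr_order (urootP n))) expr1n. Qed.

(** The orthogonality of characters of the group of roots of unity, for small
    exponents. *)
Lemma mean_uroot n (k : int) : (`|k| <= n)%N ->
  n.+1%:R^-1 * \sum_(l < n.+1) (uroot n ^+ l) ^ k = (k == 0)%:R.
Proof.
move=> kn; have [->|k0] := eqVneq k 0.
  under eq_bigr do rewrite expr0z.
  by rewrite sumr_const card_ord mulVf// pnatr_eq0.
set w := uroot n ^ k.
have w0 := unit_neq0 (cn_unity (prim_expr_order (urootP n))).
have -> : \sum_(l < n.+1) (uroot n ^+ l) ^ k = \sum_(l < n.+1) w ^+ l.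
  by apply: eq_bigr => l _; rewrite !exprnP exprz_exp mulrC -exprz_exp.
have : w ^+ n.+1 - 1 = 0.
  by rewrite exprnP exprz_exp mulrC -exprz_exp -exprnP (prim_expr_order (urootP n)) exp1rz subrr.
rewrite subrX1 => /eqP; rewrite mulf_eq0 => /orP[|/eqP->]; last by rewrite mulr0.
rewrite subr_eq0 => /eqP w1; exfalso; move: w1.
have absw : uroot n ^+ `|k| = 1 -> False.
  move/eqP; rewrite -(prim_order_dvd (urootP n)) => /dvdn_leq.
  by rewrite absz_gt0 k0 => /(_ isT); rewrite ltnNge kn.
rewrite /w; case: k kn k0 absw {w} => m kn k0 absw //.
rewrite NegzE -exprnN => /eqP; rewrite invr_eq1 => /eqP h.
exact: absw.
Qed.

End ComplexModulus.

(** * Finitely supported elements, translations and twists *)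

(** The hypotheses on [E], with the boundedness of the linear maps involved
    expressed by constants. *)
Class HomSpace (R : realType) (E : completeNormedModType R[i])
    (coord : {linear E -> (int -> R[i]^o)}) : Prop := {
  coord_inj : injective coord;
  ex_coord : forall a : int -> R[i]^o, finsupp a -> exists x : E, coord x = a;
  finsupp_dense : forall (x : E) (e : R), 0 < e ->
    exists2 a : E, finsupp (coord a) & rnorm (x - a) < e;
  coord_bounded : forall n : int, exists K : R, forall x : E,
    rnorm (coord x n : R[i]^o) <= K * rnorm x;
  psi_bounded : exists2 C : R, 0 <= C & forall (z : R[i]) (x : E),
    rnorm (z : R[i]^o) = 1 ->
    exists2 y : E, coord y = psi z (coord x) & rnorm y <= C * rnorm x
}.

Section FiniteSupport.
Variables (R : realType) (E : completeNormedModType R[i]).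
Variable coord : {linear E -> (int -> R[i]^o)}.

Definition translate (m : int) (x : E) : E :=
  ofseq coord (fun n => coord x (n - m)).

Definition basis (k : int) : E := ofseq coord (delta R k).

Definition twist (z : R[i]) (x : E) : E := restr coord (psi z) x.

Definition twist_norm : R := xget 0 [set C : R | 0 <= C /\ forall (z : R[i]) (x : E),
    rnorm (z : R[i]^o) = 1 ->
    exists2 y : E, coord y = psi z (coord x) & rnorm y <= C * rnorm x].

Context {HE : HomSpace coord}.
Local Notation F x := (finsupp (coord x)).
Local Notation U := translate.
Local Notation ee := basis.
Local Notation cn z := (rnorm (z : R[i]^o)).

Lemma coordP (x y : E) : (forall n, coord x n = coord y n) -> x = y.
Proof. by move=> h; apply: coord_inj; apply: funext. Qed.

Lemma ofseqE (x : E) a : coord x = a -> ofseq coord a = x.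
Proof.
move=> xa; apply: coord_inj.
by rewrite (xgetPex 0 (P := [set y | coord y = a])); last by exists x.
Qed.

Lemma coord0 n : coord (0 : E) n = 0. Proof. by rewrite linear0. Qed.

Lemma coordD x y n : coord (x + y) n = coord x n + coord y n.
Proof. by rewrite linearD. Qed.

Lemma coordN x n : coord (- x) n = - coord x n.
Proof. by rewrite linearN. Qed.

Lemma coordB x y n : coord (x - y) n = coord x n - coord y n.
Proof. by rewrite coordD coordN. Qed.

Lemma coordZ (l : R[i]) x n : coord (l *: x) n = l * coord x n.
Proof. by rewrite linearZ. Qed.

Lemma coord_sum I (r : seq I) (P : pred I) (f : I -> E) n :
  coord (\sum_(i <- r | P i) f i) n = \sum_(i <- r | P i) coord (f i) n.
Proof.
elim/big_rec2: _ => [|i y x _ <-]; first exact: coord0.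
exact: coordD.
Qed.

Lemma finsupp_comb (a b : int -> R[i]^o) (l : R[i]) :
  finsupp a -> finsupp b -> finsupp (fun n => l * a n + b n : R[i]^o).
Proof.
move=> fa fb; apply: (@sub_finite_set _ _ ([set n | a n != 0] `|` [set n | b n != 0])).
  move=> n /=; have [->|] := eqVneq (a n) 0; last by left.
  by rewrite mulr0 add0r; right.
by rewrite finite_setU.
Qed.

Lemma F_comb (l : R[i]) x y : F x -> F y -> F (l *: x + y).
Proof.
move=> fx fy; have := finsupp_comb l fx fy.
by congr finsupp; apply: funext => n; rewrite coordD coordZ.
Qed.

Lemma F0 : F (0 : E).
Proof.
rewrite /finsupp (_ : [set _ | _] = set0)//.
by apply/seteqP; split => n //=; rewrite coord0 eqxx.
Qed.

Lemma FD x y : F x -> F y -> F (x + y).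
Proof. by move=> fx fy; rewrite -[x]scale1r; apply: F_comb. Qed.

Lemma FZ (l : R[i]) x : F x -> F (l *: x).
Proof. by move=> fx; rewrite -[_ *: _]addr0; apply: F_comb => //; exact: F0. Qed.

Lemma FN x : F x -> F (- x).
Proof. by rewrite -scaleN1r; exact: FZ. Qed.

Lemma FB x y : F x -> F y -> F (x - y).
Proof. by move=> fx /FN fy; exact: FD. Qed.

Lemma F_sum I (r : seq I) (P : pred I) (f : I -> E) :
  (forall i, P i -> F (f i)) -> F (\sum_(i <- r | P i) f i).
Proof. by move=> h; elim/big_ind: _ => // [|x y]; [exact: F0|exact: FD]. Qed.

Lemma finsupp_delta k : finsupp (delta R k).
Proof.
apply: (@sub_finite_set _ _ [set k]); last exact: finite_set1.
move=> n /=; rewrite /delta; case: (n =P k) => //.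
by rewrite eqxx.
Qed.

Lemma coord_ee k n : coord (ee k) n = (n == k)%:R.
Proof.
have [x xk] := ex_coord (finsupp_delta k).
by rewrite /ee (ofseqE xk) xk.
Qed.

Lemma F_ee k : F (ee k).
Proof.
have [x xk] := ex_coord (finsupp_delta k).
by rewrite /ee (ofseqE xk) xk; exact: finsupp_delta.
Qed.

Lemma ee_neq0 k : ee k != 0.
Proof.
apply/eqP => /(congr1 (fun x => coord x k)).
by rewrite coord_ee coord0 eqxx => /eqP; rewrite oner_eq0.
Qed.

Lemma ee_gt0 k : 0 < rnorm (ee k).
Proof. by rewrite rnorm_gt0 ee_neq0. Qed.

Lemma finsupp_shift (a : int -> R[i]^o) (m : int) : finsupp a -> finsupp (fun n => a (n - m)).
Proof.
rewrite /finsupp => fa.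
have -> : [set n | a (n - m) != 0] = (fun n => n + m) @` [set n | a n != 0].
  apply/seteqP; split => n /=.
    by move=> h; exists (n - m) => //; rewrite subrK.
  by move=> [k ak <-]; rewrite addrK.
exact: finite_image.
Qed.

Lemma coord_tr_fun m x : F x -> coord (U m x) = (fun n => coord x (n - m)).
Proof.
move=> fx; have [y ym] := ex_coord (finsupp_shift m fx).
by rewrite /translate (ofseqE ym).
Qed.

Lemma coord_tr m x n : F x -> coord (U m x) n = coord x (n - m).
Proof. by move=> fx; rewrite coord_tr_fun. Qed.

Lemma F_tr m x : F x -> F (U m x).
Proof. by move=> fx; rewrite coord_tr_fun//; exact: finsupp_shift. Qed.

Lemma trZ m (l : R[i]) x : F x -> U m (l *: x) = l *: U m x.
Proof.
by move=> fx; apply: coordP => n; rewrite coordZ !coord_tr ?coordZ//; exact: FZ.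
Qed.

Lemma trD m x y : F x -> F y -> U m (x + y) = U m x + U m y.
Proof.
by move=> fx fy; apply: coordP => n; rewrite coordD !coord_tr ?coordD//; exact: FD.
Qed.

Lemma trB m x y : F x -> F y -> U m (x - y) = U m x - U m y.
Proof.
by move=> fx fy; apply: coordP => n; rewrite coordB !coord_tr ?coordB//; exact: FB.
Qed.

Lemma tr_sum m I (r : seq I) (P : pred I) (f : I -> E) :
  (forall i, P i -> F (f i)) ->
  U m (\sum_(i <- r | P i) f i) = \sum_(i <- r | P i) U m (f i).
Proof.
move=> h; apply: coordP => n; rewrite coord_tr; last exact: F_sum.
rewrite !coord_sum; apply: eq_bigr => i Pi.
by rewrite coord_tr//; exact: h.
Qed.

Lemma tr_tr m n x : F x -> U m (U n x) = U (m + n) x.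
Proof.
move=> fx; apply: coordP => k; rewrite !coord_tr//; last exact: F_tr.
by congr (coord x _); ring.
Qed.

Lemma tr0 x : F x -> U 0 x = x.
Proof. by move=> fx; apply: coordP => k; rewrite coord_tr// subr0. Qed.

Lemma tr_ee m k : U m (ee k) = ee (k + m).
Proof.
apply: coordP => n; rewrite coord_tr ?coord_ee; last exact: F_ee.
by rewrite subr_eq.
Qed.

Lemma F_decomp x : F x ->
  exists2 s : seq int, uniq s & x = \sum_(n <- s) coord x n *: ee n.
Proof.
move=> /finite_seqP[s xs]; exists (undup s); first exact: undup_uniq.
apply: coordP => n; rewrite coord_sum.
have [ns|ns] := boolP (n \in undup s).
  rewrite (bigD1_seq n)//= ?undup_uniq// coordZ coord_ee eqxx mulr1.
  rewrite big1 ?addr0// => i; rewrite eq_sym => /negbTE ni.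
  by rewrite coordZ coord_ee ni mulr0.
have -> : coord x n = 0.
  apply/eqP; apply: contraNT ns => h; rewrite mem_undup.
  suff : [set` s] n by [].
  by rewrite -xs.
rewrite big_seq big1// => i si; rewrite coordZ coord_ee.
by case: (n =P i) => [ni|]; rewrite ?mulr0//; rewrite ni si in ns.
Qed.

Lemma F_ind (P : E -> Prop) : P 0 ->
  (forall c k x, P x -> P (c *: ee k + x)) -> forall x, F x -> P x.
Proof.
move=> P0 Pc x /F_decomp[s _ ->].
by elim/big_rec: _ => // i y _; exact: Pc.
Qed.

Lemma twist_normP : 0 <= twist_norm /\ forall (z : R[i]) (x : E),
    cn z = 1 -> exists2 y : E, coord y = psi z (coord x) & rnorm y <= twist_norm * rnorm x.
Proof.
rewrite /twist_norm; set A := (X in xget _ X).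
suff : A (xget 0 A) by [].
by have [C C0 h] := psi_bounded; apply: xgetPex; exists C.
Qed.

Lemma twist_norm_ge0 : 0 <= twist_norm. Proof. by case: twist_normP. Qed.

Lemma twist_le (z : R[i]) x : cn z = 1 -> rnorm (twist z x) <= twist_norm * rnorm x.
Proof.
move=> z1; have [_ /(_ z x z1) [y yx]] := twist_normP.
by rewrite /twist /restr (ofseqE yx).
Qed.

Lemma coord_tw (z : R[i]) x n : cn z = 1 -> coord (twist z x) n = coord x n * z ^ n.
Proof.
move=> z1; have [_ /(_ z x z1) [y yx _]] := twist_normP.
by rewrite /twist /restr (ofseqE yx) yx.
Qed.

Lemma twD (z : R[i]) x y : cn z = 1 -> twist z (x + y) = twist z x + twist z y.
Proof.
by move=> z1; apply: coordP => n; rewrite !(coordD, coord_tw)// mulrDl.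
Qed.

Lemma twZ (z l : R[i]) x : cn z = 1 -> twist z (l *: x) = l *: twist z x.
Proof.
by move=> z1; apply: coordP => n; rewrite !(coordZ, coord_tw)// mulrA.
Qed.

Lemma tw0 (z : R[i])  : cn z = 1 -> twist z 0 = 0.
Proof. by move=> z1; apply: coordP => n; rewrite coord_tw// !coord0 mul0r. Qed.

Lemma twB (z : R[i]) x y : cn z = 1 -> twist z (x - y) = twist z x - twist z y.
Proof.
by move=> z1; apply: coordP => n; rewrite !(coordB, coord_tw)// mulrBl.
Qed.

Lemma tw_ee (z : R[i]) k : cn z = 1 -> twist z (ee k) = z ^ k *: ee k.
Proof.
move=> z1; apply: coordP => n; rewrite coord_tw// coordZ coord_ee.
by case: (n =P k) => [->|]; rewrite ?mul0r ?mulr0 ?mul1r ?mulr1.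
Qed.

End FiniteSupport.

(** * Averages of twists *)

Section Averages.
Variables (R : realType) (E : completeNormedModType R[i]).
Variable coord : {linear E -> (int -> R[i]^o)}.
Context {HE : HomSpace coord}.
Local Notation F x := (finsupp (coord x)).
Local Notation U := (translate coord).
Local Notation ee := (basis coord).
Local Notation tw := (twist coord).
Local Notation C := (twist_norm coord).
Local Notation cn z := (rnorm (z : R[i]^o)).

(** The discrete form of the integral over the unit circle. *)
Definition mean (L : nat) (f : R[i] -> E) : E :=
  (L.+1%:R^-1 : R[i]) *: \sum_(l < L.+1) f (uroot R L ^+ l).

Lemma eq_mean L (f g : R[i] -> E) : (forall z, cn z = 1 -> f z = g z) ->
  mean L f = mean L g.
Proof.
by move=> fg; congr (_ *: _); apply: eq_bigr => l _; rewrite fg// cn_uroot.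
Qed.

Lemma mean_comb L (c : R[i]) f g :
  mean L (fun z => c *: f z + g z) = c *: mean L f + mean L g.
Proof.
rewrite /mean big_split /= -scaler_sumr scalerDr scalerA mulrC -scalerA.
by [].
Qed.

Lemma mean0 L : mean L (fun=> 0) = 0.
Proof. by rewrite /mean big1 ?scaler0. Qed.

Lemma meanZ L (c : R[i]) f : mean L (fun z => c *: f z) = c *: mean L f.
Proof.
have := mean_comb L c f (fun=> 0); rewrite mean0 addr0 => <-.
by apply: eq_mean => z _; rewrite addr0.
Qed.

Lemma mean_sum L I (r : seq I) (f : I -> R[i] -> E) :
  mean L (fun z => \sum_(i <- r) f i z) = \sum_(i <- r) mean L (f i).
Proof. by rewrite /mean exchange_big scaler_sumr. Qed.

Lemma mean_le L (f : R[i] -> E) (g : R[i] -> R) :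
  (forall z, cn z = 1 -> rnorm (f z) <= g z) ->
  rnorm (mean L f) <= L.+1%:R^-1 * \sum_(l < L.+1) g (uroot R L ^+ l).
Proof.
move=> fg; rewrite rnormZ cnV cn_natr ler_wpM2l ?invr_ge0//.
rewrite (le_trans (rnorm_sum _ _ _))// ler_sum// => l _.
by apply: fg; rewrite cn_uroot.
Qed.

Lemma mean_const L (g : R) : L.+1%:R^-1 * \sum_(l < L.+1) g = g.
Proof.
rewrite sumr_const card_ord -[g *+ _]mulr_natl mulrA mulVf ?mul1r// pnatr_eq0.
Qed.

(** The exponents are pairwise distinct modulo the order [L + 1] of the root,
    so that the formula is exact. *)
Lemma parseval K (u : nat -> R[i]) L : (K <= L.+1)%N ->
  L.+1%:R^-1 * \sum_(l < L.+1)
     cn (\sum_(i < K) u i * (uroot R L ^+ l) ^ (- i%:Z)) ^+ 2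
  = \sum_(i < K) cn (u i) ^+ 2.
Proof.
move=> KL; apply: complexI.
rewrite [LHS]rmorphM /= fmorphV rmorph_nat [RHS]rmorph_sum rmorph_sum /=.
under eq_bigr => l _.
  rewrite -sqr_cn conj_sum mulr_suml.
  under eq_bigr => i _.
    rewrite mulr_sumr.
    under eq_bigr => j _.
      rewrite conjM conjcXz (unit_conj (cn_uroot _ _ _)) mulrACA.
      rewrite exprz_inv opprK -expfzDr ?unit_neq0 ?cn_uroot// addrC.
      over.
    over.
  over.
rewrite exchange_big mulr_sumr; apply: eq_bigr => i _ /=.
rewrite exchange_big mulr_sumr (bigD1 i)//= [X in _ + X]big1 ?addr0.
  by rewrite -mulr_sumr mulrCA mean_uroot ?subrr// eqxx mulr1 sqr_cn.
move=> j ji; rewrite -mulr_sumr mulrCA mean_uroot; last first.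
  by have := ltn_ord i; have := ltn_ord j; lia.
by rewrite subr_eq0 eqz_nat -[(_ == _)%N]/(j == i) (negbTE ji) mulr0.
Qed.

(** The mean is exact once [L] is at least all the distances to [m] of the
    indices in the support. *)
Lemma mean_twist_F m a : F a -> exists N, forall L, (N <= L)%N ->
  mean L (fun z => z ^ (- m) *: tw z a) = coord a m *: ee m.
Proof.
move: a; apply: F_ind.
  exists 0%N => L _; rewrite coord0 scale0r -[RHS](mean0 L); apply: eq_mean => z z1.
  by rewrite tw0// scaler0.
move=> c k x [N hN]; exists (maxn N `|k - m|) => L; rewrite geq_max => /andP[NL kL].
rewrite coordD coordZ coord_ee scalerDl -(hN L NL).
rewrite (@eq_mean _ _ (fun z => c *: (z ^ (k - m) *: ee k) + z ^ (- m) *: tw z x)); last first.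
  move=> z z1; rewrite twD// twZ// tw_ee// scalerDr; congr (_ + _).
  by rewrite !scalerA expfzDr ?unit_neq0// [z ^ (- m) * c]mulrC -mulrA [z ^ (- m) * _]mulrC.
rewrite mean_comb; congr (_ + _).
rewrite /mean -scaler_suml [X in c *: X]scalerA mean_uroot// scalerA subr_eq0 eq_sym.
by case: (m =P k) => [->//|_]; rewrite !mulr0 !scale0r.
Qed.

Lemma mean_twist_le L m x : rnorm (mean L (fun z => z ^ (- m) *: tw z x)) <= C * rnorm x.
Proof.
rewrite -(mean_const L (C * rnorm x)); apply: (@mean_le L _ (fun=> C * rnorm x)) => z z1.
by rewrite rnormZ cnXz z1 exp1rz mul1r twist_le.
Qed.

(** The coefficients of [x] are the Fourier coefficients of [z |-> tw z x]:
    this is exact on finite sums, and passes to the limit because the means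
    are bounded uniformly in [L]. *)
Lemma mean_twist_cvg m x :
  (fun L => mean L (fun z => z ^ (- m) *: tw z x)) @ \oo --> coord x m *: ee m.
Proof.
apply/cvg_rnormP => e e0.
have [K hK] := coord_bounded m.
pose B := C + `|K| * rnorm (ee m) + 1.
have B0 : 0 < B.
  by rewrite ltr_wpDl// addr_ge0 ?mulr_ge0 ?rnorm_ge0 ?twist_norm_ge0.
have [a Fa xa] := finsupp_dense x (divr_gt0 e0 B0).
have [N hN] := mean_twist_F m Fa.
exists N => L NL.
have -> : mean L (fun z => z ^ (- m) *: tw z x) - coord x m *: ee m =
   mean L (fun z => z ^ (- m) *: tw z (x - a)) - coord (x - a) m *: ee m.
  rewrite (@eq_mean _ (fun z => z ^ (- m) *: tw z (x - a))
     (fun z => (-1) *: (z ^ (- m) *: tw z a) + z ^ (- m) *: tw z x)); last first.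
    by move=> z z1; rewrite twB// scalerBr scaleN1r addrC.
  rewrite mean_comb hN// coordB scalerBl scaleN1r opprB.
  by rewrite addrACA [- _ + _]addrC subrr add0r.
apply: le_lt_trans (ler_rnormB _ _) _.
rewrite [rnorm (_ *: ee m)]rnormZ.
apply: (@le_lt_trans _ _ ((C + `|K| * rnorm (ee m)) * rnorm (x - a))).
  rewrite mulrDl lerD ?mean_twist_le// mulrAC ler_wpM2r ?rnorm_ge0//.
  by rewrite (le_trans (hK _))// ler_wpM2r ?rnorm_ge0// ler_norm.
move: xa; rewrite ltr_pdivlMr// => xa; apply: le_lt_trans xa.
rewrite mulrC ler_wpM2l ?rnorm_ge0//.
by rewrite /B lerDl.
Qed.

(** Integrating [z |-> sum_k z^-k tw z (x k)] against [u(z) conj (v(z))],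
    where [u] and [v] are trigonometric polynomials, extracts a block of
    coefficients; the integral of the weight is controlled by Parseval's
    formula. *)
Lemma toeplitz_extraction (s : seq int) (x : int -> E) (B : R) K (u v : nat -> R[i]) :
  (forall z : R[i], cn z = 1 -> rnorm (\sum_(k <- s) z ^ (- k) *: tw z (x k)) <= B) ->
  rnorm (\sum_(k <- s) \sum_(i < K) \sum_(j < K) (u i * conjc (v j)) *:
     (coord (x k) (k + (i%:Z - j%:Z)) *: ee (k + (i%:Z - j%:Z))))
  <= B * ((\sum_(i < K) cn (u i) ^+ 2 + \sum_(j < K) cn (v j) ^+ 2) / 2).
Proof.
move=> hB.
have B0 : 0 <= B by apply: le_trans (hB 1 (cn1 R)); exact: rnorm_ge0.
pose p (w : nat -> R[i]) z := \sum_(i < K) w i * z ^ (- i%:Z).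
pose q z := p u z * conjc (p v z).
pose X z := \sum_(k <- s) z ^ (- k) *: tw z (x k).
have qE z : cn z = 1 -> q z = \sum_(i < K) \sum_(j < K) (u i * conjc (v j)) * z ^ (- (i%:Z - j%:Z)).
  move=> z1; rewrite /q /p conj_sum mulr_suml; apply: eq_bigr => i _.
  rewrite mulr_sumr; apply: eq_bigr => j _.
  rewrite conjM conjcXz (unit_conj z1) mulrACA; congr (_ * _).
  by rewrite exprz_inv opprK -expfzDr ?unit_neq0// opprB addrC.
have cvX : (fun L => mean L (fun z => q z *: X z)) @ \oo -->
  \sum_(k <- s) \sum_(i < K) \sum_(j < K) (u i * conjc (v j)) *:
     (coord (x k) (k + (i%:Z - j%:Z)) *: ee (k + (i%:Z - j%:Z))).
  have -> : (fun L => mean L (fun z => q z *: X z)) =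
     (fun L => \sum_(k <- s) \sum_(i < K) \sum_(j < K) (u i * conjc (v j)) *:
       mean L (fun z => z ^ (- (k + (i%:Z - j%:Z))) *: tw z (x k))).
    apply: funext => L.
    under eq_bigr do under eq_bigr do under eq_bigr do rewrite -meanZ.
    under eq_bigr do under eq_bigr do rewrite -mean_sum.
    under eq_bigr do rewrite -mean_sum.
    rewrite -mean_sum; apply: eq_mean => z z1.
    rewrite qE// /X scaler_sumr; apply: eq_bigr => k _.
    rewrite scaler_suml; apply: eq_bigr => i _.
    rewrite scaler_suml; apply: eq_bigr => j _.
    by rewrite !scalerA -mulrA -expfzDr ?unit_neq0// -opprD [k + _]addrC.
  apply: cvg_sumr => k; apply: cvg_sumr => i; apply: cvg_sumr => j.
  by apply: cvg_scale; exact: mean_twist_cvg.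
apply: (rnorm_cvg_le_near cvX); exists K => L KL.
rewrite [leRHS](_ : _ = L.+1%:R^-1 * \sum_(l < L.+1)
   B * ((cn (p u (uroot R L ^+ l)) ^+ 2 + cn (p v (uroot R L ^+ l)) ^+ 2) / 2)); last first.
  rewrite -mulr_sumr -mulr_suml big_split /=.
  by rewrite -(@parseval K u L) 1?leqW// -(@parseval K v L) 1?leqW// /p; ring.
apply: (@mean_le L _ (fun z => B * ((cn (p u z) ^+ 2 + cn (p v z) ^+ 2) / 2))) => z z1.
rewrite rnormZ mulrC; apply: ler_pM; rewrite ?rnorm_ge0//; first exact: hB.
rewrite /q cnM cnC.
have := sqr_ge0 (cn (p u z) - cn (p v z)); lra.
Qed.

End Averages.

(** * Multipliers and Fejér means *)

Section FejerSums.

Lemma card_diagonal K n :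
  (\sum_(i < K) \sum_(j < K) (i == j + n :> nat) = K - n)%N.
Proof.
rewrite exchange_big /=.
have step (j : 'I_K) : (\sum_(i < K) (i == j + n :> nat) = (j < K - n)%N)%N.
  have [jn|jn] := ltnP j (K - n).
    have h : (j + n < K)%N by lia.
    rewrite (bigD1 (Ordinal h))//= eqxx big1 ?addn0// => i.
    by rewrite -val_eqE /= => /negbTE ->.
  rewrite big1// => i _; apply/eqP; rewrite eqb0; have := ltn_ord i.
  by apply: contraTN => /eqP ->; lia.
under eq_bigr do rewrite step.
rewrite -[RHS](card_ord (K - n)) -sum1_card.
rewrite (big_ord_widen K (fun=> 1%N) (leq_subr n K)) big_mkcond /=.
by rewrite [RHS]big_mkcond; apply: eq_bigr => j _ /=; case: ltnP.
Qed.

Lemma card_zdiagonal K (n : int) :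
  (\sum_(i < K) \sum_(j < K) (i%:Z - j%:Z == n)%R = K - `|n|)%N.
Proof.
case: n => n.
  rewrite absz_nat -card_diagonal; apply: eq_bigr => i _; apply: eq_bigr => j _.
  by congr nat_of_bool; lia.
rewrite NegzE abszN absz_nat -card_diagonal [RHS]exchange_big.
apply: eq_bigr => i _; apply: eq_bigr => j _.
by congr nat_of_bool; lia.
Qed.

(** A difference [n] occurs [K - |n|] times in a square of side [K]: this
    turns the double sums of the Toeplitz inequalities into sums with Fejér's
    weights. The bound [N] of the indices is independent of [K], so that sums
    for different [K] can be compared. *)
Lemma fejer_sum (V : zmodType) (f : int -> V) K N : (K <= N)%N ->
  \sum_(i < K) \sum_(j < K) f (i%:Z - j%:Z) =
  \sum_(l < (2 * N).+1) f (l%:Z - N%:Z) *+ (K - `|(l%:Z - N%:Z)%R|).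
Proof.
move=> KN.
under [RHS]eq_bigr => l _.
  rewrite -card_zdiagonal -sumrMnr.
  under eq_bigr do rewrite -sumrMnr.
  over.
rewrite /= [RHS]exchange_big; apply: eq_bigr => i _ /=.
rewrite [RHS]exchange_big; apply: eq_bigr => j _ /=.
have h : (i + N - j < (2 * N).+1)%N by have := ltn_ord i; have := ltn_ord j; lia.
have iN := ltn_ord i; have jN := ltn_ord j.
rewrite (bigD1 (Ordinal h))//= big1 ?addr0; last first.
  move=> l; rewrite -val_eqE /= => lN; case: eqP => //= e; exfalso.
  by move: lN; lia.
have -> : (i + N - j)%N%:Z - N%:Z = i%:Z - j%:Z by lia.
by rewrite eqxx.
Qed.

End FejerSums.

Section Multipliers.
Variables (R : realType) (E : completeNormedModType R[i]).
Variable coord : {linear E -> (int -> R[i]^o)}.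
Context {HE : HomSpace coord}.
Local Notation F x := (finsupp (coord x)).
Local Notation U := (translate coord).
Local Notation ee := (basis coord).
Local Notation tw := (twist coord).
Local Notation C := (twist_norm coord).
Local Notation cn z := (rnorm (z : R[i]^o)).
Implicit Types (M : {linear E -> E}) (x y a : E).

Lemma mult_ee M k n : multiplier coord M ->
  coord (M (ee k)) n = symbol coord M (n - k).
Proof.
move=> [_ Mc]; rewrite /symbol -/(ee 0).
have step k' n' : coord (M (ee (k' + 1))) n' = coord (M (ee k')) (n' - 1).
  rewrite (Mc (ee k') (ee (k' + 1)))//; first exact: F_ee.
  by apply: funext => m; rewrite /seq_shift !coord_ee subr_eq.
elim/int_rect: k n => [|k IH|k IH] n; first by rewrite subr0.
  have -> : k.+1%:Z = k%:Z + 1 by lia.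
  by rewrite step IH; congr (coord _ _); rewrite opprD addrA addrAC.
have := step (- k.+1%:Z) (n + 1); rewrite addrK => <-.
have -> : - k.+1%:Z + 1 = - k%:Z by lia.
by rewrite IH; congr (coord _ _); lia.
Qed.

Lemma tw_sum (z : R[i]) I (r : seq I) (f : I -> E) : cn z = 1 ->
  tw z (\sum_(i <- r) f i) = \sum_(i <- r) tw z (f i).
Proof.
by move=> z1; elim/big_rec2: _ => [|i x y _ <-]; rewrite ?tw0// twD.
Qed.

Section Bounded.
Variables (M : {linear E -> E}) (B : R).
Hypothesis (Mm : multiplier coord M) (MB : forall x, rnorm (M x) <= B * rnorm x).

Lemma mult_norm_ge0 : 0 <= B.
Proof.
by rewrite -(@pmulr_lge0 _ (rnorm (ee 0))) ?ee_gt0// (le_trans _ (MB _))// rnorm_ge0.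
Qed.

(** The extraction is applied to [tw z (M (tw z^-1 a))], which is bounded by
    [C^2 B |a|]; on [a = sum_k a_k ee k], it is the sum of the
    [z^-k tw z (a_k M (ee k))]. *)
Lemma mult_toeplitz a K (u v : nat -> R[i]) : F a ->
  rnorm (\sum_(i < K) \sum_(j < K) (u i * conjc (v j) * symbol coord M (i%:Z - j%:Z)) *:
           U (i%:Z - j%:Z) a)
  <= C ^+ 2 * B * rnorm a *
     ((\sum_(i < K) cn (u i) ^+ 2 + \sum_(j < K) cn (v j) ^+ 2) / 2).
Proof.
move=> Fa; have [s us sa] := F_decomp Fa.
have h (z : R[i]) : cn z = 1 ->
    rnorm (\sum_(k <- s) z ^ (- k) *: tw z (coord a k *: M (ee k)))
    <= C ^+ 2 * B * rnorm a.
  move=> z1; have zV1 : cn z^-1 = 1 by rewrite cnV z1 invr1.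
  rewrite [X in rnorm X](_ : _ = tw z (M (tw z^-1 a))); last first.
    rewrite [in RHS]sa tw_sum// linear_sum tw_sum//; apply: eq_bigr => k _.
    rewrite (twZ (HE := HE) _ _ zV1) (tw_ee (HE := HE) _ zV1) !linearZ /= !(twZ (HE := HE) _ _ z1).
    by rewrite !scalerA mulrC exprz_inv.
  apply: (le_trans (twist_le _ z1)); rewrite expr2 -!mulrA ler_wpM2l ?twist_norm_ge0//.
  apply: (le_trans (MB _)); rewrite mulrCA ler_wpM2l ?mult_norm_ge0//.
  exact: twist_le.
have := toeplitz_extraction (HE := HE) K u v h; congr (rnorm _ <= _).
rewrite exchange_big; apply: eq_bigr => i _ /=.
rewrite exchange_big; apply: eq_bigr => j _ /=.
rewrite -scaler_sumr -scalerA; congr (_ *: _).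
rewrite [in RHS]sa tr_sum; last by move=> k _; apply: FZ; exact: F_ee.
rewrite scaler_sumr; apply: eq_bigr => k _.
rewrite trZ ?tr_ee; last exact: F_ee.
by rewrite coordZ mult_ee// addrAC subrr add0r scalerA mulrC.
Qed.

(** The Toeplitz inequality for a single entry: a nonzero coefficient of a
    multiplier makes a translation bounded. *)
Lemma mult_coef a m : F a ->
  cn (symbol coord M m) * rnorm (U m a) <= C ^+ 2 * B * rnorm a.
Proof.
move=> Fa; have [p [q pq]] := int_natB m; pose K := (p + q).+1.
have pK : (p < K)%N by rewrite /K; lia.
have qK : (q < K)%N by rewrite /K; lia.
have := mult_toeplitz K (fun i => (i == p)%:R) (fun j => (j == q)%:R) Fa.
rewrite !sum_cn_delta// -[1 + 1]/(2%:R) divff ?pnatr_eq0// mulr1; congr (_ <= _).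
rewrite (bigD1 (Ordinal pK))//= [X in _ + X]big1 ?addr0; last first.
  move=> i; rewrite -val_eqE /= => /negbTE ->; apply: big1 => j _.
  by rewrite !mul0r scale0r.
rewrite (bigD1 (Ordinal qK))//= [X in _ + X]big1 ?addr0; last first.
  move=> i; rewrite -val_eqE /= => /negbTE ->.
  by rewrite conjc0 mulr0 mul0r scale0r.
by rewrite !eqxx conjc1 !mul1r -pq rnormZ.
Qed.

End Bounded.

(** The Fejér means of [x], as the double sum that the extraction produces. *)
Definition fejer N x : E :=
  (N.+1%:R^-1 : R[i]) *: \sum_(i < N.+1) \sum_(j < N.+1)
     coord x (i%:Z - j%:Z) *: ee (i%:Z - j%:Z).

(** The extraction with all the weights equal to [1]. *)
Lemma fejer_le N x : rnorm (fejer N x) <= C * rnorm x.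
Proof.
have h (z : R[i]) : cn z = 1 ->
    rnorm (\sum_(k <- [:: (0 : int)]) z ^ (- k) *: tw z x) <= C * rnorm x.
  by move=> z1; rewrite big_seq1 oppr0 expr0z scale1r twist_le.
have := toeplitz_extraction (HE := HE) N.+1 (fun=> 1) (fun=> 1) h.
rewrite big_seq1.
rewrite (_ : _ / 2 = N.+1%:R); last first.
  by rewrite cn1 expr1n !sumr_const card_ord; field.
move=> h2; rewrite /fejer rnormZ cnV cn_natr mulrC ler_pdivrMr ?ltr0n//.
move: h2; congr (rnorm _ <= _).
apply: eq_bigr => i _; apply: eq_bigr => j _.
by rewrite conjc1 mul1r scale1r add0r.
Qed.

Lemma fejer_comb N (c : R[i]) x y : fejer N (c *: x + y) = c *: fejer N x + fejer N y.
Proof.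
rewrite /fejer scalerA mulrC -scalerA -scalerDr; congr (_ *: _).
rewrite scaler_sumr -big_split; apply: eq_bigr => i _ /=.
rewrite scaler_sumr -big_split; apply: eq_bigr => j _ /=.
by rewrite coordD coordZ scalerDl scalerA.
Qed.

Lemma fejer0 N : fejer N 0 = 0.
Proof.
rewrite /fejer big1 ?scaler0// => i _; rewrite big1// => j _.
by rewrite coord0 scale0r.
Qed.

Lemma fejerD N x y : fejer N (x + y) = fejer N x + fejer N y.
Proof. by rewrite -[x in LHS]scale1r fejer_comb scale1r. Qed.

Lemma fejerZ N (c : R[i]) x : fejer N (c *: x) = c *: fejer N x.
Proof. by rewrite -[c *: x in LHS]addr0 fejer_comb fejer0 addr0. Qed.

Lemma cvg_dense (T : nat -> E -> E) (K : R) :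
  (forall n x y, T n (x - y) = T n x - T n y) ->
  (forall n x, rnorm (T n x) <= K * rnorm x) ->
  (forall a, F a -> (fun n => T n a) @ \oo --> a) ->
  forall x, (fun n => T n x) @ \oo --> x.
Proof.
move=> TB TK TF x; apply/cvg_rnormP => e e0.
have K0 : 0 < `|K| + 1 by rewrite ltr_wpDl.
have e2 : 0 < e / 2 by rewrite divr_gt0.
have [a Fa xa] := finsupp_dense x (divr_gt0 e2 (addr_gt0 K0 ltr01)).
have /cvg_rnormP/(_ _ e2)[N hN] := TF _ Fa.
exists N => n /hN h.
have -> : T n x - x = T n (x - a) + (T n a - a) - (x - a).
  by rewrite TB subrKA opprB addrA subrK.
apply: le_lt_trans (ler_rnormB _ _) _.
apply: (@le_lt_trans _ _ (K * rnorm (x - a) + rnorm (T n a - a) + rnorm (x - a))).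
  by rewrite lerD2r (le_trans (ler_rnormD _ _))// lerD2r.
move: xa; rewrite ltr_pdivlMr ?(addr_gt0 K0)// => xa.
have := ler_norm K; have := rnorm_ge0 (x - a); nra.
Qed.

(** On [ee k], the Fejér mean is a multiple that tends to [1]; the uniform
    bound gives the rest by density. *)
Lemma fejer_cvg x : (fun N => fejer N x) @ \oo --> x.
Proof.
apply: (@cvg_dense fejer C) => [n {}x y|n {}x|]; last 1 first.
- apply: F_ind.
    rewrite (_ : (fun n => _) = fun=> 0); first exact: cvg_cst.
    by apply: funext => n; rewrite fejer0.
  move=> c k y IH; under eq_fun do rewrite fejer_comb.
  apply: cvgD => //; apply: cvg_scale.
  apply/cvg_rnormP => e e0.
  have [N Ne] : exists N : nat, `|k|%:R * rnorm (ee k) / e < N%:R.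
    exists (Num.bound (`|k|%:R * rnorm (ee k) / e)).
    by apply: archi_boundP; rewrite divr_ge0 ?mulr_ge0 ?rnorm_ge0// ltW.
  exists (maxn N `|k|) => n; rewrite geq_max => /andP[Nn kn].
  have -> : fejer n (ee k) = ((n.+1 - `|k|)%N%:R / n.+1%:R : R[i]) *: ee k.
    rewrite /fejer mulrC -scalerA; congr (_ *: _).
    rewrite -card_zdiagonal natr_sum scaler_suml; apply: eq_bigr => i _.
    rewrite natr_sum scaler_suml; apply: eq_bigr => j _.
    by rewrite coord_ee; case: eqP => [->|_]; rewrite ?scale0r.
  rewrite -[X in _ - X]scale1r -scalerBl rnormZ.
  have -> : ((n.+1 - `|k|)%N%:R / n.+1%:R - 1 : R[i]) = - (`|k|%:R / n.+1%:R).
    rewrite natrB ?leqW//; field.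
    by rewrite nat1r pnatr_eq0.
  rewrite (@rnormN _ R[i]^o) cnM cnV !cn_natr mulrAC ltr_pdivrMr ?ltr0n//.
  rewrite [e * _]mulrC -ltr_pdivrMr//; apply: lt_le_trans Ne _.
  by rewrite ler_nat leqW.
- by rewrite addrC -scaleN1r fejer_comb scaleN1r addrC.
- exact: fejer_le.
Qed.

(** The norm of [x] is reached through finitely many coordinates at a time,
    which are continuous functionals; the closed graph theorem for the shifts
    rests on this. *)
Lemma rnorm_le_fejer x (K : R) : (forall N, rnorm (fejer N x) <= K) -> rnorm x <= K.
Proof. by move=> h; apply: (rnorm_cvg_le (u := fun N => fejer N x)); [exact: fejer_cvg|]. Qed.

End Multipliers.

(** * Uniform boundedness *)

Section UniformBoundedness.
Variables (R : realType) (E : completeNormedModType R[i]).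
Local Notation cn z := (rnorm (z : R[i]^o)).
Variable q : nat -> E -> R.
Hypothesis qD : forall N x y, q N (x + y) <= q N x + q N y.
Hypothesis qZ : forall N (l : R[i]) x, q N (l *: x) = cn l * q N x.
Hypothesis q_cont : forall N, exists K, forall x, q N x <= K * rnorm x.
Hypothesis q_pt : forall x, exists B, forall N, q N x <= B.

Lemma qN N x : q N (- x) = q N x.
Proof. by rewrite -scaleN1r qZ (@rnormN _ R[i]^o) cn1 mul1r. Qed.

(** As [q N h] is at most the mean of [q N (x + h)] and [q N (x - h)], a
    seminorm which is large at a small [h] is large at [x + h] or at [x - h],
    hence on a ball around it. *)
Lemma gliding_step : ~ (exists K, forall N x, q N x <= K * rnorm x) ->
  forall (n : nat) (x : E) (r : R), 0 < r -> exists x' r',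
    [/\ 0 < r', r' <= r / 2, rnorm (x' - x) <= r / 2 &
      exists N, forall y, rnorm (y - x') <= r' -> n%:R <= q N y].
Proof.
move=> unb n x r r0.
have [N [h hN]] : exists N h, n.+1%:R * 2 / r * rnorm h < q N h.
  apply: contrapT => H; apply: unb; exists (n.+1%:R * 2 / r) => N h.
  by rewrite leNgt; apply/negP => ?; apply: H; exists N, h.
have h0 : 0 < rnorm h.
  rewrite rnorm_gt0; apply: contraTneq hN => ->.
  by rewrite rnorm0 mulr0 -(scale0r (0 : E)) qZ rnorm0 mul0r ltxx.
pose l : R := r / 2 / rnorm h.
have l0 : 0 < l by rewrite !divr_gt0.
pose g := l%:C *: h.
have ng : rnorm g = r / 2.
  by rewrite /g rnormZ cn_real gtr0_norm// divfK// gt_eqF.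
have qg : n.+1%:R <= q N g.
  rewrite /g qZ cn_real gtr0_norm//.
  move: hN; rewrite -(ltr_pM2l l0) => /ltW; apply: le_trans.
  rewrite /l le_eqVlt; apply/orP; left; apply/eqP; field.
  by rewrite !gt_eqF.
have [x' x'x qx'] : exists2 x', rnorm (x' - x) = r / 2 & n.+1%:R <= q N x'.
  have h2 : 2 * q N g <= q N (x + g) + q N (x - g).
    have : q N ((x + g) - (x - g)) <= q N (x + g) + q N (- (x - g)) by apply: qD.
    have -> : (x + g) - (x - g) = (2 : R[i]) *: g.
      by rewrite opprB addrC addrA subrK scaler_nat mulr2n.
    by rewrite qN qZ (cn_natr R 2).
  have [h3|h3] := lerP n.+1%:R (q N (x + g)).
    by exists (x + g) => //; rewrite addrC addKr.
  exists (x - g); last lra.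
  by rewrite addrC addKr rnormN.
have [K hK] := q_cont N.
have K0 : 0 < `|K| + 1 by rewrite ltr_wpDl.
exists x', (Num.min (r / 2) (`|K| + 1)^-1); split.
- by rewrite lt_min invr_gt0 K0 divr_gt0.
- by rewrite ge_min lexx.
- by rewrite x'x.
exists N => y; rewrite le_min => /andP[_ yx'].
have := qD N y (x' - y); rewrite addrC subrK -[x' - y]opprB qN => h1.
have : q N (y - x') <= 1.
  apply: le_trans (hK _) _; apply: (@le_trans _ _ ((`|K| + 1) * rnorm (y - x'))).
    by rewrite ler_wpM2r ?rnorm_ge0// (le_trans (ler_norm K))// lerDl.
  by rewrite mulrC -ler_pdivlMr// div1r.
move: qx'; rewrite -natr1; lra.
Qed.

(** The uniform boundedness principle, by the gliding hump: the steps above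
    build a convergent sequence of nested balls, and the seminorms are
    unbounded at its limit. *)
Lemma uniform_boundedness : exists K, forall N x, q N x <= K * rnorm x.
Proof.
apply: contrapT => /gliding_step step.
have /choice[f fP] : forall a : nat * (E * R), exists b : E * R, 0 < a.2.2 ->
    [/\ 0 < b.2, b.2 <= a.2.2 / 2, rnorm (b.1 - a.2.1) <= a.2.2 / 2 &
      exists N, forall y, rnorm (y - b.1) <= b.2 -> a.1%:R <= q N y].
  move=> [n [x r]] /=; have [r0|r0] := ltrP 0 r; last by exists (0, 0).
  by have [x' [r' h]] := step n x r r0; exists (x', r').
pose p := fix p n := if n is n'.+1 then f (n', p n') else (0 : E, 1 : R).
have p0 n : 0 < (p n).2.
  by elim: n => [|n IH] //=; have [] := fP (n, p n) IH.
have pS n := fP (n, p n) (p0 n).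
have pdist n k : rnorm ((p (n + k)%N).1 - (p n).1) <= (p n).2 - (p (n + k)%N).2.
  elim: k => [|k IH]; first by rewrite addn0 !subrr rnorm0.
  rewrite addnS; have [_ /= r' x' _] := pS (n + k)%N.
  apply: le_trans (ler_rdist (p (n + k)%N).1 _ _) _.
  by apply: le_trans (lerD x' IH) _; rewrite /=; lra.
(* The halving of the radii is only used through this slower rate. *)
have psmall n : n.+1%:R * (p n).2 <= 1.
  elim: n => [|n IH]; first by rewrite mul1r.
  have [_ /= r' _ _] := pS n; have := p0 n.
  rewrite -natr1; have : 1 <= n.+1%:R :> R by rewrite ler1n.
  by move: IH r' => /=; set a := n.+1%:R; set b := (f _).2; set c := (p n).2; nra.
have [x px] : exists x : E, (fun n => (p n).1) @ \oo --> x.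
  apply: cauchy_rnorm_cvg => e e0.
  have [N Ne] : exists N : nat, 2 / e < N%:R.
    by exists (Num.bound (2 / e)); apply: archi_boundP; rewrite divr_ge0// ltW.
  have h n : (N <= n)%N -> rnorm ((p n).1 - (p N).1) < e / 2.
    move=> Nn; have := pdist N (n - N)%N; rewrite subnKC// => h.
    apply: le_lt_trans h _.
    apply: (@lt_le_trans _ _ (p N).2); first by rewrite gtrBl.
    have N0 : 0 < N.+1%:R :> R by rewrite ltr0n.
    rewrite -(ler_pM2l N0); apply: le_trans (psmall N) _.
    rewrite mulrA ler_pdivlMr// mul1r.
    move: Ne; rewrite ltr_pdivrMr// => /ltW /le_trans; apply.
    by rewrite ler_wpM2r ?ler_nat// ltW.
  exists N => n m Nn Nm; apply: le_lt_trans (ler_rdist (p N).1 _ _) _.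
  by have := h n Nn; have := h m Nm; rewrite [rnorm ((p N).1 - _)]rdistC; lra.
have xp n : rnorm (x - (p n).1) <= (p n).2.
  apply: (@rnorm_cvg_le_near _ _ (fun k => (p k).1 - (p n).1)).
    by apply: cvgB => //; exact: cvg_cst.
  exists n => k nk; have := pdist n (k - n)%N; rewrite subnKC// => h.
  by apply: le_trans h _; rewrite gerBl// ltW.
have [B hB] := q_pt x.
have [n Bn] : exists n : nat, `|B| < n%:R.
  by exists (Num.bound `|B|); apply: archi_boundP.
have [_ _ _ [N hN]] := pS n.
have := hN x (xp n.+1); rewrite /= leNgt => /negP; apply.
by apply: le_lt_trans (hB N) _; apply: le_lt_trans Bn; exact: ler_norm.
Qed.

End UniformBoundedness.

(** * Closures of the shifts and regular points *)

Section Shifts.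
Variables (R : realType) (E : completeNormedModType R[i]).
Variable coord : {linear E -> (int -> R[i]^o)}.
Context {HE : HomSpace coord}.
Local Notation F x := (finsupp (coord x)).
Local Notation U := (translate coord).
Local Notation ee := (basis coord).
Local Notation tw := (twist coord).
Local Notation C := (twist_norm coord).
Local Notation cn z := (rnorm (z : R[i]^o)).
Implicit Types (s : int) (x y a : E).

(** [S] and its inverse are the cases [s = 1] and [s = -1]; both directions
    are treated at once. *)
Definition seq_translate s (a : int -> R[i]^o) : int -> R[i]^o := fun n => a (n - s).

Lemma shift1 : @seq_shift R = seq_translate 1. Proof. by []. Qed.

Lemma shiftN1 : @seq_unshift R = seq_translate (-1).
Proof. by apply: funext => a; apply: funext => n; rewrite /seq_translate opprK. Qed.

(** Growth of the powers at the exponential rate [r], measured on the finitely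
    supported elements, on which unbounded shifts are also defined. *)
Definition power_bounded s (r : R) : Prop :=
  exists2 K, 0 < K & forall (m : nat) a, F a ->
    rnorm (U (s * m%:Z) a) <= K * r ^+ m * rnorm a.

Lemma coord_restr s x : maps_into coord (seq_translate s) ->
  coord (restr coord (seq_translate s) x) = seq_translate s (coord x).
Proof. by move=> /(_ x)[y yx]; rewrite /restr (ofseqE yx). Qed.

(** The Fejér means of the shifted [x] involve finitely many coordinates of
    [x], hence have continuous norms; these are bounded for each [x], so that
    uniform boundedness applies. *)
Lemma closed_graph s : maps_into coord (seq_translate s) ->
  exists2 K, 0 <= K & forall x y, coord y = seq_translate s (coord x) -> rnorm y <= K * rnorm x.
Proof.
move=> sE; pose T := restr coord (seq_translate s).
have TE x n : coord (T x) n = coord x (n - s) by rewrite coord_restr.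
have TD x y : T (x + y) = T x + T y.
  by apply: coordP => n; rewrite TE !coordD !TE.
have TZ (l : R[i]) x : T (l *: x) = l *: T x.
  by apply: coordP => n; rewrite TE !coordZ !TE.
have [||N|x|K hK] := @uniform_boundedness R E (fun N x => rnorm (fejer coord N (T x))).
- by move=> N x y; rewrite TD fejerD ler_rnormD.
- by move=> N l x; rewrite TZ fejerZ rnormZ.
- have /choice[k hk] := @coord_bounded R E coord HE.
  exists (N.+1%:R^-1 * \sum_(i < N.+1) \sum_(j < N.+1) k (i%:Z - j%:Z - s) * rnorm (ee (i%:Z - j%:Z))) => x.
  rewrite rnormZ cnV cn_natr -mulrA ler_wpM2l ?invr_ge0//.
  rewrite (le_trans (rnorm_sum _ _ _))// mulr_suml ler_sum// => i _.
  rewrite (le_trans (rnorm_sum _ _ _))// mulr_suml ler_sum// => j _.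
  by rewrite rnormZ TE mulrAC ler_wpM2r ?rnorm_ge0.
- by exists (C * rnorm (T x)) => N; exact: fejer_le.
exists `|K| => // x y yx.
have -> : y = T x by apply: coordP => n; rewrite TE yx.
apply: rnorm_le_fejer => N; apply: le_trans (hK _ _) _.
by rewrite ler_wpM2r ?rnorm_ge0// ler_norm.
Qed.

Lemma power_bounded_shift s : maps_into coord (seq_translate s) ->
  exists2 r, 0 < r & power_bounded s r.
Proof.
move=> /closed_graph[K K0 hK]; have r0 : 0 < K + 1 by rewrite ltr_wpDl.
exists (K + 1) => //; exists 1 => // m a Fa; rewrite mul1r.
elim: m => [|m IH]; first by rewrite mulr0 tr0// expr0 mul1r.
have -> : U (s * m.+1%:Z) a = U s (U (s * m%:Z) a).
  by rewrite tr_tr//; congr (U _ a); rewrite -addn1 PoszD; ring.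
apply: le_trans (hK (U (s * m%:Z) a) _ _) _.
  by rewrite coord_tr_fun//; exact: F_tr.
apply: (@le_trans _ _ ((K + 1) * rnorm (U (s * m%:Z) a))).
  by rewrite ler_wpM2r ?rnorm_ge0// lerDl.
by rewrite exprS -mulrA ler_wpM2l// ltW.
Qed.

Lemma F_approx x : exists2 a : nat -> E, (forall k, F (a k)) & a @ \oo --> x.
Proof.
have /choice[a ha] : forall k : nat, exists a, F a /\ rnorm (x - a) < k.+1%:R^-1.
  move=> k; have [|a Fa xa] := @finsupp_dense _ _ _ HE x (k.+1%:R^-1).
    by rewrite invr_gt0 ltr0n.
  by exists a.
exists a; first by move=> k; case: (ha k).
apply/cvg_rnormP => e e0.
have [N hN] := inv_natS_small e0.
by exists N => n Nn; rewrite rdistC; have [_ h] := ha n; exact: lt_trans h (hN n Nn).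
Qed.

Lemma coord_cvg (u : nat -> E) x n : u @ \oo --> x ->
  (fun k => coord (u k) n : R[i]^o) @ \oo --> (coord x n : R[i]^o).
Proof.
move=> ux; apply/cvg_rnormP => e e0.
have [K hK] := coord_bounded n; have K0 : 0 < `|K| + 1 by rewrite ltr_wpDl.
move/cvg_rnormP : ux => /(_ _ (divr_gt0 e0 K0))[N hN]; exists N => k /hN.
rewrite ltr_pdivlMr// -coordB; apply: le_lt_trans.
apply: le_trans (hK _) _; rewrite mulrC ler_wpM2l ?rnorm_ge0//.
by rewrite (le_trans (ler_norm K))// lerDl.
Qed.

Lemma coord_cvg_unique (u : nat -> E) x n (l : R[i]) : u @ \oo --> x ->
  (fun k => coord (u k) n : R[i]^o) @ \oo --> (l : R[i]^o) -> coord x n = l.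
Proof. by move=> ux; apply: (@cvg_rnorm_unique R R[i]^o); exact: coord_cvg ux. Qed.

Lemma cvg_tr_coord s (a : nat -> E) x y : (forall k, F (a k)) -> a @ \oo --> x ->
  (fun k => U s (a k)) @ \oo --> y -> coord y = seq_translate s (coord x).
Proof.
move=> Fa ax ay; apply: funext => n; apply: (coord_cvg_unique ay).
by under eq_fun do rewrite coord_tr//; exact: coord_cvg.
Qed.

(** The limits are identified by their coordinates. *)
Lemma F_bounded_shift s (K : R) : 0 <= K ->
  (forall a, F a -> rnorm (U s a) <= K * rnorm a) -> maps_into coord (seq_translate s).
Proof.
move=> K0 hK x; have [a Fa ax] := F_approx x.
have [|y ay] := @cauchy_rnorm_cvg R E (fun k => U s (a k)).
  move=> e e0; have K1 : 0 < K + 1 by rewrite ltr_wpDl.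
  have e2 : 0 < e / 2 / (K + 1) by rewrite !divr_gt0.
  move/cvg_rnormP : ax => /(_ _ e2)[N hN]; exists N => n m /hN an /hN am.
  rewrite -trB//; apply: le_lt_trans (hK _ (FB (Fa n) (Fa m))) _.
  have := ler_rdist x (a n) (a m); rewrite [rnorm (x - _)]rdistC.
  move: an am; rewrite !ltr_pdivlMr//; have := rnorm_ge0 (a n - a m).
  have := rnorm_ge0 (a n - x); have := rnorm_ge0 (a m - x); nra.
by exists y; apply: cvg_tr_coord ay.
Qed.

Lemma power_bounded_maps s (r : R) : 0 < r -> power_bounded s r -> maps_into coord (seq_translate s).
Proof.
move=> r0 [K K0 hK]; apply: (@F_bounded_shift _ (K * r)); first by rewrite mulr_ge0// ltW.
by move=> a Fa; have := hK 1%N a Fa; rewrite mulr1 expr1.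
Qed.

Lemma min_closureP s x y : min_closure coord (seq_translate s) (x, y) <->
  exists a : nat -> E, [/\ forall k, F (a k), a @ \oo --> x & (fun k => U s (a k)) @ \oo --> y].
Proof.
split=> [[u [v [uv ux vy]]]|[a [Fa ax ay]]].
  exists u; split=> //; first by move=> k; case: (uv k).
  rewrite (_ : (fun k => _) = v)//; apply: funext => k.
  by have [Fu vu] := uv k; apply: coord_inj; rewrite vu coord_tr_fun.
exists a, (fun k => U s (a k)); split=> // k; split=> //.
by rewrite coord_tr_fun.
Qed.

(** A bounded shift is the closure of its restriction to the finite sums, so
    that the two cases of the definition of the spectrum merge. *)
Lemma realizationE s : realization coord (seq_translate s) = min_closure coord (seq_translate s).
Proof.
rewrite /realization; case: asboolP => // sE.
have [K K0 hK] := closed_graph sE.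
have Tcvg (a : nat -> E) x : (forall k, F (a k)) -> a @ \oo --> x ->
    (fun k => U s (a k)) @ \oo --> restr coord (seq_translate s) x.
  move=> Fa ax; apply/cvg_rnormP => e e0.
  have K1 : 0 < K + 1 by rewrite ltr_wpDl.
  move/cvg_rnormP : ax => /(_ _ (divr_gt0 e0 K1))[N hN]; exists N => n /hN.
  rewrite ltr_pdivlMr//; apply: le_lt_trans; apply: (@le_trans _ _ (K * rnorm (a n - x))).
    apply: hK; apply: funext => m.
    by rewrite coordB coord_tr// coord_restr// /seq_translate coordB.
  by have := rnorm_ge0 (a n - x); nra.
apply/seteqP; split=> -[x y].
  rewrite {1}/graph_of /= => ->; apply/min_closureP.
  by have [a Fa ax] := F_approx x; exists a; split=> //; exact: Tcvg.
move=> /min_closureP[a [Fa ax ay]].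
by apply: cvg_rnorm_unique ay _; exact: Tcvg.
Qed.

(** For [z] in the resolvent set of the closure of the shift, expressed on the
    finitely supported elements: a lower bound and a dense range. *)
Definition regular s (z : R[i]) : Prop :=
  (exists2 c, 0 < c & forall a, F a -> c * rnorm a <= rnorm (U s a - z *: a)) /\
  (forall y e, 0 < e -> exists2 a, F a & rnorm (y - (U s a - z *: a)) < e).

Lemma resolvent_regular s z : resolvent_set (min_closure coord (seq_translate s)) z -> regular s z.
Proof.
move=> [B [/linear_continuousP[K hK] BP]]; split.
  have K1 : 0 < `|K| + 1 by rewrite ltr_wpDl.
  exists (`|K| + 1)^-1; first by rewrite invr_gt0.
  move=> a Fa; rewrite mulrC ler_pdivrMr// rdistC.
  have /BP {1}-> : min_closure coord (seq_translate s) (a, z *: a - (z *: a - U s a)).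
    by apply/min_closureP; exists (fun=> a); split=> //; rewrite ?subKr; exact: cvg_cst.
  apply: le_trans (hK _) _; rewrite mulrC ler_wpM2l ?rnorm_ge0//.
  by rewrite (le_trans (ler_norm K))// lerDl.
move=> y e e0; have /BP/min_closureP[a [Fa ax ay]] : B (- y) = B (- y) by [].
have : (fun k => U s (a k) - z *: a k) @ \oo --> y.
  rewrite -[y](_ : (z *: B (- y) - - y) - z *: B (- y) = y).
    by apply: cvgB => //; exact: cvg_scale.
  by rewrite opprK addrC addKr.
move=> /cvg_rnormP/(_ _ e0)[N hN]; exists (a N) => //.
by rewrite rdistC; exact: hN.
Qed.

Lemma min_closure_comb s (l : R[i]) x y x' y' :
  min_closure coord (seq_translate s) (x, y) -> min_closure coord (seq_translate s) (x', y') ->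
  min_closure coord (seq_translate s) (l *: x + x', l *: y + y').
Proof.
move=> /min_closureP[a [Fa ax ay]] /min_closureP[b [Fb bx b_y]]; apply/min_closureP.
exists (fun k => l *: a k + b k); split=> [k|//|].
- exact: F_comb.
- by apply: cvgD => //; exact: cvg_scale.
rewrite (_ : (fun k => _) = (fun k => l *: U s (a k) + U s (b k))).
  by apply: cvgD => //; exact: cvg_scale.
by apply: funext => k; rewrite trD ?trZ//; exact: FZ.
Qed.

Lemma regular_closure s z (c : R) x u :
  (forall a, F a -> c * rnorm a <= rnorm (U s a - z *: a)) ->
  min_closure coord (seq_translate s) (x, z *: x - u) -> c * rnorm x <= rnorm u.
Proof.
move=> hc /min_closureP[a [Fa ax ay]].
have au : (fun k => U s (a k) - z *: a k) @ \oo --> - u.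
  rewrite (_ : - u = (z *: x - u) - z *: x); last by rewrite addrAC subrr add0r.
  by apply: cvgB => //; exact: cvg_scale.
apply/ler_addgt0Pr => e e0.
have e2 : 0 < e / 2 by rewrite divr_gt0.
have d0 : 0 < e / 2 / (`|c| + 1) by rewrite divr_gt0// ltr_wpDl.
move/cvg_rnormP : au => /(_ _ e2)[N1 h1].
move/cvg_rnormP : ax => /(_ _ d0)[N2 h2].
pose n := maxn N1 N2.
have := h1 n (leq_maxl _ _); have := h2 n (leq_maxr _ _).
have := hc _ (Fa n).
have := ler_rnormB (U s (a n) - z *: a n + u) u; rewrite addrK.
rewrite opprK; have := ler_rdist (a n) x 0; rewrite !subr0 rdistC.
rewrite ltr_pdivlMr ?ltr_wpDl//.
set p := rnorm x; set q := rnorm (a n); set w := rnorm (a n - x).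
have : 0 <= w by exact: rnorm_ge0.
move=> w0 pq h3 h4 h5 h6.
suff : c * p <= c * q + `|c| * w by nra.
have [c0|c0] := leP 0 c.
  have := ler_wpM2l c0 pq; rewrite (ger0_norm c0); lra.
have := ler_rdist x (a n) 0; rewrite !subr0 -/p -/q -/w => qp.
have := ler_wnM2l (ltW c0) qp; rewrite (ltr0_norm c0); lra.
Qed.

(** By the lower bound, approximate solutions of the equation form a Cauchy
    sequence, and its limit is in the domain of the closure. *)
Lemma regular_resolvent s z : regular s z -> resolvent_set (min_closure coord (seq_translate s)) z.
Proof.
move=> [[c c0 hc] dr].
have ex u : exists x, min_closure coord (seq_translate s) (x, z *: x - u).
  have /choice[a ha] : forall k : nat, exists a, F a /\
      rnorm (- u - (U s a - z *: a)) < k.+1%:R^-1.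
    move=> k; have [|a Fa xa] := dr (- u) (k.+1%:R^-1); first by rewrite invr_gt0 ltr0n.
    by exists a.
  have au : (fun k => U s (a k) - z *: a k) @ \oo --> - u.
    apply/cvg_rnormP => e e0.
    have [N hN] := inv_natS_small e0.
    by exists N => n Nn; rewrite rdistC; have [_ h] := ha n; exact: lt_trans h (hN n Nn).
  have [|x ax] := @cauchy_rnorm_cvg R E a.
    move=> e e0; have d0 : 0 < c * e / 2 by rewrite divr_gt0// mulr_gt0.
    move/cvg_rnormP : au => /(_ _ d0)[N hN]; exists N => n m /hN an /hN am.
    have [Fn _] := ha n; have [Fm _] := ha m.
    have := hc _ (FB Fn Fm); rewrite trB// scalerBr.
    rewrite (_ : U s (a n) - U s (a m) - _ =
       (U s (a n) - z *: a n) - (U s (a m) - z *: a m)); last first.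
      by rewrite !opprB addrACA [RHS]addrACA; congr (_ + _); rewrite addrC.
    have := ler_rdist (- u) (U s (a n) - z *: a n) (U s (a m) - z *: a m).
    rewrite [rnorm (- u - _)]rdistC => h1 h2.
    rewrite -(ltr_pM2l c0); apply: le_lt_trans h2 _; lra.
  exists x; apply/min_closureP; exists a; split=> //; first by move=> k; case: (ha k).
  rewrite (_ : (fun k => _) = fun k => (U s (a k) - z *: a k) + z *: a k).
    by rewrite [z *: x - u]addrC; apply: cvgD => //; exact: cvg_scale.
  by apply: funext => k; rewrite subrK.
have uniq x x' u : min_closure coord (seq_translate s) (x, z *: x - u) ->
    min_closure coord (seq_translate s) (x', z *: x' - u) -> x = x'.
  move=> h h'; have := min_closure_comb (-1) h' h.
  rewrite !scaleN1r opprB addrA => h2.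
  apply/eqP; rewrite -subr_eq0 -rnorm_eq0; apply/eqP/le_anti.
  rewrite rnorm_ge0 andbT -(ler_pM2l c0) mulr0 -(rnorm0 E).
  apply: (regular_closure hc); rewrite subr0 addrC.
  move: h2; rewrite addrC; congr (min_closure _ _ (_, _)).
  by rewrite -[u - _ + _]addrA addKr scalerDr scalerN.
have /choice[B BP] := ex.
have Bl : linear B.
  move=> l u v; apply: (uniq _ _ (l *: u + v)); first exact: BP.
  have := min_closure_comb l (BP u) (BP v).
  congr (min_closure _ _ (_, _)).
  by rewrite scalerBr scalerDr opprD !scalerA [l * z]mulrC addrACA.
pose Bm := GRing.isLinear.Build R[i] E E _ B Bl.
pose BL : {linear E -> E} := HB.pack B Bm.
exists BL; split.
  apply/linear_continuousP; exists c^-1 => u.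
  by rewrite mulrC ler_pdivlMr// mulrC; apply: (regular_closure hc); exact: BP.
move=> x u; split=> [h|->]; last exact: BP.
exact: (uniq _ _ u).
Qed.

Lemma specP s z : spec coord (seq_translate s) z <-> ~ regular s z.
Proof.
rewrite /spec /spectrum realizationE /=; split=> h1 h2; apply: h1.
  exact: regular_resolvent.
exact: resolvent_regular.
Qed.

End Shifts.

(** * Regular points and growth of the powers *)

Section Geometric.
Variable R : realType.

Lemma geom_small (q B e : R) : 0 <= q < 1 -> 0 < e -> exists n, q ^+ n * B < e.
Proof.
move=> /andP[q0 q1] e0.
have : (fun n => q ^+ n) @ \oo --> (0 : R) by apply: cvg_expr; rewrite ger0_norm.
have B0 : 0 < `|B| + 1 by rewrite ltr_wpDl.
move=> /cvgrPdist_lt/(_ _ (divr_gt0 e0 B0))[N _ /(_ N (leqnn N))] /=.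
rewrite sub0r normrN ger0_norm ?exprn_ge0// ltr_pdivlMr// => h; exists N.
apply: le_lt_trans h; apply: ler_wpM2l; first by rewrite exprn_ge0.
by rewrite (le_trans (ler_norm B))// lerDl.
Qed.

Lemma geom_sum_le (q : R) n : 0 <= q < 1 -> \sum_(m < n) q ^+ m <= (1 - q)^-1.
Proof.
move=> /andP[q0 q1]; have h : 0 < 1 - q by rewrite subr_gt0.
rewrite -[leRHS]mul1r ler_pdivlMr// mulrC.
have -> : (1 - q) * \sum_(m < n) q ^+ m = 1 - q ^+ n.
  by have := subrX1 q n; lra.
by rewrite gerBl exprn_ge0.
Qed.

End Geometric.

Section Spectrum.
Variables (R : realType) (E : completeNormedModType R[i]).
Variable coord : {linear E -> (int -> R[i]^o)}.
Context {HE : HomSpace coord}.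
Local Notation F x := (finsupp (coord x)).
Local Notation U := (translate coord).
Local Notation ee := (basis coord).
Local Notation C := (twist_norm coord).
Local Notation cn z := (rnorm (z : R[i]^o)).
Local Notation pb := (power_bounded coord).
Local Notation D s z a := (U s a - z *: a).
Implicit Types (s : int) (x y a : E) (z : R[i]).

Lemma D_comb s z (l : R[i]) a b : F a -> F b ->
  D s z (l *: a + b) = l *: D s z a + D s z b.
Proof.
move=> Fa Fb; rewrite trD ?trZ//; last exact: FZ.
rewrite scalerDr scalerBr opprD addrACA; congr (_ - _ + _).
by rewrite !scalerA mulrC.
Qed.

Lemma D0 s z : D s z (0 : E) = 0.
Proof. by rewrite scaler0 subr0 -(scale0r (0 : E)) trZ ?scale0r//; exact: F0. Qed.

Lemma DZ s z (l : R[i]) a : F a -> D s z (l *: a) = l *: D s z a.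
Proof. by move=> Fa; rewrite -[l *: a]addr0 D_comb ?D0 ?addr0//; exact: F0. Qed.

Lemma D_sum s z I (r : seq I) (f : I -> E) : (forall i, F (f i)) ->
  D s z (\sum_(i <- r) f i) = \sum_(i <- r) D s z (f i).
Proof. by move=> Ff; rewrite tr_sum// scaler_sumr -sumrB. Qed.

Lemma F_D s z a : F a -> F (D s z a).
Proof. by move=> Fa; apply: FB; [exact: F_tr|exact: FZ]. Qed.

(** The common form of two Neumann series: the partial sums [P n], of terms
    [c m *: U (g m)], invert [U s - z] on both sides, up to an error [T n]
    that decays geometrically. *)
Lemma parametrix_regular s z (c : nat -> R[i]) (g : nat -> int) (T : nat -> E -> E) (K K' q : R) :
  0 <= q < 1 -> 0 <= K ->
  (forall n a, F a -> rnorm (T n a) <= K * q ^+ n * rnorm a) ->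
  (forall n a, F a -> rnorm (c n *: U (g n) a) <= K' * q ^+ n * rnorm a) ->
  (forall a, F a -> T 0%N a = a) ->
  (forall n a, F a -> c n *: D s z (U (g n) a) = T n a - T n.+1 a) ->
  0 <= K' ->
  regular coord s z.
Proof.
move=> q01 K0 hT hP T0 tel K'0; have /andP[q0 q1] := q01.
pose P n a := \sum_(m < n) c m *: U (g m) a.
have FP n a : F a -> F (P n a).
  by move=> Fa; apply: F_sum => i _; apply: FZ; exact: F_tr.
have DP n a : F a -> D s z (P n a) = a - T n a.
  move=> Fa; rewrite D_sum; last by move=> i; apply: FZ; exact: F_tr.
  elim: n => [|n IH]; first by rewrite big_ord0 T0// subrr.
  rewrite big_ord_recr IH /= trZ; last exact: F_tr.
  rewrite scalerA [z * _]mulrC -scalerA -scalerBr tel//.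
  by rewrite addrA subrK.
have PD n a : F a -> P n (D s z a) = a - T n a.
  move=> Fa; rewrite -DP// D_sum; last by move=> i; apply: FZ; exact: F_tr.
  apply: eq_bigr => i _.
  rewrite (trB _ (F_tr s Fa) (FZ z Fa)) (trZ _ _ Fa) (trZ _ _ (F_tr (g i) Fa)).
  by rewrite !tr_tr// scalerBr !scalerA [s + _]addrC [z * _]mulrC.
pose A := K' / (1 - q).
have A0 : 0 <= A by rewrite divr_ge0// subr_ge0 ltW.
have Ple n a : F a -> rnorm (P n a) <= A * rnorm a.
  move=> Fa; apply: le_trans (rnorm_sum _ _ _) _.
  apply: (@le_trans _ _ (\sum_(m < n) K' * q ^+ m * rnorm a)).
    by apply: ler_sum => i _; exact: hP.
  rewrite -mulr_suml -mulr_sumr ler_wpM2r ?rnorm_ge0// ler_wpM2l//.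
  exact: geom_sum_le.
split.
  have A1 : 0 < A + 1 by rewrite ltr_wpDl.
  exists (A + 1)^-1; first by rewrite invr_gt0.
  move=> a Fa; rewrite mulrC ler_pdivrMr// mulrC; apply/ler_addgt0Pr => e e0.
  have [n hn] := geom_small (K * rnorm a) q01 e0.
  have := ler_rnormD (P n (D s z a)) (T n a); rewrite PD// subrK -PD//.
  have := Ple n _ (F_D s z Fa); have := hT n a Fa; have := rnorm_ge0 (D s z a).
  by rewrite mulrDl mul1r; move: hn; rewrite mulrA [_ * K]mulrC; lra.
move=> y e e0; have e2 : 0 < e / 2 by rewrite divr_gt0.
have [a Fa ya] := finsupp_dense y e2.
have [n hn] := geom_small (K * rnorm a) q01 e2.
exists (P n a); first exact: FP.
apply: le_lt_trans (ler_rdist a _ _) _; rewrite DP// subKr.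
have := hT n a Fa; move: hn; rewrite mulrA [_ * K]mulrC; lra.
Qed.

(** Neumann's series in the powers of the shift. *)
Lemma regular_outside s z (r : R) : pb s r -> 0 < r < cn z -> regular coord s z.
Proof.
move=> [K K0 hK] /andP[r0 rz]; have z0 : 0 < cn z by apply: lt_trans rz.
have zn0 : z != 0 by rewrite -cn_eq0 gt_eqF.
have q01 : 0 <= r / cn z < 1.
  by rewrite divr_ge0 ?ltW//= ltr_pdivrMr// mul1r.
have bound n a : F a -> rnorm (z ^- n *: U (s * n%:Z) a) <= K * (r / cn z) ^+ n * rnorm a.
  move=> Fa; rewrite rnormZ cnV cnX expr_div_n mulrC.
  by rewrite mulrA mulrAC ler_wpM2r ?invr_ge0 ?exprn_ge0 ?rnorm_ge0//; exact: hK.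
apply: (@parametrix_regular s z (fun m => - z ^- m.+1) (fun m => s * m%:Z)
   (fun m a => z ^- m *: U (s * m%:Z) a) K (K / cn z) (r / cn z)) => //.
- exact: ltW.
- move=> n a Fa; rewrite scaleNr rnormN.
  have -> : z ^- n.+1 *: U (s * n) a = z^-1 *: (z ^- n *: U (s * n) a).
    by rewrite scalerA -invfM -exprS.
  have zV : 0 <= (cn z)^-1 by rewrite invr_ge0 ltW.
  by rewrite rnormZ cnV; have := ler_wpM2l zV (bound n a Fa); congr (_ <= _); ring.
- by move=> a Fa; rewrite mulr0 tr0// expr0 invr1 scale1r.
- move=> n a Fa; rewrite tr_tr// scalerBr !scaleNr opprK addrC; congr (_ - _).
    by rewrite scalerA exprSr invfM -mulrA mulVf// mulr1.
  by congr (_ *: U _ a); rewrite -addn1 PoszD; ring.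
by rewrite divr_ge0// ltW.
Qed.

(** Neumann's series in the powers of the inverse shift. *)
Lemma regular_inside s z (q : R) : pb (- s) q -> 0 < q -> q * cn z < 1 -> regular coord s z.
Proof.
move=> [K K0 hK] q0 qz.
have q01 : 0 <= q * cn z < 1 by rewrite mulr_ge0 ?rnorm_ge0 ?ltW.
apply: (@parametrix_regular s z (fun m => z ^+ m) (fun m => - s * m.+1%:Z)
   (fun m a => z ^+ m *: U (- s * m%:Z) a) K (K * q) (q * cn z)) => //.
- exact: ltW.
- move=> n a Fa; rewrite rnormZ cnX exprMn mulrC.
  by rewrite mulrA mulrAC ler_wpM2r ?exprn_ge0 ?rnorm_ge0//; exact: hK.
- move=> n a Fa; rewrite rnormZ cnX exprMn mulrC.
  have := hK n.+1 a Fa; rewrite exprS => h.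
  have := ler_wpM2r (exprn_ge0 n (rnorm_ge0 (z : R[i]^o))) h.
  by congr (_ <= _); ring.
- by move=> a Fa; rewrite mulr0 tr0// expr0 scale1r.
- move=> n a Fa; rewrite tr_tr// scalerBr; congr (_ - _).
    by congr (_ *: U _ a); rewrite -addn1 PoszD; ring.
  by rewrite scalerA -exprSr.
by rewrite mulr_ge0// ltW.
Qed.

(** The approximation is iterated on the remainders. *)
Lemma reduction_dense s z (t : R) : 0 <= t < 1 ->
  (forall y, exists2 a, F a & rnorm (y - D s z a) <= t * rnorm y) ->
  forall y (e : R), 0 < e -> exists2 a, F a & rnorm (y - D s z a) < e.
Proof.
move=> t01 red y e e0; have [n hn] := geom_small (rnorm y) t01 e0.
suff [a Fa ha] : exists2 a, F a & rnorm (y - D s z a) <= t ^+ n * rnorm y.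
  by exists a => //; exact: le_lt_trans hn.
elim: n {hn} => [|n [a Fa ha]].
  exists 0; first exact: F0.
  by rewrite D0 subr0 mul1r.
have [b Fb hb] := red (y - D s z a).
exists (1 *: a + b); first exact: F_comb.
rewrite D_comb// scale1r opprD addrA; apply: le_trans hb _.
rewrite exprS -mulrA; apply: ler_wpM2l => //.
by case/andP: t01.
Qed.

(** The lower bound loses at most one half; the approximate solutions for [z]
    leave a remainder of at most three quarters for [z'], which can then be
    reduced. *)
Lemma regular_near s z z' (c : R) : 0 < c ->
  (forall a, F a -> c * rnorm a <= rnorm (D s z a)) ->
  (forall y (e : R), 0 < e -> exists2 a, F a & rnorm (y - D s z a) < e) ->
  cn (z' - z) <= c / 4 ->
  (forall a, F a -> c / 2 * rnorm a <= rnorm (D s z' a)) /\ regular coord s z'.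
Proof.
move=> c0 hc dz zz'.
have DD a : D s z' a = D s z a - (z' - z) *: a.
  by rewrite scalerBl opprB addrA subrK.
have Dle a : rnorm (D s z a - D s z' a) <= c / 4 * rnorm a.
  by rewrite DD opprB addrC subrK rnormZ ler_wpM2r ?rnorm_ge0.
have low a : F a -> c / 2 * rnorm a <= rnorm (D s z' a).
  move=> Fa; have := Dle a; have := hc a Fa.
  have := ler_rnormD (D s z a - D s z' a) (D s z' a); rewrite subrK.
  have : 0 <= c * rnorm a by rewrite mulr_ge0 ?rnorm_ge0 ?ltW.
  by move: (rnorm a) => p; nra.
split=> //; split; first by exists (c / 2) => //; rewrite divr_gt0.
apply: (@reduction_dense _ _ (3 / 4)); first lra.
move=> y; have [->|y0] := eqVneq y 0.
  exists 0; first exact: F0.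
  by rewrite D0 subr0 rnorm0 mulr0.
have ny : 0 < rnorm y by rewrite rnorm_gt0.
have [|a Fa ya] := dz y (rnorm y / 4); first by rewrite divr_gt0.
exists a => //.
have := ler_rdist (D s z a) y (D s z' a); have := Dle a; have := hc a Fa.
have := ler_rdist y (D s z a) 0; rewrite !subr0 [rnorm (D s z a - y)]rdistC.
move: ya ny; set p := rnorm y; set w := rnorm (y - D s z a).
by set v := rnorm (D s z a); move: (rnorm a) (rnorm (_ - _)) => ra rb; nra.
Qed.

Hypothesis shift_bounded : maps_into coord (seq_translate 1) \/ maps_into coord (seq_translate (-1)).

Lemma closure_restr s t x y : maps_into coord (seq_translate t) ->
  min_closure coord (seq_translate s) (x, y) ->
  min_closure coord (seq_translate s) (restr coord (seq_translate t) x, restr coord (seq_translate t) y).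
Proof.
move=> tE; have [K K0 hK] := closed_graph tE.
have Tcvg (u : nat -> E) v : u @ \oo --> v ->
    (fun k => restr coord (seq_translate t) (u k)) @ \oo --> restr coord (seq_translate t) v.
  move=> uv; apply/cvg_rnormP => e e0.
  have K1 : 0 < K + 1 by rewrite ltr_wpDl.
  move/cvg_rnormP : uv => /(_ _ (divr_gt0 e0 K1))[N hN]; exists N => n /hN.
  rewrite ltr_pdivlMr//; apply: le_lt_trans; apply: (@le_trans _ _ (K * rnorm (u n - v))).
    apply: hK; apply: funext => m.
    by rewrite coordB !coord_restr// /seq_translate coordB.
  by have := rnorm_ge0 (u n - v); nra.
have TF a : F a -> restr coord (seq_translate t) a = U t a.
  by move=> Fa; apply: coordP => n; rewrite coord_restr// coord_tr.
move=> /min_closureP[a [Fa ax ay]]; apply/min_closureP.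
exists (fun k => U t (a k)); split.
- by move=> k; exact: F_tr.
- by under eq_fun do rewrite -TF//; exact: Tcvg.
rewrite (_ : (fun k => _) = fun k => restr coord (seq_translate t) (U s (a k))).
  exact: Tcvg.
by apply: funext => k; rewrite TF ?tr_tr ?[s + t]addrC//; exact: F_tr.
Qed.

(** The resolvent commutes with the closure of the shift, hence with whichever
    of the two shifts is bounded everywhere, hence with both on finite
    sums. *)
Lemma resolvent_multiplier s z (B : {linear E -> E}) : continuous B ->
  (forall x u, min_closure coord (seq_translate s) (x, z *: x - u) <-> x = B u) ->
  multiplier coord B.
Proof.
move=> Bc BP; split=> // a sa Fa saE.
have comm t b : maps_into coord (seq_translate t) -> F b ->
    coord (B (U t b)) = seq_translate t (coord (B b)).
  move=> tE Fb; rewrite -coord_restr//; congr (coord _ : int -> R[i]^o).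
  apply/esym/BP; have /BP/(closure_restr tE) : B b = B b by [].
  congr (min_closure _ _ (_, _)); apply: coordP => n.
  by rewrite coord_restr// /seq_translate !coordB !coordZ coord_restr// coord_tr.
have -> : sa = U 1 a by apply: coordP => n; rewrite saE coord_tr.
rewrite shift1; case: shift_bounded => tE; first exact: comm.
have := comm _ (U 1 a) tE (F_tr 1 Fa); rewrite tr_tr// addNr tr0// => ->.
by apply: funext => n; rewrite /seq_translate opprK subrK.
Qed.

(** The image [y] of [ee 0] by the resolvent. As the resolvent is a
    multiplier, the size of the coefficients of [y] controls the
    translations. *)
Lemma ex_green s z : regular coord s z -> exists2 y,
  min_closure coord (seq_translate s) (y, z *: y - ee 0) &
  exists2 K, 0 <= K &
    forall m a, F a -> cn (coord y m) * rnorm (U m a) <= K * rnorm a.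
Proof.
move=> /regular_resolvent[B [Bc BP]]; exists (B (ee 0)); first exact/BP.
have Bm := resolvent_multiplier Bc BP.
have /linear_continuousP[K hK] := Bc.
have hK' x : rnorm (B x) <= `|K| * rnorm x.
  by apply: le_trans (hK x) _; rewrite ler_wpM2r ?rnorm_ge0// ler_norm.
exists (C ^+ 2 * `|K|); first by rewrite mulr_ge0// sqr_ge0.
by move=> m a Fa; exact: mult_coef.
Qed.

(** The resolvent equation in coordinates; off [n = 0], the sequence [y] is
    geometric. *)
Lemma green_rec s z y n : min_closure coord (seq_translate s) (y, z *: y - ee 0) ->
  coord y (n - s) = z * coord y n - (n == 0)%:R.
Proof.
move=> /min_closureP[a [Fa ay a2]].
have := congr1 (fun f : int -> R[i]^o => f n) (cvg_tr_coord Fa ay a2).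
by rewrite coordB coordZ coord_ee /seq_translate => ->.
Qed.

Section Green.
Variables (s : int) (z : R[i]) (y : E) (K : R).
Hypothesis s1 : s * s = 1.
Hypothesis yz : min_closure coord (seq_translate s) (y, z *: y - ee 0).
Hypothesis K0 : 0 <= K.
Hypothesis yK : forall m a, F a -> cn (coord y m) * rnorm (U m a) <= K * rnorm a.

Let sm_neq0 (m : int) : m != 0 -> s * m != 0.
Proof.
move=> m0; apply: contraNneq m0 => h.
by rewrite -[m]mul1r -s1 -mulrA h mulr0.
Qed.

Lemma green_pos m : coord y 0 = z ^+ m * coord y (s * m%:Z).
Proof.
elim: m => [|m IH]; first by rewrite mulr0 mul1r.
rewrite IH exprSr -mulrA; congr (_ * _).
have := green_rec (s * m.+1%:Z) yz; rewrite (negbTE (sm_neq0 _))// subr0 => <-.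
by congr (coord y _); rewrite -addn1 PoszD; ring.
Qed.

Lemma green_neg m : coord y (- s * m.+1%:Z) = z ^+ m * coord y (- s).
Proof.
elim: m => [|m IH]; first by rewrite mulr1 mul1r.
rewrite exprS -mulrA -IH.
have := green_rec (- s * m.+1%:Z) yz.
rewrite -[X in X == 0]mulrNN opprK (negbTE (sm_neq0 _)) ?subr0; last by rewrite oppr_eq0.
by move=> <-; congr (coord y _); rewrite -addn1 PoszD; ring.
Qed.

Lemma green_zero : coord y (- s) = z * coord y 0 - 1.
Proof. by have := green_rec 0 yz; rewrite sub0r eqxx. Qed.

(** The coefficients of [y] in the direction [s] are exactly [y 0] times the
    powers of [z^-1]; the control of the translations by [y] then bounds their
    growth. *)
Lemma green_pb_pos : coord y 0 != 0 -> pb s (cn z).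
Proof.
rewrite -cn_eq0 => y0; have {}y0 : 0 < cn (coord y 0) by rewrite lt_def y0 rnorm_ge0.
exists ((K + 1) / cn (coord y 0)); first by rewrite divr_gt0// ltr_wpDl.
move=> m a Fa; rewrite -(ler_pM2l y0).
rewrite [leRHS](_ : _ = (K + 1) * (cn z ^+ m * rnorm a)); last first.
  by field; rewrite gt_eqF.
have : cn (coord y 0) = cn z ^+ m * cn (coord y (s * m%:Z)).
  by rewrite (green_pos m) cnM cnX.
move=> ->; rewrite -!mulrA; have zm := exprn_ge0 m (rnorm_ge0 (z : R[i]^o)).
apply: le_trans (ler_wpM2l zm (yK _ Fa)) _.
by rewrite mulrCA ler_wpM2r ?mulr_ge0 ?rnorm_ge0// lerDl.
Qed.

(** The same in the direction [- s], where the coefficients of [y] are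
    geometric with ratio [z]. *)
Lemma green_pb_neg : z != 0 -> coord y (- s) != 0 -> pb (- s) (cn z)^-1.
Proof.
rewrite -[z == 0]cn_eq0 -cn_eq0 => z0 y0.
have {}y0 : 0 < cn (coord y (- s)) by rewrite lt_def y0 rnorm_ge0.
have {}z0 : 0 < cn z by rewrite lt_def z0 rnorm_ge0.
have h0 : 0 <= K * cn z / cn (coord y (- s)) by rewrite !mulr_ge0 ?invr_ge0 ?rnorm_ge0.
exists (K * cn z / cn (coord y (- s)) + 1); first by rewrite ltr_wpDl.
move=> [|m] a Fa; first by rewrite mulr0 tr0// expr0 mulr1 ler_peMl ?rnorm_ge0// lerDr.
apply: (@le_trans _ _ (K * cn z / cn (coord y (- s)) * (cn z)^-1 ^+ m.+1 * rnorm a)); last first.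
  rewrite ler_wpM2r ?rnorm_ge0// ler_wpM2r ?lerDl//.
  by rewrite exprn_ge0// invr_ge0 ltW.
have := yK (- s * m.+1%:Z) Fa; rewrite green_neg cnM cnX.
have zm : 0 < cn z ^+ m by rewrite exprn_gt0.
move=> h; have zy : 0 < cn z ^+ m * cn (coord y (- s)) by rewrite mulr_gt0.
rewrite -(ler_pM2l zy); apply: le_trans h _.
rewrite le_eqVlt; apply/orP; left; apply/eqP; rewrite exprVn exprS; field.
by rewrite !gt_eqF.
Qed.

End Green.

(** The resolvent identity. *)
Lemma green_near s z z' y y' (c : R) :
  (forall a, F a -> c * rnorm a <= rnorm (D s z' a)) ->
  min_closure coord (seq_translate s) (y, z *: y - ee 0) ->
  min_closure coord (seq_translate s) (y', z' *: y' - ee 0) ->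
  c * rnorm (y - y') <= cn (z' - z) * rnorm y.
Proof.
move=> hc h h'; rewrite -rnormZ; apply: (regular_closure (z := z') hc).
have := min_closure_comb (HE := HE) (-1) h' h.
congr (min_closure _ _ (_, _)); rewrite !scaleN1r addrC//.
rewrite opprB addrA subrK scalerBl scalerBr opprB.
by rewrite [RHS]addrC addrA subrK.
Qed.

(** By contradiction, for [z] in the closed annulus: when [z] moves radially,
    the resolvents at nearby points have a zero coefficient at [- s] outwards,
    and at [0] inwards, since a nonzero one would give a growth rate that
    excludes [z] from the annulus. By continuity both coefficients vanish at
    [z], which contradicts [y (- s) = z y 0 - 1]. *)
Lemma regular_strict s z : s * s = 1 -> regular coord s z ->
  (exists2 r, 0 < r < cn z & pb s r) \/ (exists2 q, 0 < q & q * cn z < 1 /\ pb (- s) q).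
Proof.
move=> s1 reg; apply: contrapT => /not_orP[nout nin].
have [[c c0 hc] dz] := reg.
have [y yz _] := ex_green reg.
have [w w1 wz] := ex_direction z.
have near (t : R) n : `|t| <= c / 4 ->
    (forall y' K, min_closure coord (seq_translate s) (y', (z + t%:C * w) *: y' - ee 0) ->
       0 <= K -> (forall m a, F a -> cn (coord y' m) * rnorm (U m a) <= K * rnorm a) ->
       coord y' n = 0) ->
    exists2 y', coord y' n = 0 & rnorm (y - y') <= 2 / c * rnorm y * `|t|.
  move=> tc h; have zz' : cn (z + t%:C * w - z) = `|t|.
    by rewrite addrC addKr cnM w1 mulr1 cn_real.
  have [|low reg'] := regular_near (z' := z + t%:C * w) c0 hc dz; first by rewrite zz'.
  have [y' yz' [K K0 hK]] := ex_green reg'; exists y'; first exact: h yz' K0 hK.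
  have := green_near low yz yz'; rewrite zz' => h2.
  have c2 : 0 < c / 2 by rewrite divr_gt0.
  rewrite -(ler_pM2l c2); apply: le_trans h2 _.
  by rewrite le_eqVlt; apply/orP; left; apply/eqP; field; rewrite gt_eqF.
have vanish n (t0 : R) : 0 < t0 ->
    (forall t : R, 0 < t <= t0 -> exists2 y', coord y' n = 0 & rnorm (y - y') <= 2 / c * rnorm y * t) ->
    coord y n = 0.
  move=> t00 h; have [K hK] := coord_bounded n.
  apply: (@rnorm_eq0_small R R[i]^o _ (`|K| * (2 / c * rnorm y))) => e e0.
  pose t := Num.min e t0.
  have t0' : 0 < t <= t0 by rewrite lt_min e0 t00 /= ge_min lexx orbT.
  have [y' y'n yy'] := h t t0'.
  have := hK (y - y'); rewrite coordB y'n subr0 => h2.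
  apply: le_trans h2 _; apply: (@le_trans _ _ (`|K| * rnorm (y - y'))).
    by rewrite ler_wpM2r ?rnorm_ge0// ler_norm.
  rewrite -[leRHS]mulrA ler_wpM2l//; apply: le_trans yy' _.
  rewrite ler_wpM2l//; first by rewrite mulr_ge0 ?rnorm_ge0// divr_ge0// ltW.
  by rewrite /t ge_min lexx.
have c4 : 0 < c / 4 by rewrite divr_gt0.
have yns : coord y (- s) = 0.
  apply: (vanish _ (c / 4)) => // t /andP[t0 tc].
  have [||y' y'0 yy'] := near t (- s); first by rewrite gtr0_norm.
    move=> y' K yz' K0 hK; apply/eqP; apply: contrapT => /negP y'0.
    apply: nin.
    have zE : z + t%:C * w = (cn z + t)%:C * w by rewrite {1}wz -mulrDl -rmorphD.
    have cnz' : cn (z + t%:C * w) = cn z + t.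
      by rewrite zE cnM w1 mulr1 cn_real ger0_norm// addr_ge0 ?rnorm_ge0 ?ltW.
    have zt : 0 < cn z + t by rewrite ltr_wpDl ?rnorm_ge0.
    exists (cn z + t)^-1; first by rewrite invr_gt0.
    split; first by rewrite mulrC ltr_pdivrMr// mul1r ltrDl.
    rewrite -cnz'; apply: (green_pb_neg s1 yz' K0 hK) => //.
    by rewrite -cn_eq0 cnz' gt_eqF.
  by exists y' => //; rewrite (gtr0_norm t0) in yy'.
have := green_zero yz; rewrite yns => /esym/eqP; rewrite subr_eq0 => /eqP zy.
have z0 : 0 < cn z.
  rewrite rnorm_gt0; apply: contra_eq_neq zy => ->.
  by rewrite mul0r eq_sym oner_neq0.
have y0 : coord y 0 = 0.
  apply: (vanish _ (Num.min (c / 4) (cn z / 2))).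
    by rewrite lt_min c4 divr_gt0.
  move=> t; rewrite le_min => /and3P[t0 tc tz].
  have [||y' y'0 yy'] := near (- t) 0; first by rewrite normrN gtr0_norm.
    move=> y' K yz' K0 hK; apply/eqP; apply: contrapT => /negP y'0.
    apply: nout.
    have zE : z + (- t)%:C * w = (cn z - t)%:C * w.
      by rewrite {1}wz -mulrDl -rmorphD.
    have zt : 0 < cn z - t by lra.
    have cnz' : cn (z + (- t)%:C * w) = cn z - t.
      by rewrite zE cnM w1 mulr1 cn_real gtr0_norm.
    exists (cn z - t); first by rewrite zt gtrBl.
    by rewrite -cnz'; exact: (green_pb_pos s1 yz' K0 hK).
  by exists y' => //; rewrite normrN (gtr0_norm t0) in yy'.
by move: zy; rewrite y0 mulr0 => /eqP; rewrite eq_sym oner_eq0.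
Qed.

(** A power of the shift and the same power of its inverse compose to the
    identity. *)
Lemma pb_disjoint s (r q : R) : 0 < r -> 0 < q -> pb s r -> pb (- s) q -> 1 <= q * r.
Proof.
move=> r0 q0 [K K0 hK] [K' K'0 hK']; rewrite leNgt; apply/negP => qr.
have qr01 : 0 <= q * r < 1 by rewrite mulr_ge0 ?ltW.
have [n hn] := geom_small (K' * K * rnorm (ee 0)) qr01 (ee_gt0 0).
suff : rnorm (ee 0) < rnorm (ee 0) by rewrite ltxx.
apply: le_lt_trans hn.
have -> : ee 0 = U (- s * n%:Z) (U (s * n%:Z) (ee 0)).
  by rewrite tr_tr; [rewrite -mulrDl addNr mul0r tr0//; exact: F_ee|exact: F_ee].
apply: le_trans (hK' _ _ _) _; first by apply: F_tr; exact: F_ee.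
rewrite exprMn; have q0n : 0 <= K' * q ^+ n by rewrite mulr_ge0 ?exprn_ge0 ?ltW.
apply: le_trans (ler_wpM2l q0n (hK n _ (F_ee 0))) _.
rewrite le_eqVlt; apply/orP; left; apply/eqP.
rewrite tr_tr; last exact: F_ee.
rewrite -mulrDl addNr mul0r tr0//; last exact: F_ee.
ring.
Qed.

End Spectrum.

(** * Spectra and spectral radii of the shifts *)

Section SpectralRadius.
Variables (R : realType) (E : completeNormedModType R[i]).
Variable coord : {linear E -> (int -> R[i]^o)}.
Context {HE : HomSpace coord}.
Local Notation cn z := (rnorm (z : R[i]^o)).
Local Notation pb := (power_bounded coord).
Implicit Types (s : int) (z : R[i]).

Lemma inve_le_fin (T : \bar R) (x : R) : (0 <= T)%E -> 0 < x ->
  (T^-1 <= x%:E)%E = ((x^-1)%:E <= T)%E.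
Proof.
case: T => [t| |]//; rewrite ?lee_fin => t0 x0; last first.
  by rewrite (ltW x0) leey.
rewrite inver; case: eqP => [->|/eqP tn0].
  rewrite leNgt ltry; apply/esym/negbTE.
  by rewrite -ltNge invr_gt0.
have {}t0 : 0 < t by rewrite lt_def tn0.
by rewrite !lee_fin -[x in LHS]invrK lef_pV2 ?posrE ?invr_gt0.
Qed.

(** The spectral radius formula suggests this value: the infimum of the rates
    of exponential growth of the powers. *)
Definition shift_radius s : \bar R :=
  ereal_inf [set r%:E | r in [set r : R | 0 < r /\ pb s r]].

Lemma shift_radius_ge0 s : (0 <= shift_radius s)%E.
Proof. by apply: le_ereal_inf_tmp => _ [r [r0 _] <-]; rewrite lee_fin ltW. Qed.

Lemma shift_radius_le s (r : R) : 0 < r -> pb s r -> (shift_radius s <= r%:E)%E.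
Proof. by move=> r0 pr; apply: ereal_inf_lbound; exists r. Qed.

Lemma shift_radius_lt s (x : R) : (shift_radius s < x%:E)%E ->
  exists2 r, 0 < r < x & pb s r.
Proof.
move=> /ereal_inf_lt[_ [r [r0 pr] <-]]; rewrite lte_fin => rx.
by exists r => //; rewrite r0.
Qed.

Lemma shift_radius_maps s : maps_into coord (seq_translate s) -> (shift_radius s < +oo)%E.
Proof.
move=> /power_bounded_shift[r r0 pr].
by apply: le_lt_trans (shift_radius_le r0 pr) _; rewrite ltry.
Qed.

Lemma shift_radius_pinfty s : ~ maps_into coord (seq_translate s) -> shift_radius s = +oo%E.
Proof.
move=> ns; rewrite /shift_radius (_ : [set _ | _ in _] = set0) ?ereal_inf0//.
apply/seteqP; split=> // t [r [r0 pr] _]; apply: ns.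
exact: power_bounded_maps pr.
Qed.

Lemma shift_radius_inv s : ((shift_radius (- s))^-1 <= shift_radius s)%E.
Proof.
apply: le_ereal_inf_tmp => _ [r [r0 pr] <-].
rewrite inve_le_fin ?shift_radius_ge0//.
apply: le_ereal_inf_tmp => _ [q [q0 pq] <-].
by rewrite lee_fin -[leLHS]mul1r ler_pdivrMr//; exact: pb_disjoint pr pq.
Qed.

Hypothesis shift_bounded : maps_into coord (seq_translate 1) \/ maps_into coord (seq_translate (-1)).

(** Neumann's series cover the complement of the annulus, and a regular point
    admits a growth rate that puts it in this complement. *)
Lemma shift_specP s z : s * s = 1 -> spec coord (seq_translate s) z <->
  ((shift_radius (- s))^-1 <= (cn z)%:E <= shift_radius s)%E.
Proof.
move=> s1; split.
  move/specP => nreg; apply/andP; split; last first.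
    rewrite leNgt; apply/negP => /shift_radius_lt[r rz pr]; apply: nreg.
    exact: regular_outside pr rz.
  rewrite leNgt; apply/negP => h.
  suff [q [q0 [qz pq]]] : exists q, 0 < q /\ q * cn z < 1 /\ pb (- s) q.
    by apply: nreg; exact: regular_inside pq q0 qz.
  have [z0|z0] := eqVneq (cn z) 0.
    have : (shift_radius (- s) < +oo)%E.
      rewrite ltey; apply: contraTN h => /eqP ->.
      by rewrite invey -leNgt lee_fin rnorm_ge0.
    have := shift_radius_ge0 (- s).
    case E1 : (shift_radius (- s)) => [t| |]// _ _.
    have [|q /andP[q0 qt] pq] := @shift_radius_lt (- s) (t + 1).
      by rewrite E1 lte_fin ltrDl.
    by exists q; rewrite z0 mulr0 ltr01.
  have {}z0 : 0 < cn z by rewrite lt_def z0 rnorm_ge0.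
  move: h; rewrite ltNge inve_le_fin ?shift_radius_ge0// -ltNge.
  move=> /shift_radius_lt[q /andP[q0 qz] pq]; exists q; split=> //; split=> //.
  by rewrite -ltr_pdivlMr// div1r.
move=> /andP[h1 h2]; apply/specP => /(regular_strict shift_bounded s1)[].
  move=> [r /andP[r0 rz] pr]; have := le_trans h2 (shift_radius_le r0 pr).
  by rewrite lee_fin leNgt rz.
move=> [q q0 [qz pq]].
have [z0|z0] := eqVneq (cn z) 0.
  move: h1; rewrite z0; have := shift_radius_le q0 pq; have := shift_radius_ge0 (- s).
  case: (shift_radius (- s)) => [t| |]//; rewrite !lee_fin => t0 tq.
  rewrite inver; case: eqP => [_|/eqP tn0]; first by rewrite leNgt ltry.
  by rewrite lee_fin leNgt invr_gt0 lt_def tn0 t0.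
have {}z0 : 0 < cn z by rewrite lt_def z0 rnorm_ge0.
move: h1; rewrite inve_le_fin ?shift_radius_ge0// => h1.
have := le_trans h1 (shift_radius_le q0 pq).
by rewrite lee_fin -[(cn z)^-1]mul1r ler_pdivrMr// leNgt qz.
Qed.

(** A finite [shift_radius s] is attained in the spectrum. If it is infinite,
    then the spectrum is unbounded or empty, and the spectral radius is
    infinite in both cases. *)
Lemma shift_rho s : s = 1 \/ s = -1 -> rho coord (seq_translate s) = shift_radius s.
Proof.
move=> s1; have ss : s * s = 1 by case: s1 => ->.
have sP z := shift_specP z ss.
have attained (x : R) : (shift_radius s) = x%:E -> spec coord (seq_translate s) x%:C.
  move=> sx; have x0 : 0 <= x by rewrite -lee_fin -sx shift_radius_ge0.
  by apply/sP; rewrite cn_real ger0_norm// -sx lexx andbT shift_radius_inv.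
rewrite /rho /specradius -/(spec _ _).
case: eqP => [sp0|/eqP/set0P[z0 sz0]].
  have := shift_radius_ge0 s; case E1 : (shift_radius s) => [x| |]//= _.
  by have := attained x E1; rewrite sp0.
apply/eqP; rewrite eq_le; apply/andP; split.
  by apply: ge_ereal_sup => _ [z /sP/andP[_ h] <-].
case E1 : (shift_radius s) => [x| |]//.
- have x0 : 0 <= x by rewrite -lee_fin -E1 shift_radius_ge0.
  apply: ereal_sup_ubound; exists x%:C; first exact: attained.
  by rewrite cn_real ger0_norm.
- have mN : maps_into coord (seq_translate (- s)).
    have nm : ~ maps_into coord (seq_translate s).
      by move=> /shift_radius_maps; rewrite E1.
    by case: s1 shift_bounded nm => -> [] // ?; rewrite ?opprK.
  have := shift_radius_maps mN; have := shift_radius_ge0 (- s).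
  have /sP/andP[+ _] := sz0.
  case E2 : (shift_radius (- s)) => [t| |]// tz _ _.
  have tz' (x : R) : cn z0 <= x -> spec coord (seq_translate s) x%:C.
    move=> zx; have x0 : 0 <= x by apply: le_trans zx; exact: rnorm_ge0.
    apply/sP; rewrite E1 leey andbT E2 cn_real ger0_norm//.
    by apply: le_trans tz _; rewrite lee_fin.
  rewrite leye_eq; apply/eqP; apply/eqyP => A A0.
  pose x := Num.max A (cn z0).
  apply: (@le_trans _ _ x%:E); first by rewrite lee_fin le_max lexx.
  apply: ereal_sup_ubound; exists x%:C.
    by apply: tz'; rewrite le_max lexx orbT.
  by rewrite cn_real gtr0_norm// lt_max A0.
by have := shift_radius_ge0 s; rewrite E1.
Qed.

End SpectralRadius.

(** * Toeplitz inequalities on the circles of the spectrum *)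

Section ToeplitzBound.
Variables (R : realType) (E : completeNormedModType R[i]).
Variable coord : {linear E -> (int -> R[i]^o)}.
Context {HE : HomSpace coord}.
Local Notation F x := (finsupp (coord x)).
Local Notation U := (translate coord).
Local Notation ee := (basis coord).
Local Notation C := (twist_norm coord).
Local Notation cn z := (rnorm (z : R[i]^o)).
Local Notation D s z a := (U s a - z *: a).
Implicit Types (s : int) (x y a : E) (z : R[i]).

(** The Toeplitz matrices with entries [c (i - j)] have norm at most [B]; by
    homogeneity, the mean of the squares stands for the product of the
    norms. *)
Definition toeplitz_bounded (c : int -> R[i]) (B : R) : Prop :=
  forall K (u v : nat -> R[i]),
    cn (\sum_(i < K) \sum_(j < K) u i * conjc (v j) * c (i%:Z - j%:Z)) <=
    B * ((\sum_(i < K) cn (u i) ^+ 2 + \sum_(j < K) cn (v j) ^+ 2) / 2).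

Lemma toeplitz_coef c B n : toeplitz_bounded c B -> cn (c n) <= B.
Proof.
move=> hc; have [p [q pq]] := int_natB n; pose K := (p + q).+1.
have pK : (p < K)%N by rewrite /K; lia.
have qK : (q < K)%N by rewrite /K; lia.
have := hc K (fun i => (i == p)%:R) (fun j => (j == q)%:R).
rewrite !sum_cn_delta// -[1 + 1]/(2%:R) divff ?pnatr_eq0// mulr1; congr (_ <= _).
rewrite (bigD1 (Ordinal pK))//= [X in _ + X]big1 ?addr0; last first.
  move=> i; rewrite -val_eqE /= => /negbTE ->; apply: big1 => j _.
  by rewrite !mul0r.
rewrite (bigD1 (Ordinal qK))//= [X in _ + X]big1 ?addr0; last first.
  move=> i; rewrite -val_eqE /= => /negbTE ->.
  by rewrite conjc0 mulr0 mul0r.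
by rewrite !eqxx conjc1 !mul1r -pq.
Qed.

Section Direction.
Variables (s : int) (rho : R).
Hypotheses (s1 : s = 1 \/ s = -1) (rho0 : 0 < rho).

Let ss : s * s = 1. Proof. by case: s1 => ->. Qed.

Let rC : R[i] := rho%:C.

Let rC0 : rC != 0. Proof. by rewrite -cn_eq0 cn_real gtr0_norm// gt_eqF. Qed.

Lemma int_dir_ind (P : int -> Prop) : P 0 -> (forall k, P k -> P (k + s)) ->
  (forall k, P k -> P (k - s)) -> forall k, P k.
Proof.
move=> P0 Pp Pm.
have [P1 P2] : (forall k, P k -> P (k + 1)) /\ (forall k, P k -> P (k - 1)).
  case: s1 Pp Pm => -> Pp Pm; split=> k Pk; [exact: Pp|exact: Pm| |exact: Pp].
  by have := Pm k Pk; rewrite opprK.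
elim/int_rect => // n IH; first by rewrite -addn1 PoszD; exact: P1.
by rewrite -addn1 PoszD opprD; exact: P2.
Qed.

(** Division by [U s - rho] on the Laurent polynomials: the remainder is the
    value at [rho]. *)
Lemma division_ee k : exists2 g, F g & ee k = rC ^ (s * k) *: ee 0 + D s rC g.
Proof.
elim/int_dir_ind: k => [|k [g Fg e]|k [g Fg e]].
- exists 0; first exact: F0.
  by rewrite mulr0 expr0z scale1r D0 addr0.
- exists (rC *: g + ee k); first by apply: F_comb => //; exact: F_ee.
  rewrite D_comb//; last exact: F_ee.
  rewrite tr_ee addrA mulrDr ss expfzDr// expr1z mulrC -scalerA -scalerDr -e.
  by rewrite addrC subrK.
exists (rC^-1 *: (g - ee (k - s))).
  by apply: FZ; apply: FB => //; exact: F_ee.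
have Fk : F (ee (k - s)) by exact: F_ee.
rewrite DZ; last exact: FB.
rewrite mulrBr ss expfzDr// exprN1 mulrC -scalerA -scalerDr.
have -> : D s rC (g - ee (k - s)) = D s rC g - D s rC (ee (k - s)).
  by rewrite trB// scalerBr !opprB addrACA [RHS]addrACA; congr (_ + _); rewrite addrC.
by rewrite addrA -e tr_ee subrK opprB addrCA subrr addr0 scalerA mulVf// scale1r.
Qed.

Lemma division_sum I (r : seq I) (f : I -> R[i]) (k : I -> int) :
  exists2 g, F g & \sum_(i <- r) f i *: ee (k i) =
    (\sum_(i <- r) f i * rC ^ (s * k i)) *: ee 0 + D s rC g.
Proof.
elim: r => [|i r [g Fg e]].
  exists 0; first exact: F0.
  by rewrite !big_nil scale0r D0 addr0.
have [h Fh eh] := division_ee (k i).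
exists (f i *: h + g); first exact: F_comb.
rewrite !big_cons e eh D_comb// scalerDr scalerDl scalerA addrACA.
by [].
Qed.

Lemma division x : F x -> exists l g, F g /\ x = l *: ee 0 + D s rC g.
Proof.
move=> /F_decomp[r _ ->].
have [g Fg e] := division_sum r (coord x) id.
by exists (\sum_(i <- r) coord x i * rC ^ (s * i)), g.
Qed.

(** If [ee 0] were a limit of elements of the range, then by division so would
    be every finite sum, and the range would be dense. Hence [ee 0] is at a
    positive distance from the range, and the value at [rho], which is the
    coefficient of [ee 0] modulo the range, is a continuous functional. *)
Lemma residue_bound :
  ~ (forall y (e : R), 0 < e -> exists2 a, F a & rnorm (y - D s rC a) < e) ->
  exists2 d, 0 < d & forall (l : R[i]) g, F g -> d * cn l <= rnorm (l *: ee 0 + D s rC g).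
Proof.
move=> nd; have [d d0 hd] : exists2 d, 0 < d & forall g, F g -> d <= rnorm (ee 0 - D s rC g).
  apply: contrapT => H; apply: nd => y e e0.
  have e2 : 0 < e / 2 by rewrite divr_gt0.
  have [a Fa ya] := finsupp_dense y e2.
  have [l [g [Fg al]]] := division Fa.
  have l1 : 0 < cn l + 1 by rewrite ltr_wpDl ?rnorm_ge0.
  have [h Fh hh] : exists2 h, F h & rnorm (ee 0 - D s rC h) < e / 2 / (cn l + 1).
    apply: contrapT => H2; apply: H; exists (e / 2 / (cn l + 1)); first by rewrite divr_gt0.
    by move=> h Fh; rewrite leNgt; apply/negP => ?; apply: H2; exists h.
  exists (l *: h + g); first exact: F_comb.
  rewrite D_comb//; apply: le_lt_trans (ler_rdist a _ _) _.
  have -> : a - (l *: D s rC h + D s rC g) = l *: (ee 0 - D s rC h).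
    by rewrite al opprD addrACA subrr addr0 -scalerBr.
  rewrite rnormZ; move: hh; rewrite ltr_pdivlMr// => hh.
  by have := rnorm_ge0 (ee 0 - D s rC h); nra.
exists d => // l g Fg; have [->|l0] := eqVneq l 0.
  by rewrite rnorm0 mulr0 rnorm_ge0.
have := hd (- (l^-1 *: g)) (FN (FZ _ Fg)).
have nl : 0 < cn l by rewrite rnorm_gt0.
move=> /(ler_wpM2r (ltW nl)) h; apply: le_trans h _.
rewrite mulrC -rnormZ scalerBr.
suff -> : - (l *: D s rC (- (l^-1 *: g))) = D s rC g by [].
have -> : - (l^-1 *: g) = (- l^-1) *: g by rewrite scaleNr.
by rewrite DZ// scaleNr scalerN opprK scalerA divff// scale1r.
Qed.

(** The value at [rho] is applied to the Toeplitz inequality for [ee 0]; it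
    maps [U n (ee 0)] to the power [rho ^ (s * n)]. *)
Lemma toeplitz_residue :
  ~ (forall y (e : R), 0 < e -> exists2 a, F a & rnorm (y - D s rC a) < e) ->
  exists2 C', 0 <= C' & forall (M : {linear E -> E}) (B : R), multiplier coord M ->
    (forall x, rnorm (M x) <= B * rnorm x) ->
    toeplitz_bounded (fun n => symbol coord M n * rC ^ (s * n)) (C' * B).
Proof.
move=> /residue_bound[d d0 hd].
exists (C ^+ 2 * rnorm (ee 0) / d).
  by rewrite divr_ge0 ?mulr_ge0 ?rnorm_ge0 ?exprn_ge0 ?twist_norm_ge0 ?ltW.
move=> M B Mm MB K u v.
have := mult_toeplitz (HE := HE) Mm MB K u v (F_ee (HE := HE) 0).
rewrite !pair_big /=.
under eq_bigr do rewrite tr_ee add0r.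
have [g Fg ->] := division_sum (index_enum ('I_K * 'I_K)%type)
   (fun p => u p.1 * conjc (v p.2) * symbol coord M (p.1%:Z - p.2%:Z)) (fun p => p.1%:Z - p.2%:Z).
move=> h; rewrite -(ler_pM2l d0); have := le_trans (hd _ _ Fg) h; congr (d * cn _ <= _).
  by apply: eq_bigr => p _; rewrite mulrA.
by field; rewrite gt_eqF.
Qed.

(** Along approximate eigenvectors of [U s] at [rho], all the translations are
    close to scalars; the preliminary translation by [K] avoids the powers of
    the inverse of [U s], which may be unbounded. *)
Lemma toeplitz_eigen (k : R) : 0 <= k -> (forall a, F a -> rnorm (U s a) <= k * rnorm a) ->
  ~ (exists2 c, 0 < c & forall a, F a -> c * rnorm a <= rnorm (D s rC a)) ->
  forall (M : {linear E -> E}) (B : R), multiplier coord M ->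
    (forall x, rnorm (M x) <= B * rnorm x) ->
    toeplitz_bounded (fun n => symbol coord M n * rC ^ (s * n)) (C ^+ 2 * B).
Proof.
move=> k0 hk nlow M B Mm MB K u v.
have ae (e : R) : 0 < e -> exists2 a, F a & rnorm (D s rC a) < e * rnorm a.
  move=> e0; apply: contrapT => H; apply: nlow; exists e => // a Fa.
  by rewrite leNgt; apply/negP => ?; apply: H; exists a.
(* A bound for the distance from [U (s * n) a] to [rho ^ n *: a], relative to
   the norm of [D s rC a]. *)
pose A := fix A n := if n is n'.+1 then k * A n' + rho ^+ n' else 0.
have A0 n : 0 <= A n.
  by elim: n => //= n IH; rewrite addr_ge0 ?mulr_ge0// exprn_ge0// ltW.
have hA n a : F a -> rnorm (U (s * n%:Z) a - rC ^+ n *: a) <= A n * rnorm (D s rC a).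
  move=> Fa; elim: n => [|n IH].
    by rewrite mulr0 tr0// expr0 scale1r subrr rnorm0 mul0r.
  have -> : U (s * n.+1%:Z) a - rC ^+ n.+1 *: a =
      U s (U (s * n%:Z) a - rC ^+ n *: a) + rC ^+ n *: D s rC a.
    rewrite trB ?trZ ?tr_tr//; [|exact: F_tr|exact: FZ].
    rewrite scalerBr addrA subrK scalerA -exprSr; congr (U _ a - _).
    by rewrite -addn1 PoszD; ring.
  apply: le_trans (ler_rnormD _ _) _; rewrite /= mulrDl; apply: lerD.
    apply: le_trans (hk _ _) _; first by apply: FB; [exact: F_tr|exact: FZ].
    by rewrite -mulrA ler_wpM2l.
  by rewrite rnormZ cnX cn_real gtr0_norm.
pose n_ (i j : 'I_K) : nat := absz (s * (i%:Z - j%:Z) + K%:Z).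
have nE i j : (n_ i j)%:Z = s * (i%:Z - j%:Z) + K%:Z.
  rewrite gez0_abs//; have := ltn_ord i; have := ltn_ord j.
  by case: s1 => ->; lia.
pose t (i j : 'I_K) := u i * conjc (v j) * symbol coord M (i%:Z - j%:Z).
pose S := \sum_(i < K) \sum_(j < K) t i j * rC ^+ n_ i j.
pose Q := \sum_(i < K) \sum_(j < K) cn (t i j) * A (n_ i j).
pose W := (\sum_(i < K) cn (u i) ^+ 2 + \sum_(j < K) cn (v j) ^+ 2) / 2.
have W0 : 0 <= W.
  by rewrite divr_ge0// addr_ge0//; apply: sumr_ge0 => i _; exact: sqr_ge0.
have B0 : 0 <= B by exact: mult_norm_ge0 MB.
have Q0 : 0 <= Q.
  by apply: sumr_ge0 => i _; apply: sumr_ge0 => j _; rewrite mulr_ge0 ?rnorm_ge0.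
have C2 : 0 <= C ^+ 2 * B by rewrite mulr_ge0// exprn_ge0// twist_norm_ge0.
have key (e : R) : 0 < e -> cn S <= C ^+ 2 * B * (rho ^+ K + A K * e) * W + Q * e.
  move=> e0; have [a Fa ha] := ae e e0.
  have na : 0 < rnorm a.
    rewrite lt_def rnorm_ge0 andbT; apply: contraTneq ha => ->.
    by rewrite mulr0 -leNgt rnorm_ge0.
  pose a' := U (s * K%:Z) a.
  have a'le : rnorm a' <= (rho ^+ K + A K * e) * rnorm a.
    rewrite -[a'](subrK (rC ^+ K *: a)); apply: le_trans (ler_rnormD _ _) _.
    rewrite mulrDl addrC; apply: lerD; first by rewrite rnormZ cnX cn_real gtr0_norm.
    apply: le_trans (hA _ _ Fa) _; rewrite -mulrA ler_wpM2l//; exact: ltW.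
  have := mult_toeplitz (HE := HE) Mm MB K u v (F_tr (HE := HE) (s * K%:Z) Fa); rewrite -/a' -/W.
  set X := \sum_(i < K) _ => hX.
  have XS : X = S *: a + \sum_(i < K) \sum_(j < K) t i j *: (U (s * (n_ i j)%:Z) a - rC ^+ n_ i j *: a).
    rewrite /S scaler_suml -big_split; apply: eq_bigr => i _ /=.
    rewrite scaler_suml -big_split; apply: eq_bigr => j _ /=.
    rewrite scalerBr !scalerA addrC subrK; congr (_ *: _).
    by rewrite /a' tr_tr// nE; congr (U _ a); rewrite mulrDr mulrA ss mul1r.
  have err : rnorm (\sum_(i < K) \sum_(j < K) t i j *: (U (s * (n_ i j)%:Z) a - rC ^+ n_ i j *: a))
      <= Q * e * rnorm a.
    rewrite -mulrA /Q mulr_suml; apply: le_trans (rnorm_sum _ _ _) _; apply: ler_sum => i _.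
    rewrite mulr_suml; apply: le_trans (rnorm_sum _ _ _) _; apply: ler_sum => j _.
    rewrite rnormZ -mulrA ler_wpM2l ?rnorm_ge0//; apply: le_trans (hA _ _ Fa) _.
    by rewrite ler_wpM2l//; exact: ltW.
  rewrite -(ler_pM2r na) mulrDl -rnormZ.
  rewrite -[S *: a](addrK (\sum_(i < K) \sum_(j < K) t i j *: (U (s * (n_ i j)%:Z) a - rC ^+ n_ i j *: a))) -XS.
  apply: le_trans (ler_rnormB _ _) _; apply: lerD => //.
  apply: le_trans hX _; have := ler_wpM2r W0 (ler_wpM2l C2 a'le).
  by move/le_trans; apply; rewrite le_eqVlt; apply/orP; left; apply/eqP; ring.
have {key} key : cn S <= C ^+ 2 * B * rho ^+ K * W.
  apply/ler_addgt0Pr => e e0.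
  pose L := C ^+ 2 * B * A K * W + Q + 1.
  have L0 : 0 < L.
    by rewrite ltr_wpDl// addr_ge0//; apply: mulr_ge0 => //; apply: mulr_ge0.
  have := key (e / L) (divr_gt0 e0 L0); move/le_trans; apply.
  have -> : C ^+ 2 * B * (rho ^+ K + A K * (e / L)) * W + Q * (e / L) =
     C ^+ 2 * B * rho ^+ K * W + (L - 1) * (e / L) by rewrite /L; ring.
  rewrite lerD2l mulrA ler_pdivrMr// mulrC ler_pM2l//.
  by rewrite gerBl.
have rK : 0 < rho ^+ K by rewrite exprn_gt0.
rewrite -(ler_pM2r rK) -/W.
have <- : cn (rC ^+ K) = rho ^+ K by rewrite cnX cn_real gtr0_norm.
rewrite -cnM mulr_suml.
rewrite (_ : \sum_(i < K) _ = S).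
  by apply: le_trans key _; rewrite cnX cn_real gtr0_norm// mulrAC.
apply: eq_bigr => i _; rewrite mulr_suml; apply: eq_bigr => j _.
rewrite /t !mulrA -!mulrA; do !congr (_ * _).
by rewrite !exprnP -expfzDr// nE.
Qed.

(** A point is not regular for one of two reasons: approximate eigenvectors,
    or a range that is not dense. *)
Lemma toeplitz_direction : maps_into coord (seq_translate s) -> ~ regular coord s rC ->
  exists2 C', 0 <= C' & forall (M : {linear E -> E}) (B : R), multiplier coord M ->
    (forall x, rnorm (M x) <= B * rnorm x) ->
    toeplitz_bounded (fun n => symbol coord M n * rC ^ (s * n)) (C' * B).
Proof.
move=> /closed_graph[k k0 hk] /not_andP[nlow|]; last exact: toeplitz_residue.
exists (C ^+ 2); first by rewrite exprn_ge0// twist_norm_ge0.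
apply: (toeplitz_eigen k0) => // a Fa; apply: hk.
by rewrite coord_tr_fun.
Qed.

End Direction.

Hypothesis shift_bounded : maps_into coord (seq_translate 1) \/ maps_into coord (seq_translate (-1)).

(** The bounded shift is used, whichever it is: the spectra of the two shifts
    are images of each other by inversion, so that [r^-1] is in the spectrum
    of the inverse shift. *)
Lemma toeplitz_spec (r : R) : 0 < r -> spec coord (seq_translate 1) r%:C ->
  exists2 C', 0 <= C' & forall (M : {linear E -> E}) (B : R), multiplier coord M ->
    (forall x, rnorm (M x) <= B * rnorm x) ->
    toeplitz_bounded (fun n => symbol coord M n * (r ^ n)%:C) (C' * B).
Proof.
move=> r0 spr; have [sb|sb] := shift_bounded.
  have [//||C' C'0 h] := toeplitz_direction (s := 1) (rho := r) _ r0 sb; first by left.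
    exact/specP.
  exists C' => // M B Mm MB; have := h M B Mm MB; congr (toeplitz_bounded _ _).
  by apply: funext => n; rewrite mul1r real_exprz.
have rV : 0 < r^-1 by rewrite invr_gt0.
have [//||C' C'0 h] := toeplitz_direction (s := -1) (rho := r^-1) _ rV sb; first by right.
  apply/specP/(shift_specP shift_bounded); first by [].
  have /andP[h1 h2] := proj1 (shift_specP (HE := HE) shift_bounded r%:C (mulr1 (1 : int))) spr.
  move: h1 h2; rewrite !cn_real !gtr0_norm// !inve_le_fin ?shift_radius_ge0//.
  by rewrite opprK invrK => -> ->.
exists C' => // M B Mm MB; have := h M B Mm MB; congr (toeplitz_bounded _ _).
by apply: funext => n; rewrite mulN1r -real_exprz exprz_inv opprK.
Qed.

End ToeplitzBound.

(** * Power series *)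

Section PowerSeries.
Variable R : realType.
Local Notation cn z := (rnorm (z : R[i]^o)).

Lemma cauchy_cn_cvg (u : nat -> R[i]^o) :
  (forall e : R, 0 < e -> exists N, forall n m, (N <= n)%N -> (N <= m)%N ->
    cn (u n - u m) < e) -> exists x : R[i]^o, u @ \oo --> x.
Proof.
move=> h.
have part (f : R[i] -> R) : (forall z w, f (z - w) = f z - f w) ->
    (forall z, `|f z| <= cn z) -> exists x : R, (fun n => f (u n)) @ \oo --> x.
  move=> fB fle; apply/cvg_ex/cauchy_cvgP/cauchy_ballP => e e0.
  have [N hN] := h _ e0.
  exists ((fun n => f (u n)) @` [set n | N <= n]%N, (fun n => f (u n)) @` [set n | N <= n]%N).
    by split; exists N => // n Nn; exists n.
  move=> -[_ _] /= [[n Nn <-] [m Nm <-]].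
  rewrite -ball_normE /= -fB; apply: le_lt_trans (fle _) _; exact: hN.
have [|x ux] := part (@complex.Re R) _ (@Re_le_cn R); first by move=> [? ?] [? ?].
have [|y uy] := part (@complex.Im R) _ (@Im_le_cn R); first by move=> [? ?] [? ?].
exists (x +i* y : R[i]^o); apply/cvg_rnormP => e e0.
have e2 : 0 < e / 2 by rewrite divr_gt0.
move/cvgrPdistC_lt : ux => /(_ _ e2)[N1 _ h1].
move/cvgrPdistC_lt : uy => /(_ _ e2)[N2 _ h2].
exists (maxn N1 N2) => n; rewrite geq_max => /andP[n1 n2].
apply: le_lt_trans (cn_le_ReIm _) _.
have := h1 n n1; have := h2 n n2; rewrite /=.
by case: (u n) => a b /= hb ha; lra.
Qed.

Lemma geom_tail_le (q : R) n m : 0 <= q < 1 ->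
  \sum_(n <= k < m) q ^+ k <= q ^+ n * (1 - q)^-1.
Proof.
move=> q01; have /andP[q0 q1] := q01.
rewrite -{1}[n]add0n big_addn big_mkord.
under eq_bigr do rewrite addnC exprD.
by rewrite -mulr_sumr ler_wpM2l ?exprn_ge0//; exact: geom_sum_le.
Qed.

Lemma series_geom_cvg (u : nat -> R[i]^o) (K q : R) : 0 <= q < 1 ->
  (forall n, cn (u n) <= K * q ^+ n) -> exists l : R[i]^o, series u @ \oo --> l.
Proof.
move=> q01 hu; have /andP[q0 q1] := q01.
have K0 : 0 <= K by have := hu 0%N; rewrite expr0 mulr1; apply: le_trans; exact: rnorm_ge0.
have tail n m : (n <= m)%N -> cn (series u m - series u n) <= q ^+ n * (K / (1 - q)).
  move=> nm; rewrite sub_series_geq//; apply: le_trans (rnorm_sum _ _ _) _.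
  apply: (@le_trans _ _ (\sum_(n <= k < m) K * q ^+ k)); first by apply: ler_sum => k _.
  rewrite -mulr_sumr mulrCA ler_wpM2l//; exact: geom_tail_le.
apply: cauchy_cn_cvg => e e0.
have e2 : 0 < e / 2 by rewrite divr_gt0.
have [N hN] := geom_small (K / (1 - q)) q01 e2.
exists N => n m Nn Nm.
apply: le_lt_trans (ler_rdist (series u N : R[i]^o) _ _) _.
have := tail _ _ Nn; have := tail _ _ Nm; rewrite [rnorm (series u N - _)]rdistC; lra.
Qed.

Lemma series_geom_le (u : nat -> R[i]^o) (K q : R) (l : R[i]^o) : 0 <= q < 1 ->
  (forall n, cn (u n) <= K * q ^+ n) -> series u @ \oo --> l -> cn l <= K / (1 - q).
Proof.
move=> q01 hu ul; have /andP[q0 q1] := q01.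
have K0 : 0 <= K by have := hu 0%N; rewrite expr0 mulr1; apply: le_trans; exact: rnorm_ge0.
apply: (rnorm_cvg_le ul) => n; apply: le_trans (rnorm_sum _ _ _) _.
apply: (@le_trans _ _ (\sum_(0 <= k < n) K * q ^+ k)); first by apply: ler_sum => k _.
by rewrite -mulr_sumr ler_wpM2l// big_mkord; exact: geom_sum_le.
Qed.

(** By induction on [n]; the right-hand side is summable against coefficients
    that decay geometrically faster than [r ^- n]. *)
Lemma taylor_remainder (w h : R[i]) (r : R) n : 0 < r -> cn w + cn h <= r ->
  cn ((w + h) ^+ n - w ^+ n - h * (n%:R * w ^+ n.-1)) <= cn h ^+ 2 * (n%:R ^+ 2 * r ^+ n / r ^+ 2).
Proof.
move=> r0 whr; have h0 := rnorm_ge0 (h : R[i]^o); have w0 := rnorm_ge0 (w : R[i]^o).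
have wr : cn w <= r by lra.
elim: n => [|n IH].
  by rewrite !expr0 mul0r mulr0 subr0 subrr rnorm0 expr0n !mul0r mulr0.
have -> : (w + h) ^+ n.+1 - w ^+ n.+1 - h * (n.+1%:R * w ^+ n.+1.-1) =
    (w + h) * ((w + h) ^+ n - w ^+ n - h * (n%:R * w ^+ n.-1)) + h ^+ 2 * (n%:R * w ^+ n.-1).
  case: n {IH} => [|m] /=; first by rewrite !expr1 !expr0; ring.
  by rewrite !exprS; ring.
apply: le_trans (ler_rnormD _ _) _.
have h1 : cn ((w + h) * ((w + h) ^+ n - w ^+ n - h * (n%:R * w ^+ n.-1))) <=
    r * (cn h ^+ 2 * (n%:R ^+ 2 * r ^+ n / r ^+ 2)).
  rewrite cnM; apply: ler_pM; rewrite ?rnorm_ge0//.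
  exact: le_trans (ler_rnormD _ _) _.
have h2 : cn (h ^+ 2 * (n%:R * w ^+ n.-1)) <= cn h ^+ 2 * (n%:R * r ^+ n.+1 / r ^+ 2).
  rewrite cnM cnX ler_wpM2l ?exprn_ge0//.
  case: n {IH h1} => [|n] /=; first by rewrite !mul0r rnorm0.
  rewrite cnM cn_natr cnX -mulrA ler_wpM2l//.
  rewrite [r ^+ n.+2](_ : _ = r ^+ n * r ^+ 2) ?mulfK ?expf_neq0 ?gt_eqF//; last by rewrite -exprD addn2.
  by rewrite lerXn2r ?nnegrE// ltW.
apply: le_trans (lerD h1 h2) _.
have -> : r * (cn h ^+ 2 * (n%:R ^+ 2 * r ^+ n / r ^+ 2)) + cn h ^+ 2 * (n%:R * r ^+ n.+1 / r ^+ 2) =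
   cn h ^+ 2 * ((n%:R ^+ 2 + n%:R) * (r ^+ n.+1 / r ^+ 2)) by rewrite (exprS r n); ring.
rewrite ler_wpM2l ?exprn_ge0// -mulrA ler_wpM2r ?divr_ge0 ?exprn_ge0 ?(ltW r0)//.
rewrite -natr1; have : 0 <= n%:R :> R by []; nra.
Qed.

Lemma square_geom (q : R) : 0 <= q < 1 -> exists A t, [/\ 0 <= A, 0 <= t < 1 &
  forall n : nat, n%:R ^+ 2 * q ^+ n <= A * t ^+ n].
Proof.
(* The number [p] exceeds [1], so that its powers absorb the factor [n], and
   is small enough for [p ^+ 2 * q] to be less than [1]. *)
move=> /andP[q0 q1]; pose d := (1 - q) / 4; pose p := 1 + d.
have d0 : 0 < d by rewrite divr_gt0// subr_gt0.
have np (n : nat) : n%:R <= p ^+ n / d.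
  rewrite ler_pdivlMr//; elim: n => [|n IH]; first by rewrite mul0r.
  rewrite -natr1 exprS /p.
  have : 1 <= (1 + d) ^+ n by rewrite exprn_ege1// lerDl ltW.
  by move: IH; rewrite /p; move: ((1 + d) ^+ n) => x; nra.
exists (d ^- 2), (p ^+ 2 * q); split.
- by rewrite invr_ge0 exprn_ge0// ltW.
- have -> : p = 1 + (1 - q) / 4 by [].
  by rewrite mulr_ge0 ?exprn_ge0//=; [nra|lra].
move=> n; rewrite (exprMn _ (p ^+ 2) q) [leRHS]mulrA ler_wpM2r ?exprn_ge0//.
rewrite mulrC exprAC -expr_div_n ler_pXn2r// nnegrE//.
by apply: le_trans (np n).
Qed.

Section Terms.
Variables (a : nat -> R[i]) (k : nat) (r K : R).
Hypotheses (r0 : 0 < r) (ha : forall n, cn (a n) * r ^+ (n + k) <= K).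

Let term (w : R[i]) : nat -> R[i]^o := fun n => a n * w ^+ (n + k).

(** The exponents start at [k]: the nonnegative part of a Laurent series has
    [k = 0], and the negative part is the case [k = 1], at the inverse of
    [z]. *)
Definition power_sum (w : R[i]^o) : R[i]^o := lim (series (term w) @ \oo).

Lemma power_cvg (w : R[i]) : cn w < r -> series (term w) @ \oo --> power_sum w.
Proof.
move=> wr; suff [l] : exists l : R[i]^o, series (term w) @ \oo --> l.
  by move=> h; rewrite /power_sum (cvg_lim _ h).
have K0 : 0 <= K by apply: le_trans (ha 0); rewrite mulr_ge0 ?rnorm_ge0// exprn_ge0// ltW.
have q01 : 0 <= cn w / r < 1.
  by rewrite divr_ge0 ?rnorm_ge0 ?ltW//= ltr_pdivrMr// mul1r.
have /andP[q0 q1] := q01.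
apply: (@series_geom_cvg _ K (cn w / r)) => // n.
have -> : cn (term w n) = cn (a n) * r ^+ (n + k) * (cn w / r) ^+ (n + k).
  rewrite /term cnM cnX expr_div_n -!mulrA; congr (_ * _).
  by rewrite mulrCA divff ?mulr1// expf_neq0// gt_eqF.
apply: le_trans (ler_wpM2r (exprn_ge0 _ q0) (ha n)) _.
rewrite ler_wpM2l// exprD ler_piMr ?exprn_ge0// exprn_ile1//; exact: ltW.
Qed.

(** The second-order remainders of the terms have a convergent sum, which
    gives a remainder for the power series. *)
Lemma power_derivable (w : R[i]^o) : cn w < r -> derivable power_sum w 1.
Proof.
move=> wr; have w0 := rnorm_ge0 (w : R[i]^o).
have K0 : 0 <= K by apply: le_trans (ha 0); rewrite mulr_ge0 ?rnorm_ge0// exprn_ge0// ltW.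
pose r' := (cn w + r) / 2.
have r'0 : 0 < r' by rewrite /r'; lra.
have wr' : cn w < r' by rewrite /r'; lra.
have r'r : r' < r by rewrite /r'; lra.
clearbody r'.
have q01 : 0 <= r' / r < 1 by rewrite divr_ge0 ?ltW//= ltr_pdivrMr// mul1r.
have [A [t [A0 t01 At]]] := square_geom q01; have /andP[t0 t1] := t01.
have main n : cn (a n) * ((n + k)%:R ^+ 2 * r' ^+ (n + k)) <= K * A * t ^+ n.
  have -> : cn (a n) * ((n + k)%:R ^+ 2 * r' ^+ (n + k)) =
      cn (a n) * r ^+ (n + k) * ((n + k)%:R ^+ 2 * (r' / r) ^+ (n + k)).
    have : r ^+ (n + k) != 0 by rewrite expf_neq0// gt_eqF.
    rewrite expr_div_n; move: (r ^+ _) (r' ^+ _) (cn _) => x y w' x0; field.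
    exact: x0.
  apply: (@le_trans _ _ (K * (A * t ^+ (n + k)))).
    apply: ler_pM => //; first by rewrite mulr_ge0 ?rnorm_ge0// exprn_ge0// ltW.
    by rewrite mulr_ge0 ?exprn_ge0// divr_ge0 ?ltW.
  rewrite -mulrA ler_wpM2l// ler_wpM2l// exprD ler_piMr ?exprn_ge0//.
  by rewrite exprn_ile1// ltW.
pose dterm : nat -> R[i]^o := fun n => a n * ((n + k)%:R * w ^+ (n + k).-1).
have [d hd] : exists d : R[i]^o, series dterm @ \oo --> d.
  apply: (@series_geom_cvg _ (K * A / r') t) => // n.
  rewrite mulrAC ler_pdivlMr//; apply: le_trans (main n).
  rewrite /dterm !cnM cn_natr cnX -!mulrA ler_wpM2l ?rnorm_ge0//.
  case: (n + k)%N => [|m]; first by rewrite !mul0r.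
  rewrite /= ler_wpM2l// exprSr.
  have h1 : cn w ^+ m * r' <= r' ^+ m * r'.
    by rewrite ler_wpM2r ?(ltW r'0)// lerXn2r ?nnegrE// ltW.
  have m1 : 1 <= m.+1%:R :> R by rewrite ler1n.
  have m0 : 0 <= r' ^+ m * r' by rewrite mulr_ge0 ?exprn_ge0// ltW.
  by apply: le_trans h1 _; rewrite ler_peMl.
pose B := K * A / r' ^+ 2 / (1 - t).
have B0 : 0 <= B.
  by rewrite !divr_ge0 ?mulr_ge0 ?exprn_ge0 ?(ltW r'0)// subr_ge0 ltW.
have rem (h : R[i]) : cn h <= r' - cn w ->
    cn (power_sum (w + h) - power_sum w - h * d) <= cn h ^+ 2 * B.
  move=> hr; have whr : cn w + cn h <= r' by lra.
  have wh : cn (w + h) < r by apply: le_lt_trans (ler_rnormD _ _) _; lra.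
  pose eterm : nat -> R[i]^o := fun n =>
    a n * ((w + h) ^+ (n + k) - w ^+ (n + k) - h * ((n + k)%:R * w ^+ (n + k).-1)).
  have he : series eterm @ \oo --> (power_sum (w + h) - power_sum w - h * d : R[i]^o).
    rewrite (_ : series eterm = fun n => series (term (w + h)) n - series (term w) n - h * series dterm n).
      apply: cvgB; first by apply: cvgB; exact: power_cvg.
      exact: (@cvg_scale R R[i]^o h).
    apply: funext => n; rewrite /series /= mulr_sumr -!sumrB; apply: eq_bigr => i _.
    by rewrite /eterm /term /dterm; ring.
  rewrite /B mulrA; apply: (series_geom_le t01 _ he) => n.
  rewrite /eterm cnM.
  apply: le_trans (ler_wpM2l (rnorm_ge0 _) (taylor_remainder (n + k) r'0 whr)) _.
  have r2 : 0 <= r' ^- 2 by rewrite invr_ge0 exprn_ge0// ltW.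
  have := ler_wpM2l (exprn_ge0 2 (rnorm_ge0 (h : R[i]^o))) (ler_wpM2r r2 (main n)).
  by congr (_ <= _); ring.
apply/cvg_ex; exists d; apply/cvgrPdist_lt => e /posc_real[-> e0].
pose m := Num.min (r' - cn w) (complex.Re e / (B + 1)).
have B1 : 0 < B + 1 by rewrite ltr_wpDl.
have m0 : 0 < m by rewrite lt_min subr_gt0 wr' divr_gt0.
apply/(@nbhs_rnormP R R[i]^o); exists m => // h; rewrite sub0r rnormN => hm h0.
rewrite -[`|_|]/(`|_ : R[i]^o|) rnormE ltcR.
have nh : 0 < cn h by rewrite rnorm_gt0.
move: hm; rewrite lt_min => /andP[/ltW h1 h2].
have := rem h h1 => h3.
rewrite [X in h^-1 *: (X - _)](_ : _ = power_sum (w + h)); last first.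
  by rewrite /= [_ + w]addrC; congr (power_sum (w + _)); exact: mulr1.
rewrite rdistC -(ltr_pM2l nh) -cnM mulrBr -[h^-1 *: _]/(h^-1 * _) mulVKf//.
apply: le_lt_trans h3 _; rewrite expr2 -mulrA ltr_pM2l//.
move: h2; rewrite ltr_pdivlMr// => h2; apply: le_lt_trans h2.
by rewrite ler_wpM2l ?rnorm_ge0// lerDl.
Qed.

End Terms.

End PowerSeries.

(** * Holomorphy of the symbols *)

Section LaurentSeries.
Variables (R : realType).
Local Notation cn z := (rnorm (z : R[i]^o)).

Lemma laurent_sumE (c : int -> R[i]^o) :
  laurent_sum c = (power_sum (fun n => c n%:Z) 0
     \+ (power_sum (fun n => c (- n.+1%:Z)) 1 \o GRing.inv))%R.
Proof.
apply: funext => z; rewrite /laurent_sum /power_sum /laurent_pos /laurent_neg /=.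
congr (lim (series _ @ \oo) + lim (series _ @ \oo)); apply: funext => n.
  by rewrite addn0.
by rewrite addn1 exprVn.
Qed.

(** The nonnegative powers converge inside the circle of radius [r], and the
    negative powers outside the circle of radius [r']; at [z = 0] there is no
    such circle, and the negative powers have to be absent. *)
Lemma laurent_holomorphic_at (c : int -> R[i]^o) (z : R[i]^o) (r K : R) :
  cn z < r -> (forall n : nat, cn (c n%:Z) * r ^+ n <= K) ->
  (z = 0 /\ forall n : int, n < 0 -> c n = 0) \/
  (exists2 r', 0 < r' < cn z & forall n : nat, cn (c (- n.+1%:Z)) * r' ^- n.+1 <= K) ->
  laurent_cvg c z /\ derivable (laurent_sum c) z 1.
Proof.
move=> zr hpos hneg; have r0 : 0 < r by apply: le_lt_trans zr; exact: rnorm_ge0.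
have h0 n : cn (c n%:Z) * r ^+ (n + 0) <= K by rewrite addn0.
have posE : laurent_pos c z = series (fun n : nat => c n%:Z * z ^+ (n + 0) : R[i]^o).
  by congr series; apply: funext => n; rewrite addn0.
have pos_cvg : cvg (laurent_pos c z @ \oo).
  by rewrite posE; apply/cvg_ex; eexists; exact: (power_cvg (k := 0) r0 h0 zr).
have pos_der := power_derivable (k := 0) r0 h0 zr.
rewrite laurent_sumE; case: hneg => [[z0 cneg]|[r' /andP[r'0 r'z] hneg]].
  have neg0 : (fun n : nat => c (- n.+1%:Z)) = fun=> 0.
    by apply: funext => n; rewrite cneg// oppr_lt0.
  have N0 : power_sum (fun n : nat => c (- n.+1%:Z)) 1 = fun=> 0.
    apply: funext => w; rewrite neg0 /power_sum.
    rewrite (_ : series _ = fun=> 0); first exact: lim_cst.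
    by apply: funext => n; rewrite /series /= big1// => i _; rewrite mul0r.
  split; last first.
    rewrite (_ : (_ \+ _) = power_sum (fun n : nat => c n%:Z) 0)//.
    by apply: funext => w; rewrite /= N0 addr0.
  split; [by move=> _; exact: cneg|exact: pos_cvg|].
  have -> : laurent_neg c z = fun=> 0.
    apply: funext => n; rewrite /laurent_neg /series /= big1// => i _.
    by rewrite cneg ?mul0r// oppr_lt0.
  by apply/cvg_ex; exists 0; exact: cvg_cst.
have zn0 : z != 0 by rewrite -cn_eq0 gt_eqF// (lt_trans r'0).
have r'V : 0 < r'^-1 by rewrite invr_gt0.
have h1 n : cn (c (- n.+1%:Z)) * r'^-1 ^+ (n + 1) <= K by rewrite addn1 exprVn.
have zV : cn z^-1 < r'^-1 by rewrite cnV ltf_pV2 ?posrE// (lt_trans r'0).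
have neg_der := power_derivable (k := 1) r'V h1 zV.
split.
  split; [by move=> z0; rewrite z0 eqxx in zn0|exact: pos_cvg|].
  rewrite (_ : laurent_neg c z = series (fun n : nat => c (- n.+1%:Z) * z^-1 ^+ (n + 1) : R[i]^o)).
    by apply/cvg_ex; eexists; exact: (power_cvg (k := 1) r'V h1 zV).
  by congr series; apply: funext => n; rewrite addn1 exprVn.
apply: derivableD; first exact: pos_der.
apply/derivable1_diffP; apply: differentiable_comp; first exact: differentiable_Rinv.
by apply/derivable1_diffP; exact: neg_der.
Qed.

End LaurentSeries.

Section HolomorphicSymbols.
Variables (R : realType) (E : completeNormedModType R[i]).
Variable coord : {linear E -> (int -> R[i]^o)}.
Context {HE : HomSpace coord}.
Local Notation F x := (finsupp (coord x)).
Local Notation U := (translate coord).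
Local Notation cn z := (rnorm (z : R[i]^o)).
Hypothesis shift_bounded : maps_into coord (seq_translate 1) \/ maps_into coord (seq_translate (-1)).

(** A nonzero coefficient at [n < 0] makes [U n] bounded, and then also
    [U (-1)], its product with a power of the bounded shift. *)
Lemma symbol_neg (M : {linear E -> E}) (n : int) : multiplier coord M ->
  ~ maps_into coord (seq_translate (-1)) -> n < 0 -> symbol coord M n = 0.
Proof.
move=> Mm nN n0; apply/eqP; apply: contrapT => /negP sn0; apply: nN.
have [sE|//] := shift_bounded.
have [r r0 [K K0 hK]] := power_bounded_shift sE.
have [Mc _] := Mm; have [B B0 nB] := opnorm_fin Mc.
have MB x : rnorm (M x) <= B * rnorm x by apply: opnorm_le; rewrite nB.
have {}sn0 : 0 < cn (symbol coord M n) by rewrite rnorm_gt0.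
pose m := `|(- n - 1)%R|%N.
have mE : m%:Z = - n - 1 by rewrite /m; lia.
pose A := twist_norm coord ^+ 2 * B / cn (symbol coord M n).
have A0 : 0 <= A.
  by rewrite divr_ge0 ?rnorm_ge0// mulr_ge0// exprn_ge0// twist_norm_ge0.
apply: (@F_bounded_shift _ _ _ _ _ (A * (K * r ^+ m))).
  by rewrite mulr_ge0// mulr_ge0 ?exprn_ge0 ?ltW.
move=> a Fa; have -> : U (-1) a = U n (U (1 * m%:Z) a).
  by rewrite tr_tr// mE; congr (U _ a); lia.
apply: (@le_trans _ _ (A * rnorm (U (1 * m%:Z) a))); last first.
  by rewrite -mulrA ler_wpM2l//; exact: hK.
rewrite /A mulrAC ler_pdivlMr// mulrC.
by apply: mult_coef => //; exact: F_tr.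
Qed.

(** The Toeplitz bounds on two circles of the spectrum, on either side of [z],
    make both parts of the Laurent series converge. When [z = 0] is in the
    spectrum, the inverse shift is not bounded, and the negative part
    vanishes. *)
Lemma symbol_holomorphic (M : {linear E -> E}) : multiplier coord M ->
  laurent_holomorphic (symbol coord M) (interior (spec coord (seq_translate 1) : set R[i]^o)).
Proof.
move=> Mm z /(@nbhs_rnormP R R[i]^o)[e e0 he].
have [Mc _] := Mm; have [B B0 nB] := opnorm_fin Mc.
have MB x : rnorm (M x) <= B * rnorm x by apply: opnorm_le; rewrite nB.
have spP w := shift_specP shift_bounded w (mulr1 (1 : int)).
have coef (r : R) : 0 < r -> spec coord (seq_translate 1) r%:C ->
    exists K, forall n, cn (symbol coord M n) * r ^ n <= K.
  move=> r0 /(toeplitz_spec shift_bounded r0)[C' C'0 h].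
  exists (C' * B) => n; have := toeplitz_coef n (h M B Mm MB).
  by rewrite cnM cn_real ger0_norm// exprz_ge0// ltW.
have spec_mod (w : R[i]) (r : R) : 0 < r -> cn w = r ->
    spec coord (seq_translate 1) w -> spec coord (seq_translate 1) r%:C.
  by move=> r0 wr /spP h; apply/spP; rewrite cn_real gtr0_norm// -wr.
have [w w1 wz] := ex_direction z.
have ray (t : R) : `|t| < e -> 0 < cn z + t -> spec coord (seq_translate 1) (cn z + t)%:C.
  move=> te zt.
  have zE : z + t%:C * w = (cn z + t)%:C * w by rewrite {1}wz -mulrDl -rmorphD.
  apply: (@spec_mod (z + t%:C * w)) => //.
    by rewrite zE cnM w1 mulr1 cn_real gtr0_norm.
  by apply: he; rewrite opprD addrA subrr sub0r rnormN cnM w1 mulr1 cn_real.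
have zt : 0 < cn z + e / 2 by rewrite ltr_wpDl ?rnorm_ge0// divr_gt0.
have [|K2 hK2] := coef _ zt _.
  by apply: ray => //; rewrite gtr0_norm ?divr_gt0// ltr_pdivrMr// mulr2n mulrDr mulr1 ltrDl.
have [z0|z0] := eqVneq z 0.
  apply: (@laurent_holomorphic_at _ _ _ (cn z + e / 2) K2) => //.
    by rewrite ltrDl divr_gt0.
  left; split=> // n n0; apply: symbol_neg => // /shift_radius_maps.
  have /spP/andP[+ _] : spec coord (seq_translate 1) z.
    by apply: he; rewrite subrr rnorm0.
  rewrite z0 rnorm0; have := @shift_radius_ge0 R E coord (-1).
  case: (shift_radius coord (-1)) => [t| |]//; rewrite inver lee_fin => t0.
  case: eqP => [//|/eqP tn0]; rewrite lee_fin leNgt invr_gt0.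
  by rewrite lt_def tn0 t0.
have nz : 0 < cn z by rewrite rnorm_gt0.
pose t := Num.min (e / 2) (cn z / 2).
have t0 : 0 < t by rewrite lt_min !divr_gt0.
have te : t < e by rewrite gt_min ltr_pdivrMr// mulr2n mulrDr mulr1 ltrDl e0.
have tz : t < cn z by rewrite gt_min [X in _ || X]ltr_pdivrMr// mulr2n mulrDr mulr1 ltrDl nz orbT.
have zt1 : 0 < cn z - t by rewrite subr_gt0.
have [|K1 hK1] := coef _ zt1 _.
  by apply: ray => //; rewrite normrN gtr0_norm.
apply: (@laurent_holomorphic_at _ _ _ (cn z + e / 2) (Num.max K1 K2)).
- by rewrite ltrDl divr_gt0.
- by move=> n; rewrite le_max hK2 orbT.
right; exists (cn z - t); first by rewrite zt1 gtrBl.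
by move=> n; rewrite le_max exprnN hK1.
Qed.

End HolomorphicSymbols.

(** * Means over the circle *)

Section CircleMean.
Variable R : realType.
Local Notation cn z := (rnorm (z : R[i]^o)).
Local Notation mu := (@lebesgue_measure R).
Local Notation I := (`[0%R, (2 * pi)%R]%classic : set R).
Implicit Types (f g : R -> R[i]) (h : R -> R).

Lemma ae_imp (P Q : R -> Prop) : (forall t, P t -> Q t) ->
  {ae mu, forall t, P t} -> {ae mu, forall t, Q t}.
Proof. exact: (@filterS _ _ (ae_filter_ringOfSetsType mu)). Qed.

Lemma two_pi_gt0 : 0 < 2 * pi :> R.
Proof. by rewrite mulr_gt0// pi_gt0. Qed.

Lemma measurable_I : measurable I.
Proof. exact: measurable_itv. Qed.

Lemma mu_I : mu I = (2 * pi)%:E.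
Proof.
by rewrite lebesgue_measure_itv /= lte_fin two_pi_gt0 -EFinD subr0.
Qed.

Lemma bounded_integrable h K : measurable_fun I h -> (forall t, `|h t| <= K) ->
  mu.-integrable I (EFin \o h).
Proof.
move=> mh hK; apply: measurable_bounded_integrable => //.
- by rewrite /= mu_I ltry.
exists K; split; first exact: num_real.
by move=> x Kx t _ /=; apply: le_trans (hK t) _; exact: ltW.
Qed.

Definition rmean h : R := (2 * pi)^-1 * \int[mu]_(t in `[0%R, (2 * pi)%R]) h t.

Lemma rmean_cst (c : R) : rmean (fun=> c) = c.
Proof.
rewrite /rmean Rintegral_cst /= ?mu_I /=; last exact: measurable_I.
by rewrite mulrCA mulVf ?mulr1// gt_eqF// two_pi_gt0.
Qed.

Lemma rmean_le h1 h2 : mu.-integrable I (EFin \o h1) -> mu.-integrable I (EFin \o h2) ->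
  (forall t, h1 t <= h2 t) -> rmean h1 <= rmean h2.
Proof.
move=> i1 i2 h12; rewrite /rmean ler_wpM2l ?invr_ge0 ?(ltW two_pi_gt0)//.
by apply: le_Rintegral => //; exact: measurable_I.
Qed.

(** The sum of the [h i] has a finite integral, hence is finite almost
    everywhere. *)
Lemma ae_bounded (h : nat -> R -> R) (K q : R) : 0 <= q < 1 ->
  (forall i, measurable_fun I (h i)) -> (forall i, exists B, forall t, `|h i t| <= B) ->
  (forall i t, 0 <= h i t) -> (forall i, rmean (h i) <= K * q ^+ i) ->
  {ae mu, forall t, I t -> exists A, forall i, h i t <= A}.
Proof.
move=> q01 mh hB h0 hK.
have ih i : mu.-integrable I (EFin \o h i).
  by have [B hiB] := hB i; exact: bounded_integrable hiB.
pose G t := (\sum_(i <oo) (h i t)%:E)%E.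
have mhE i : measurable_fun I (EFin \o h i) by exact/measurable_EFinP.
have mG : measurable_fun I G.
  rewrite /G (_ : (fun t => _) = fun t => (\sum_(i <oo | i \in predT) (h i t)%:E)%E)//.
  apply: (@ge0_emeasurable_sum _ _ _ I (fun i t => (h i t)%:E) predT).
    by move=> i t _ _; rewrite lee_fin.
  by move=> i _; exact: mhE.
have Gint : (\int[mu]_(t in I) G t <= (2 * pi * (K / (1 - q)))%:E)%E.
  rewrite /G integral_nneseries//; last first.
    by move=> i t _; rewrite lee_fin.
  have eint i : (\int[mu]_(t in I) (h i t)%:E = (2 * pi * rmean (h i))%:E)%E.
    rewrite /rmean mulrA divff ?mul1r ?gt_eqF ?two_pi_gt0// /Rintegral fineK//.
    exact: integrable_fin_num (ih i).
  apply: lime_le.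
    apply: is_cvg_ereal_nneg_natsum => i _.
    by apply: integral_ge0 => t _; rewrite lee_fin.
  apply: nearW => n.
  under eq_bigr do rewrite eint.
  rewrite sumEFin lee_fin -mulr_sumr ler_wpM2l ?(ltW two_pi_gt0)//.
  apply: (@le_trans _ _ (\sum_(0 <= i < n) K * q ^+ i)); first exact: ler_sum.
  have K0 : 0 <= K.
    have := hK 0%N; rewrite expr0 mulr1; apply: le_trans.
    by rewrite /rmean mulr_ge0 ?invr_ge0 ?(ltW two_pi_gt0)// Rintegral_ge0.
  by rewrite -mulr_sumr ler_wpM2l// big_mkord; exact: geom_sum_le.
have iG : mu.-integrable I G.
  apply/integrableP; split=> //.
  under eq_integral => t _.
    rewrite gee0_abs; last by apply: nneseries_ge0 => i _ _; rewrite lee_fin.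
    over.
  by apply: le_lt_trans Gint _; rewrite ltry.
have := @integrable_ae _ (measurableTypeR R) R mu I (measurable_itv _) _ iG; apply: ae_imp => t Gt It.
exists (fine (G t)) => i; rewrite -lee_fin fineK; last exact: Gt.
rewrite /G (@nneseriesD1 _ _ i)//; last by move=> k _; rewrite lee_fin.
by rewrite leeDl// nneseries_ge0// => k _ _; rewrite lee_fin.
Qed.

(** Bounded measurable functions on the circle, parametrised by [t]. The bound
    holds at every [t], and not only on [I], so that dominated convergence and
    comparison need no restriction. *)
Definition bmeas f : Prop :=
  [/\ measurable_fun I (fun t => complex.Re (f t)),
      measurable_fun I (fun t => complex.Im (f t)) & exists K, forall t, cn (f t) <= K].

(** With the integrals written as in [fourier], so that Fourier coefficients
    are instances of [cmean] by definition. *)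
Definition cmean f : R[i] := (2 * pi)^-1%:C *
  ((\int[mu]_(t in `[0%R, (2 * pi)%R]) complex.Re (f t)) +i*
   (\int[mu]_(t in `[0%R, (2 * pi)%R]) complex.Im (f t))).

Lemma cmeanE f : cmean f = rmean (fun t => complex.Re (f t)) +i* rmean (fun t => complex.Im (f t)).
Proof.
rewrite /cmean /rmean; set a := Rintegral _ _ _; set b := Rintegral _ _ _.
by rewrite /real_complex_def; simpc.
Qed.

Lemma bmeas_intRe f : bmeas f -> mu.-integrable I (EFin \o (fun t => complex.Re (f t))).
Proof.
move=> [mr _ [K hK]]; apply: (bounded_integrable mr) => t.
by apply: le_trans (hK t); exact: Re_le_cn.
Qed.

Lemma bmeas_intIm f : bmeas f -> mu.-integrable I (EFin \o (fun t => complex.Im (f t))).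
Proof.
move=> [_ mi [K hK]]; apply: (bounded_integrable mi) => t.
by apply: le_trans (hK t); exact: Im_le_cn.
Qed.

Lemma bmeas_cst (c : R[i]) : bmeas (fun=> c).
Proof. by split; [exact: measurable_cst|exact: measurable_cst|exists (cn c)]. Qed.

Lemma bmeasD f g : bmeas f -> bmeas g -> bmeas (fun t => f t + g t).
Proof.
move=> [mr mi [K hK]] [mr' mi' [K' hK']]; split.
- rewrite (_ : (fun t => _) = (fun t => complex.Re (f t)) \+ (fun t => complex.Re (g t))).
    exact: measurable_funD.
  by apply: funext => t /=; case: (f t) (g t) => ? ? [].
- rewrite (_ : (fun t => _) = (fun t => complex.Im (f t)) \+ (fun t => complex.Im (g t))).
    exact: measurable_funD.
  by apply: funext => t /=; case: (f t) (g t) => ? ? [].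
by exists (K + K') => t; apply: le_trans (ler_rnormD _ _) _; exact: lerD.
Qed.

Lemma bmeasM f g : bmeas f -> bmeas g -> bmeas (fun t => f t * g t).
Proof.
move=> [mr mi [K hK]] [mr' mi' [K' hK']]; split.
- rewrite (_ : (fun t => _) = ((fun t => complex.Re (f t)) \* (fun t => complex.Re (g t))) \-
     ((fun t => complex.Im (f t)) \* (fun t => complex.Im (g t)))).
    by apply: measurable_funB; exact: measurable_funM.
  by apply: funext => t /=; case: (f t) (g t) => ? ? [].
- rewrite (_ : (fun t => _) = ((fun t => complex.Re (f t)) \* (fun t => complex.Im (g t))) \+
     ((fun t => complex.Im (f t)) \* (fun t => complex.Re (g t)))).
    by apply: measurable_funD; exact: measurable_funM.
  by apply: funext => t /=; case: (f t) (g t) => ? ? [].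
by exists (K * K') => t; rewrite cnM; apply: ler_pM; rewrite ?rnorm_ge0.
Qed.

Lemma bmeas_conj f : bmeas f -> bmeas (fun t => conjc (f t)).
Proof.
move=> [mr mi [K hK]]; split.
- rewrite (_ : (fun t => _) = (fun t => complex.Re (f t)))//.
  by apply: funext => t; case: (f t).
- rewrite (_ : (fun t => _) = \- (fun t => complex.Im (f t))).
    exact: measurable_funN.
  by apply: funext => t /=; case: (f t).
by exists K => t; rewrite cnC.
Qed.

Lemma bmeasX f n : bmeas f -> bmeas (fun t => f t ^+ n).
Proof.
move=> bf; elim: n => [|n IH]; first exact: bmeas_cst.
by under eq_fun do rewrite exprS; exact: bmeasM.
Qed.

Lemma bmeas_sum J (r : seq J) (f : J -> R -> R[i]) : (forall j, bmeas (f j)) ->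
  bmeas (fun t => \sum_(j <- r) f j t).
Proof.
move=> bf; elim: r => [|j r IH].
  by under eq_fun do rewrite big_nil; exact: bmeas_cst.
by under eq_fun do rewrite big_cons; exact: bmeasD.
Qed.

Lemma bmeas_sqr f : bmeas f -> measurable_fun I (fun t => cn (f t) ^+ 2).
Proof.
move=> bf; have [mr _ _] := bmeasM bf (bmeas_conj bf).
rewrite (_ : (fun t => _) = (fun t => complex.Re (f t * conjc (f t))))//.
by apply: funext => t; rewrite sqr_cn.
Qed.

Lemma cmeanD f g : bmeas f -> bmeas g -> cmean (fun t => f t + g t) = cmean f + cmean g.
Proof.
move=> bf bg; rewrite !cmeanE /rmean.
have -> : (fun t => complex.Re (f t + g t)) = (fun t => complex.Re (f t) + complex.Re (g t)).
  by apply: funext => t /=; case: (f t) (g t) => ? ? [].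
have -> : (fun t => complex.Im (f t + g t)) = (fun t => complex.Im (f t) + complex.Im (g t)).
  by apply: funext => t /=; case: (f t) (g t) => ? ? [].
rewrite RintegralD; [|exact: measurable_I|exact: bmeas_intRe|exact: bmeas_intRe].
rewrite RintegralD; [|exact: measurable_I|exact: bmeas_intIm|exact: bmeas_intIm].
by rewrite !mulrDr.
Qed.

Lemma cmeanZ (c : R[i]) f : bmeas f -> cmean (fun t => c * f t) = c * cmean f.
Proof.
move=> bf; have iR := bmeas_intRe bf; have iI := bmeas_intIm bf.
have iZ (x : R) h : mu.-integrable I (EFin \o h) -> mu.-integrable I (EFin \o (fun t => x * h t)).
  by move=> ih; exact: (@integrableZl _ (measurableTypeR R) R mu I (measurable_itv _) x _ ih).
rewrite !cmeanE /rmean; case: c => x y.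
have -> : (fun t => complex.Re ((x +i* y) * f t)) = (fun t => x * complex.Re (f t) - y * complex.Im (f t)).
  by apply: funext => t /=; case: (f t).
have -> : (fun t => complex.Im ((x +i* y) * f t)) = (fun t => x * complex.Im (f t) + y * complex.Re (f t)).
  by apply: funext => t /=; case: (f t).
rewrite RintegralB ?RintegralD ?RintegralZl//; do ?[exact: measurable_I|exact: iZ].
by simpc; congr (_ +i* _); ring.
Qed.

Lemma cmean_cst (c : R[i]) : cmean (fun=> c) = c.
Proof. by rewrite cmeanE !rmean_cst; case: c. Qed.

Lemma cmean_sum J (r : seq J) (f : J -> R -> R[i]) : (forall j, bmeas (f j)) ->
  cmean (fun t => \sum_(j <- r) f j t) = \sum_(j <- r) cmean (f j).
Proof.
move=> bf; elim: r => [|j r IH].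
  by under eq_fun do rewrite big_nil; rewrite cmean_cst big_nil.
under eq_fun do rewrite big_cons; rewrite cmeanD ?IH ?big_cons//.
exact: bmeas_sum.
Qed.

Lemma cmean_real h : cmean (fun t => (h t)%:C) = (rmean h)%:C.
Proof. by rewrite cmeanE /= rmean_cst. Qed.

Lemma rmean_cvg (h_ : nat -> R -> R) h (K : R) :
  (forall n, measurable_fun I (h_ n)) -> measurable_fun I h ->
  (forall n t, `|h_ n t| <= K) ->
  {ae mu, forall t, I t -> (fun n => h_ n t) @ \oo --> h t} ->
  (fun n => rmean (h_ n)) @ \oo --> rmean h.
Proof.
move=> mh_ mh hK hae.
have iK : mu.-integrable I (EFin \o (fun=> K)).
  apply: (@bounded_integrable _ `|K|) => //; exact: measurable_cst.
have mhE_ n : measurable_fun I (EFin \o h_ n) by apply/measurable_EFinP; exact: mh_.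
have mhE : measurable_fun I (EFin \o h) by apply/measurable_EFinP.
have [||ih _ hcvg] := @dominated_convergence _ (measurableTypeR R) R mu I
  (measurable_itv _) (fun n => EFin \o h_ n) (EFin \o h) (EFin \o (fun=> K)) mhE_ mhE _ iK.
- by apply: ae_imp hae => t ht It; apply: cvg_EFin; [exact: nearW|exact: ht].
- by apply: aeW => t It n; rewrite /= lee_fin.
rewrite /rmean; apply: cvgMr; apply: fine_cvg.
by rewrite /Rintegral fineK; [exact: hcvg|exact: integrable_fin_num].
Qed.

(** Dominated convergence, for the real and the imaginary parts. *)
Lemma cmean_cvg (f_ : nat -> R -> R[i]) f (K : R) :
  (forall n, bmeas (f_ n)) -> bmeas f -> (forall n t, cn (f_ n t) <= K) ->
  {ae mu, forall t, I t -> (fun n => f_ n t : R[i]^o) @ \oo --> (f t : R[i]^o)} ->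
  (fun n => cmean (f_ n) : R[i]^o) @ \oo --> (cmean f : R[i]^o).
Proof.
move=> bf_ [mr mi _] hK hae.
have part (p : R[i] -> R) : (forall z w, p (z - w) = p z - p w) ->
    (forall z, `|p z| <= cn z) -> (forall n, measurable_fun I (fun t => p (f_ n t))) ->
    measurable_fun I (fun t => p (f t)) ->
    (fun n => rmean (fun t => p (f_ n t))) @ \oo --> rmean (fun t => p (f t)).
  move=> pB ple mp_ mp; apply: (@rmean_cvg _ _ K) => //.
    by move=> n t; apply: le_trans (ple _) (hK n t).
  apply: ae_imp hae => t ht It; apply/cvgrPdistC_lt => e e0.
  have /cvg_rnormP/(_ _ e0)[N hN] := ht It; exists N => // n Nn /=.
  by rewrite -pB; apply: le_lt_trans (ple _) _; exact: hN.
have cr := part (@complex.Re R) _ (@Re_le_cn R) _ mr.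
have ci := part (@complex.Im R) _ (@Im_le_cn R) _ mi.
have {}cr : (fun n => rmean (fun t => complex.Re (f_ n t))) @ \oo --> rmean (fun t => complex.Re (f t)).
  by apply: cr => [[? ?] [? ?]//|n]; case: (bf_ n).
have {}ci : (fun n => rmean (fun t => complex.Im (f_ n t))) @ \oo --> rmean (fun t => complex.Im (f t)).
  by apply: ci => [[? ?] [? ?]//|n]; case: (bf_ n).
apply/cvg_rnormP => e e0; have e2 : 0 < e / 2 by rewrite divr_gt0.
move/cvgrPdistC_lt : cr => /(_ _ e2)[N1 _ h1].
move/cvgrPdistC_lt : ci => /(_ _ e2)[N2 _ h2].
exists (maxn N1 N2) => n; rewrite geq_max => /andP[n1 n2].
apply: le_lt_trans (cn_le_ReIm _) _; rewrite !cmeanE.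
have := h1 n n1; have := h2 n n2; rewrite /= => hi hr; simpc => /=.
lra.
Qed.

Lemma cn_cis t : cn (cis t : R[i]) = 1.
Proof.
by apply: complexI; rewrite -cnE normc_def /cis /= cos2Dsin2 sqrtr1.
Qed.

Lemma cisX t n : cis t ^+ n = cis (n%:R * t) :> R[i].
Proof.
elim: n => [|n IH]; first by rewrite mul0r /cis cos0 sin0.
rewrite exprS IH /cis; simpc; rewrite -natr1 mulrDl mul1r addrC cosD sinD.
by congr (_ +i* _); ring.
Qed.

Lemma conj_cis t : conjc (cis t : R[i]) = (cis t)^-1.
Proof. exact/unit_conj/cn_cis. Qed.

Lemma bmeas_cis : bmeas (fun t => cis t).
Proof.
split.
- by apply: measurable_funTS; apply: continuous_measurable_fun; exact: continuous_cos.
- by apply: measurable_funTS; apply: continuous_measurable_fun; exact: continuous_sin.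
by exists 1 => t; rewrite cn_cis.
Qed.

Lemma bmeas_cisXz (k : int) : bmeas (fun t => cis t ^ k).
Proof.
case: k => n; first by under eq_fun do rewrite -exprnP; exact: bmeasX bmeas_cis.
under eq_fun do rewrite NegzE -exprnN -exprVn -conj_cis.
by apply: bmeasX; apply: bmeas_conj; exact: bmeas_cis.
Qed.

Lemma rmean_FTC (f F : R -> R) : continuous f -> (forall t : R, is_derive t 1 F (f t)) ->
  rmean f = (2 * pi)^-1 * (F (2 * pi) - F 0).
Proof.
move=> fc Fd; have Fc : continuous F.
  by move=> t; apply/differentiable_continuous/derivable1_diffP; exact: ex_derive.
rewrite /rmean /Rintegral (@continuous_FTC2 _ f F 0 (2 * pi))//.
- exact: two_pi_gt0.
- exact: continuous_subspaceT.
- split=> [t _||].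
  + exact: ex_derive.
  + exact/cvg_at_right_filter/Fc.
  + exact/cvg_at_left_filter/Fc.
by move=> t _; rewrite derive1E; exact: derive_val.
Qed.

Lemma is_derive_scale (a t : R) (F : R -> R) (d : R) : is_derive t 1 F d ->
  is_derive t 1 (fun t => a * F t) (a * d).
Proof.
move=> dF; rewrite (_ : (fun t => a * F t) = cst a * F); last by apply: funext.
by apply: is_derive_eq; rewrite scaler0 addr0.
Qed.

Lemma is_derive_comp_scale (a t : R) (F : R -> R) (d : R) : is_derive (a * t) 1 F d ->
  is_derive t 1 (fun t => F (a * t)) (a * d).
Proof.
move=> dF; have dl : is_derive t 1 (fun t : R => a * t) a.
  by rewrite -[X in is_derive _ _ _ X]mulr1; apply: is_derive_scale.
rewrite mulrC; exact: (is_derive1_comp (f := F) (g := fun t : R => a * t)).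
Qed.

Lemma cos_nat_2pi n : cos (n%:R * (2 * pi)) = 1 :> R.
Proof.
have -> : n%:R * (2 * pi) = 0 + (pi *+ 2) *+ n :> R.
  by rewrite add0r -[RHS]mulr_natl [2 * pi]mulr_natl.
by rewrite (periodicn (@cosD2pi R)) cos0.
Qed.

Lemma sin_nat_2pi n : sin (n%:R * (2 * pi)) = 0 :> R.
Proof.
have -> : n%:R * (2 * pi) = 0 + (pi *+ 2) *+ n :> R.
  by rewrite add0r -[RHS]mulr_natl [2 * pi]mulr_natl.
by rewrite (periodicn (@sinD2pi R)) sin0.
Qed.

Lemma rmean_cos n : rmean (fun t => cos (n.+1%:R * t)) = 0.
Proof.
have n0 : n.+1%:R != 0 :> R by rewrite pnatr_eq0.
have cf : continuous (fun t : R => cos (n.+1%:R * t)).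
  by move=> t; apply: continuous_comp; [exact: mulrl_continuous|exact: continuous_cos].
have dF (t : R) : is_derive t 1 (fun t => n.+1%:R^-1 * sin (n.+1%:R * t)) (cos (n.+1%:R * t)).
  rewrite -[cos _](mulKf n0); apply: is_derive_scale.
  exact: is_derive_comp_scale.
by rewrite (rmean_FTC cf dF) sin_nat_2pi !mulr0 sin0 mulr0 subrr mulr0.
Qed.

Lemma rmean_sin n : rmean (fun t => sin (n.+1%:R * t)) = 0.
Proof.
have n0 : n.+1%:R != 0 :> R by rewrite pnatr_eq0.
have cf : continuous (fun t : R => sin (n.+1%:R * t)).
  by move=> t; apply: continuous_comp; [exact: mulrl_continuous|exact: continuous_sin].
have dF (t : R) : is_derive t 1 (fun t => - n.+1%:R^-1 * cos (n.+1%:R * t)) (sin (n.+1%:R * t)).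
  rewrite -[X in is_derive _ _ _ X]opprK -[X in is_derive _ _ _ (- X)](mulKf n0) -mulNr.
  apply: is_derive_scale; exact: is_derive_comp_scale.
by rewrite (rmean_FTC cf dF) cos_nat_2pi !mulr0 cos0 subrr mulr0.
Qed.

Lemma cmean_cisX n : cmean (fun t => cis t ^+ n.+1) = 0.
Proof.
under eq_fun do rewrite cisX.
by rewrite cmeanE /= rmean_cos rmean_sin.
Qed.

Lemma cmean_conj f : bmeas f -> cmean (fun t => conjc (f t)) = conjc (cmean f).
Proof.
move=> bf; rewrite !cmeanE /rmean.
have -> : (fun t => complex.Re (conjc (f t))) = (fun t => complex.Re (f t)).
  by apply: funext => t; case: (f t).
have -> : (fun t => complex.Im (conjc (f t))) = (fun t => (-1) * complex.Im (f t)).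
  by apply: funext => t; case: (f t) => a b /=; rewrite mulN1r.
rewrite RintegralZl; [|exact: measurable_itv|exact: bmeas_intIm].
by rewrite mulN1r mulrN.
Qed.

(** The orthogonality of the characters of the circle. *)
Lemma cmean_cisXz (k : int) : cmean (fun t => cis t ^ k) = (k == 0)%:R.
Proof.
case: k => [[|n]|n].
- by under eq_fun do rewrite expr0z; rewrite cmean_cst.
- by under eq_fun do rewrite -exprnP; rewrite cmean_cisX.
under eq_fun do rewrite NegzE -exprnN -exprVn -conj_cis -rmorphXn.
by rewrite (cmean_conj (bmeasX _ bmeas_cis)) cmean_cisX conjc0.
Qed.

End CircleMean.

(** * Functions with Toeplitz-bounded Fourier coefficients *)

Section SymbolFunction.
Variable R : realType.
Local Notation cn z := (rnorm (z : R[i]^o)).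
Local Notation mu := (@lebesgue_measure R).
Local Notation I := (`[0%R, (2 * pi)%R]%classic : set R).

Lemma rmeanZ (a : R) (h : R -> R) : mu.-integrable I (EFin \o h) ->
  rmean (fun t => a * h t) = a * rmean h.
Proof.
move=> ih; rewrite /rmean RintegralZl; [|exact: measurable_itv|exact: ih].
by rewrite mulrCA.
Qed.

Lemma rmean_ge0 (h : R -> R) : (forall t, 0 <= h t) -> 0 <= rmean h.
Proof.
by move=> h0; rewrite /rmean mulr_ge0 ?invr_ge0 ?(ltW (two_pi_gt0 R))// Rintegral_ge0.
Qed.

Lemma bmeas_sqr_int (f : R -> R[i]) : bmeas f ->
  mu.-integrable I (EFin \o (fun t => cn (f t) ^+ 2)).
Proof.
move=> bf; have [_ _ [K hK]] := bf.
apply: (@bounded_integrable _ _ (K ^+ 2)); first exact: bmeas_sqr.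
move=> t; rewrite ger0_norm ?sqr_ge0// lerXn2r ?nnegrE ?rnorm_ge0//.
by apply: le_trans (hK t); exact: rnorm_ge0.
Qed.

Lemma rmean_sqr (f : R -> R[i]) : (rmean (fun t => cn (f t) ^+ 2))%:C =
  cmean (fun t => f t * conjc (f t)).
Proof. by rewrite -cmean_real; congr cmean; apply: funext => t; rewrite sqr_cn. Qed.

Lemma cis_neq0 (t : R) : cis t != 0 :> R[i].
Proof. exact/unit_neq0/cn_cis. Qed.

(** As the exponents start at [- N], every trigonometric polynomial has this
    form. *)
Lemma parseval_circle K (N : nat) (d : nat -> R[i]) :
  rmean (fun t => cn (\sum_(l < K) d l * cis t ^ (l%:Z - N%:Z)) ^+ 2) =
  \sum_(l < K) cn (d l) ^+ 2.
Proof.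
apply: complexI; rewrite rmean_sqr [RHS]rmorph_sum /=.
have -> : (fun t => (\sum_(l < K) d l * cis t ^ (l%:Z - N%:Z)) *
      conjc (\sum_(l < K) d l * cis t ^ (l%:Z - N%:Z))) =
    (fun t : R => \sum_(l < K) \sum_(m < K) (d l * conjc (d m)) * cis t ^ (l%:Z - m%:Z)).
  apply: funext => t; rewrite conj_sum mulr_suml; apply: eq_bigr => l _.
  rewrite mulr_sumr; apply: eq_bigr => m _.
  rewrite conjM conjcXz conj_cis mulrACA exprz_inv -expfzDr ?cis_neq0//.
  by congr (_ * _ ^ _); lia.
have bt (l m : 'I_K) : bmeas (fun t : R => (d l * conjc (d m)) * cis t ^ (l%:Z - m%:Z)).
  by apply: bmeasM; [exact: bmeas_cst|exact: bmeas_cisXz].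
rewrite cmean_sum; last by move=> l; apply: bmeas_sum => m; exact: bt.
apply: eq_bigr => l _; rewrite cmean_sum; last by move=> m; exact: bt.
rewrite (bigD1 l)//= cmeanZ ?cmean_cisXz; last exact: bmeas_cisXz.
rewrite subrr eqxx mulr1 big1 ?addr0 ?sqr_cn// => m ml.
rewrite cmeanZ ?cmean_cisXz; last exact: bmeas_cisXz.
by rewrite subr_eq0 eqz_nat eq_sym -[(_ == _)%N]/(m == l) (negbTE ml) mulr0.
Qed.

Lemma limn_sup_bound (u : nat -> R) (B : R) : (forall n, `|u n| <= B) -> `|limn_sup u| <= B.
Proof.
move=> uB.
have ub : has_ubound (range u) by exists B => _ [n _ <-]; exact: le_trans (ler_norm _) (uB n).
have lb : has_lbound (range u).
  by exists (- B) => _ [n _ <-]; have := uB n; rewrite ler_norml => /andP[].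
have cs : cvgn (sups u) by apply/cvg_ex; eexists; exact: cvg_sups_inf.
rewrite ler_norml; apply/andP; split.
  apply: limr_ge => //; apply: nearW => n.
  apply: (@le_trans _ _ (u n)); first by have := uB n; rewrite ler_norml => /andP[].
  by apply: ub_le_sup; [exact: has_ubound_sdrop|exists n => //=].
apply: limr_le => //; apply: nearW => n; apply: ge_sup.
  by exists (u n), n => //=.
by move=> _ [m _ <-]; exact: le_trans (ler_norm _) (uB m).
Qed.

Section Fejer.
Variables (c : int -> R[i]) (B : R).
Hypothesis cB : toeplitz_bounded c B.

(** The Fejér means of the Fourier series with coefficients [c], as double
    sums over a square. *)
Definition fejer_poly k (w : R[i]) : R[i] :=
  k.+1%:R^-1 * \sum_(a < k.+1) \sum_(b < k.+1) c (a%:Z - b%:Z) * w ^ (a%:Z - b%:Z).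

(** The Toeplitz inequality for the vectors of powers of [w]. *)
Lemma fejer_poly_le k w : cn w = 1 -> cn (fejer_poly k w) <= B.
Proof.
move=> w1; have := cB k.+1 (fun i => w ^+ i) (fun j => w ^+ j).
rewrite (_ : _ / 2 = k.+1%:R); last first.
  under eq_bigr do rewrite cnX w1 expr1n expr1n.
  by rewrite !sumr_const card_ord; field.
move=> h; rewrite /fejer_poly cnM cnV cn_natr mulrC ler_pdivrMr ?ltr0n//.
move: h; congr (cn _ <= _).
apply: eq_bigr => a _; apply: eq_bigr => b _.
rewrite mulrC; congr (_ * _).
by rewrite !exprnP conjcXz (unit_conj w1) exprz_inv -expfzDr ?unit_neq0.
Qed.

Lemma bmeas_fejer_poly k : bmeas (fun t => fejer_poly k (cis t)).
Proof.
apply: bmeasM; first exact: bmeas_cst.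
apply: bmeas_sum => a; apply: bmeas_sum => b.
by apply: bmeasM; [exact: bmeas_cst|exact: bmeas_cisXz].
Qed.

Lemma fejer_poly_mean k f : bmeas f ->
  cmean (fun t => fejer_poly k (cis t) * f t) =
  k.+1%:R^-1 * \sum_(a < k.+1) \sum_(b < k.+1)
    c (a%:Z - b%:Z) * cmean (fun t => cis t ^ (a%:Z - b%:Z) * f t).
Proof.
move=> bf.
have bt (a b : 'I_k.+1) : bmeas (fun t : R => cis t ^ (a%:Z - b%:Z) * f t).
  by apply: bmeasM => //; exact: bmeas_cisXz.
have bct (a b : 'I_k.+1) : bmeas (fun t : R => c (a%:Z - b%:Z) * (cis t ^ (a%:Z - b%:Z) * f t)).
  by apply: bmeasM => //; exact: bmeas_cst.
have -> : (fun t => fejer_poly k (cis t) * f t) = (fun t => k.+1%:R^-1 *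
    \sum_(a < k.+1) \sum_(b < k.+1) c (a%:Z - b%:Z) * (cis t ^ (a%:Z - b%:Z) * f t)).
  apply: funext => t; rewrite /fejer_poly -mulrA; congr (_ * _).
  rewrite mulr_suml; apply: eq_bigr => a _; rewrite mulr_suml; apply: eq_bigr => b _.
  by rewrite mulrA.
rewrite cmeanZ; last by apply: bmeas_sum => a; apply: bmeas_sum => b; exact: bct.
congr (_ * _); rewrite cmean_sum; last by move=> a; apply: bmeas_sum => b; exact: bct.
apply: eq_bigr => a _; rewrite cmean_sum; last by move=> b; exact: bct.
by apply: eq_bigr => b _; rewrite cmeanZ.
Qed.

(** Fejér's weight of the frequency [n]. *)
Let kappa (k : nat) (n : int) : R := (k.+1 - `|n|)%N%:R / k.+1%:R.

Lemma fejer_poly_coef k N w : (k < N)%N ->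
  fejer_poly k w = \sum_(l < (2 * N).+1)
    ((kappa k (l%:Z - N%:Z))%:C * c (l%:Z - N%:Z)) * w ^ (l%:Z - N%:Z).
Proof.
move=> kN; rewrite /fejer_poly (fejer_sum (fun n => c n * w ^ n) kN) mulr_sumr.
apply: eq_bigr => l _; rewrite /kappa rmorphM /= fmorphV !rmorph_nat.
by rewrite -[_ *+ _]mulr_natl; ring.
Qed.

Lemma kappa_mono k l n : (l <= k)%N -> 0 <= kappa l n <= kappa k n.
Proof.
move=> lk; rewrite /kappa divr_ge0//= ler_pdivrMr ?ltr0n// mulrAC ler_pdivlMr ?ltr0n//.
rewrite -!natrM ler_nat.
have [ln|ln] := leqP l.+1 `|n|; first by move: ln; rewrite -subn_eq0 => /eqP ->; rewrite mul0n.
by nia.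
Qed.

Let J k := rmean (fun t => cn (fejer_poly k (cis t)) ^+ 2).

Let B0 : 0 <= B.
Proof. by apply: le_trans (toeplitz_coef 0 cB); exact: rnorm_ge0. Qed.

Lemma energy_le k : J k <= B ^+ 2.
Proof.
rewrite -(rmean_cst (B ^+ 2)); apply: rmean_le.
- exact: bmeas_sqr_int (bmeas_fejer_poly k).
- by apply: (@bounded_integrable _ _ `|B ^+ 2|) => //; exact: measurable_cst.
by move=> t; rewrite lerXn2r ?nnegrE ?rnorm_ge0//; apply: fejer_poly_le; rewrite cn_cis.
Qed.

(** By Parseval's formula: the weights increase with the index, and
    [(x - y)^2 <= x^2 - y^2] when [0 <= y <= x]. *)
Lemma energy_diff k l : (l <= k)%N ->
  rmean (fun t => cn (fejer_poly k (cis t) - fejer_poly l (cis t)) ^+ 2) <= J k - J l.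
Proof.
move=> lk; rewrite /J; pose f i : int := i%:Z - k.+1%:Z.
have E m : (m <= k)%N -> (fun t : R => cn (fejer_poly m (cis t)) ^+ 2) =
    (fun t => cn (\sum_(i < (2 * k.+1).+1)
      ((kappa m (f i))%:C * c (f i)) * cis t ^ (f i)) ^+ 2).
  by move=> mk; apply: funext => t; rewrite (@fejer_poly_coef m k.+1).
rewrite (E k (leqnn k)) (E l lk).
have -> : (fun t : R => cn (fejer_poly k (cis t) - fejer_poly l (cis t)) ^+ 2) =
    (fun t => cn (\sum_(i < (2 * k.+1).+1)
      ((kappa k (f i) - kappa l (f i))%:C * c (f i)) * cis t ^ (f i)) ^+ 2).
  apply: funext => t; rewrite (@fejer_poly_coef k k.+1)// (@fejer_poly_coef l k.+1)//.
  by rewrite -sumrB; congr (cn _ ^+ 2); apply: eq_bigr => i _; rewrite rmorphB /= !mulrBl.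
rewrite (parseval_circle _ _ (fun i => (kappa k (f i) - kappa l (f i))%:C * c (f i))).
rewrite (parseval_circle _ _ (fun i => (kappa k (f i))%:C * c (f i))).
rewrite (parseval_circle _ _ (fun i => (kappa l (f i))%:C * c (f i))).
rewrite -sumrB; apply: ler_sum => i _.
rewrite !cnM !cn_real !exprMn !real_normK ?num_real// -mulrBl ler_wpM2r ?sqr_ge0//.
have /andP[] := kappa_mono (f i) lk.
move: (kappa k _) (kappa l _) => x y; nra.
Qed.

Lemma energy_mono k l : (l <= k)%N -> J l <= J k.
Proof.
move=> lk; rewrite -subr_ge0; apply: le_trans (energy_diff lk).
by apply: rmean_ge0 => t; exact: sqr_ge0.
Qed.

Lemma energy_cauchy (e : R) : 0 < e -> exists N, forall k, (N <= k)%N -> J k - J N < e.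
Proof.
move=> e0; have hs : has_sup (range J).
  split; first by exists (J 0), 0%N.
  by exists (B ^+ 2) => _ [k _ <-]; exact: energy_le.
have [_ [N _ <-] hN] := sup_adherent e0 hs.
exists N => k Nk; have : J k <= sup (range J) by apply: ub_le_sup; [exact: hs.2|exists k].
by lra.
Qed.

(** The energies [J k] increase and are bounded, so that the Fejér means form
    a Cauchy sequence in mean square, and a rapidly converging subsequence
    converges almost everywhere. The upper limits of the real and imaginary
    parts make [nu] measurable, and bounded at every point. *)
Lemma ex_symbol_function : exists (nu : R[i] -> R[i]) (k : nat -> nat),
  [/\ bmeas (fun t => nu (cis t)), forall i, (i <= k i)%N &
   {ae mu, forall t, I t ->
     (fun i => fejer_poly (k i) (cis t) : R[i]^o) @ \oo --> (nu (cis t) : R[i]^o)}].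
Proof.
(* The rate [8^-i] beats the weight [4^i] of the squares below, which in turn
   makes the differences [O(2^-i)]. *)
have /choice[N hN] : forall i : nat, exists N, forall k, (N <= k)%N -> J k - J N < (8%:R : R) ^- i.
  by move=> i; apply: energy_cauchy; rewrite invr_gt0 exprn_gt0// ltr0n.
pose k i := (\sum_(j < i.+1) (N j).+1)%N.
have kS i : k i.+1 = (k i + (N i.+1).+1)%N by rewrite /k big_ord_recr.
have Nk i : (N i <= k i)%N by rewrite /k big_ord_recr /=; lia.
have ik i : (i <= k i)%N.
  by elim: i => // i IH; rewrite kS; lia.
pose Df i t : R[i] := fejer_poly (k i.+1) (cis t) - fejer_poly (k i) (cis t).
have bD i : bmeas (Df i).
  rewrite (_ : Df i = fun t => fejer_poly (k i.+1) (cis t) + (-1) * fejer_poly (k i) (cis t)).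
    apply: bmeasD; first exact: bmeas_fejer_poly.
    by apply: bmeasM; [exact: bmeas_cst|exact: bmeas_fejer_poly].
  by apply: funext => t; rewrite mulN1r.
have DK i : rmean (fun t => 4 ^+ i * cn (Df i t) ^+ 2) <= 1 * 2^-1 ^+ i.
  rewrite rmeanZ; last exact: bmeas_sqr_int.
  have h : rmean (fun t => cn (Df i t) ^+ 2) <= 8 ^- i.
    apply: le_trans (energy_diff _) _; first by rewrite kS; lia.
    have h1 := hN i (k i.+1) _; have h2 := energy_mono (Nk i).
    have := h1 _; rewrite kS => h3.
    have : (N i <= k i + (N i.+1).+1)%N by have := Nk i; lia.
    by move=> /h3; lra.
  have e4 : 0 <= 4 ^+ i :> R by rewrite exprn_ge0.
  apply: le_trans (ler_wpM2l e4 h) _; rewrite mul1r -!exprVn -exprMn.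
  by rewrite le_eqVlt; apply/orP; left; apply/eqP; congr (_ ^+ _); lra.
have fB (i : nat) (t : R) : cn (fejer_poly (k i) (cis t)) <= B.
  by apply: fejer_poly_le; rewrite cn_cis.
have DB i : exists C', forall t, `|4 ^+ i * cn (Df i t) ^+ 2| <= C'.
  exists (4 ^+ i * (B + B) ^+ 2) => t.
  rewrite ger0_norm ?mulr_ge0 ?exprn_ge0 ?sqr_ge0 ?rnorm_ge0//.
  rewrite ler_wpM2l ?exprn_ge0// lerXn2r ?nnegrE ?rnorm_ge0 ?addr_ge0//.
  by apply: le_trans (ler_rnormB _ _) _; apply: lerD.
have q01 : 0 <= (2^-1 : R) < 1 by rewrite invr_ge0 ler0n /= invf_lt1// ltr1n.
have := ae_bounded q01 _ DB _ DK.
move=> aeA.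
pose nu (z : R[i]) : R[i] := limn_sup (fun i => complex.Re (fejer_poly (k i) z)) +i*
   limn_sup (fun i => complex.Im (fejer_poly (k i) z)).
have ReB t i : `|complex.Re (fejer_poly (k i) (cis t))| <= B.
  exact: le_trans (Re_le_cn _) (fB i t).
have ImB t i : `|complex.Im (fejer_poly (k i) (cis t))| <= B.
  exact: le_trans (Im_le_cn _) (fB i t).
exists nu, k; split=> //.
  split.
  - apply: (measurable_fun_limn_sup (h := fun i t => complex.Re (fejer_poly (k i) (cis t)))).
    + by move=> t _; exists B => _ [i _ <-]; exact: le_trans (ler_norm _) (ReB t i).
    + by move=> t _; exists (- B) => _ [i _ <-]; have := ReB t i; rewrite ler_norml => /andP[].
    + by move=> i; case: (bmeas_fejer_poly (k i)).
  - apply: (measurable_fun_limn_sup (h := fun i t => complex.Im (fejer_poly (k i) (cis t)))).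
    + by move=> t _; exists B => _ [i _ <-]; exact: le_trans (ler_norm _) (ImB t i).
    + by move=> t _; exists (- B) => _ [i _ <-]; have := ImB t i; rewrite ler_norml => /andP[].
    + by move=> i; case: (bmeas_fejer_poly (k i)).
  exists (B + B) => t; apply: le_trans (cn_le_ReIm _) _ => /=.
  by apply: lerD; apply: limn_sup_bound => i; [exact: ReB|exact: ImB].
apply: ae_imp (aeA _ _).
- move=> t h It; have [A hA] := h It.
  have Dle i : cn (Df i t : R[i]^o) <= (`|A| + 1) * 2^-1 ^+ i.
    have A1 : 0 <= `|A| + 1 by rewrite addr_ge0.
    rewrite exprVn ler_pdivlMr ?exprn_gt0// -(@ler_pXn2r _ 2)// ?nnegrE ?mulr_ge0 ?rnorm_ge0 ?exprn_ge0//.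
    rewrite exprMn -exprM mulnC exprM mulrC.
    have := hA i; rewrite (_ : 2 ^+ 2 = 4 :> R); last by rewrite -natrX.
    move=> h1; apply: le_trans h1 _; have := ler_norm A; have := normr_ge0 A; nra.
  have [l hl] := series_geom_cvg q01 Dle.
  have hf : (fun i => fejer_poly (k i) (cis t) : R[i]^o) @ \oo -->
      (l + fejer_poly (k 0) (cis t) : R[i]^o).
    rewrite (_ : (fun i => _) = fun i => series (fun i => Df i t : R[i]^o) i + fejer_poly (k 0) (cis t)).
      by apply: cvgD; [exact: hl|exact: cvg_cst].
    apply: funext => i; rewrite /series /= telescope_sumr// subrK//.
  have part (p : R[i] -> R) : (forall z w, p (z - w) = p z - p w) -> (forall z, `|p z| <= cn z) ->
      limn_sup (fun i => p (fejer_poly (k i) (cis t))) = p (l + fejer_poly (k 0) (cis t)).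
    move=> pB ple; apply: (cvg_limn_inf_sup _).2; apply/cvgrPdistC_lt => e e0.
    have /cvg_rnormP/(_ _ e0)[n hn] := hf; exists n => // m nm /=.
    by rewrite -pB; apply: le_lt_trans (ple _) _; exact: hn.
  rewrite (_ : nu (cis t) = l + fejer_poly (k 0) (cis t))//.
  rewrite /nu (part (@complex.Re R)) ?(part (@complex.Im R)).
  + by case: (l + _).
  + by move=> [? ?] [? ?].
  + exact: Im_le_cn.
  + by move=> [? ?] [? ?].
  + exact: Re_le_cn.
- move=> i; apply: measurable_funM; [exact: measurable_cst|exact: bmeas_sqr].
- by move=> i t; apply: mulr_ge0; [exact: exprn_ge0|exact: sqr_ge0].
Qed.

End Fejer.

End SymbolFunction.

(** * Powers of a multiplier and of its symbol *)

Section SymbolPowers.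
Variables (R : realType) (E : completeNormedModType R[i]).
Variable coord : {linear E -> (int -> R[i]^o)}.
Context {HE : HomSpace coord}.
Local Notation F x := (finsupp (coord x)).
Local Notation U := (translate coord).
Local Notation ee := (basis coord).
Local Notation cn z := (rnorm (z : R[i]^o)).
Local Notation mu := (@lebesgue_measure R).
Local Notation I := (`[0%R, (2 * pi)%R]%classic : set R).
Hypothesis shift_bounded : maps_into coord (seq_translate 1) \/ maps_into coord (seq_translate (-1)).

Lemma closure_of_maps t x y : maps_into coord (seq_translate t) -> coord y = seq_translate t (coord x) ->
  min_closure coord (seq_translate t) (x, y).
Proof.
move=> tE yx; rewrite -realizationE /realization asboolT//.
by rewrite /graph_of /=; apply: coordP => n; rewrite coord_restr// yx.
Qed.

Lemma linear_cvg (M : {linear E -> E}) (u : nat -> E) v : continuous M ->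
  u @ \oo --> v -> (fun k => M (u k)) @ \oo --> M v.
Proof. by move=> cM uv; apply: (cvg_comp _ _ uv (cM v)). Qed.

Lemma cvg_prod (u v : nat -> R[i]) (a b : R[i]) :
  (u : nat -> R[i]^o) @ \oo --> (a : R[i]^o) -> (v : nat -> R[i]^o) @ \oo --> (b : R[i]^o) ->
  (fun n => u n * v n : R[i]^o) @ \oo --> (a * b : R[i]^o).
Proof.
move=> ua vb; apply/cvg_rnormP => e e0; have [N0 hN0] := cvg_bounded vb.
pose K := cn a + cn b + 1.
have K0 : 0 < K by rewrite ltr_pwDr// addr_ge0// rnorm_ge0.
have [aK bK] : cn a <= K /\ cn b + 1 <= K.
  by rewrite /K; have := rnorm_ge0 (a : R[i]^o); have := rnorm_ge0 (b : R[i]^o); lra.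
have d0 : 0 < e / (K + K) by rewrite divr_gt0// addr_gt0.
have /cvg_rnormP/(_ _ d0)[N1 hN1] := ua; have /cvg_rnormP/(_ _ d0)[N2 hN2] := vb.
exists (maxn N0 (maxn N1 N2)) => n; rewrite !geq_max => /and3P[/hN0 n0 /hN1 n1 /hN2 n2].
have -> : u n * v n - a * b = (u n - a) * v n + a * (v n - b) by ring.
apply: le_lt_trans (ler_rnormD _ _) _; rewrite !cnM.
have -> : e = e / (K + K) * K + K * (e / (K + K)) by field; rewrite gt_eqF// addr_gt0.
apply: ltr_leD.
  apply: le_lt_trans (_ : cn (u n - a) * K < _); last by rewrite ltr_pM2r.
  by rewrite ler_wpM2l ?rnorm_ge0// (le_trans n0).
by apply: ler_pM; rewrite ?rnorm_ge0// ltW.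
Qed.

(** The commutation with the shift on finite sums extends by continuity to the
    closure of the shift, hence to any two elements related by the shift: one
    of the two shifts is defined everywhere, and is closed. *)
Lemma multiplier_shift (M : {linear E -> E}) x y : multiplier coord M ->
  coord y = seq_translate 1 (coord x) -> coord (M y) = seq_translate 1 (coord (M x)).
Proof.
move=> [/linear_continuousP[K hK] Mc] yx.
have [a [Fa ax ay]] : exists a : nat -> E, [/\ forall k, F (a k), a @ \oo --> x &
    (fun k => U 1 (a k)) @ \oo --> y].
  case: shift_bounded => sE.
    by apply/min_closureP; exact: closure_of_maps.
  have xy : coord x = seq_translate (-1) (coord y).
    by apply: funext => n; rewrite yx /seq_translate opprK addrK.
  have /min_closureP[a [Fa ay ax]] := closure_of_maps sE xy.
  exists (fun k => U (-1) (a k)); split=> // [k|]; first exact: F_tr.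
  by under eq_fun do rewrite tr_tr// subrr tr0//.
have Mcvg (u : nat -> E) v : u @ \oo --> v -> (fun k => M (u k)) @ \oo --> M v.
  by apply: linear_cvg; apply/linear_continuousP; exists K.
apply: funext => n; apply: (coord_cvg_unique (Mcvg _ _ ay)).
rewrite (_ : (fun k => _) = fun k => coord (M (a k)) (n - 1) : R[i]^o).
  exact: coord_cvg (Mcvg _ _ ax).
apply: funext => k; rewrite (Mc (a k))//.
by rewrite coord_tr_fun.
Qed.

Lemma cvg_subseq (V : normedModType R[i]) (u : nat -> V) (x : V) (k : nat -> nat) :
  (forall i, (i <= k i)%N) -> u @ \oo --> x -> (fun i => u (k i)) @ \oo --> x.
Proof.
move=> ik /cvg_rnormP h; apply/cvg_rnormP => e /h[N hN]; exists N => n Nn.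
by apply: hN; exact: leq_trans Nn (ik n).
Qed.

Section Powers.
Variables (M : {linear E -> E}) (B C' r : R).
Hypothesis Mm : multiplier coord M.
Hypothesis MB : forall x, rnorm (M x) <= B * rnorm x.
Hypotheses (r0 : 0 < r) (C'0 : 0 <= C').
Hypothesis toeplitz : forall (N : {linear E -> E}) (A : R), multiplier coord N ->
  (forall x, rnorm (N x) <= A * rnorm x) ->
  toeplitz_bounded (fun n => symbol coord N n * (r ^ n)%:C) (C' * A).

Let c n := symbol coord M n * (r ^ n)%:C.

Variables (nu : R[i] -> R[i]) (k : nat -> nat).
Hypothesis bnu : bmeas (fun t => nu (cis t)).
Hypothesis ik : forall i, (i <= k i)%N.
Hypothesis nu_cvg : {ae mu, forall t, I t ->
  (fun i => fejer_poly c (k i) (cis t) : R[i]^o) @ \oo --> (nu (cis t) : R[i]^o)}.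

Let cB : toeplitz_bounded c (C' * B). Proof. exact: toeplitz. Qed.

Let fp_le i t : cn (fejer_poly c (k i) (cis t)) <= C' * B.
Proof. by apply: (fejer_poly_le cB); rewrite cn_cis. Qed.

(** The powers of [nu] have the Fourier coefficients of the powers of [M]: in
    the induction step, the product by [nu] is a limit of products by Fejér
    means, whose coefficients are those of [N] applied to the Fejér means of
    [M (ee 0)] in [E]. *)
Lemma fourier_power j : exists N : {linear E -> E},
  [/\ multiplier coord N, forall x, rnorm (N x) <= B ^+ j * rnorm x,
   forall x, N x = iter j M x &
   forall n, cmean (fun t => nu (cis t) ^+ j * cis t ^ (- n)) = symbol coord N n * (r ^ n)%:C].
Proof.
elim: j => [|j [N [Nm NB Ni Nf]]].
  exists idfun; split.
  - by split=> //; move=> x; exact: cvg_id.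
  - by move=> x; rewrite mul1r.
  - by [].
  move=> n; under eq_fun do rewrite expr0 mul1r; rewrite cmean_cisXz oppr_eq0.
  rewrite /symbol /= -/(ee 0) coord_ee.
  by case: eqP => [->|]; rewrite ?mul0r// expr0z mulr1.
have B0 : 0 <= B by exact: mult_norm_ge0 MB.
pose NM : {linear E -> E} := N \o M.
have NMB x : rnorm (NM x) <= B ^+ j.+1 * rnorm x.
  rewrite exprSr -mulrA; apply: le_trans (NB _) _.
  by rewrite ler_wpM2l ?exprn_ge0.
exists NM; split=> //.
- split; first by apply/linear_continuousP; exists (B ^+ j.+1).
  move=> a sa Fa saE; rewrite shift1; have [_ Mc] := Mm.
  exact: (multiplier_shift Nm (Mc a sa Fa saE)).
- by move=> x; rewrite iterSr -Ni.
move=> n; pose f t := nu (cis t) ^+ j * cis t ^ (- n).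
have bf : bmeas f by apply: bmeasM; [exact: bmeasX|exact: bmeas_cisXz].
have [_ _ [K hK]] := bf.
have K0 : 0 <= K by apply: le_trans (hK 0); exact: rnorm_ge0.
have lim1 : (fun i => cmean (fun t => fejer_poly c (k i) (cis t) * f t) : R[i]^o) @ \oo -->
    (cmean (fun t => nu (cis t) * f t) : R[i]^o).
  apply: (@cmean_cvg _ _ _ (C' * B * K)).
  - by move=> i; apply: bmeasM => //; exact: bmeas_fejer_poly.
  - exact: bmeasM.
  - by move=> i t; rewrite cnM; apply: ler_pM; rewrite ?rnorm_ge0.
  apply: ae_imp nu_cvg => t h It; have := h It => {}h.
  rewrite (_ : (fun i => _) = fun i => f t *: (fejer_poly c (k i) (cis t) : R[i]^o)).
    rewrite mulrC; exact: (@cvg_scale R R[i]^o).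
  by apply: funext => i; rewrite mulrC.
have lim2 : (fun i => cmean (fun t => fejer_poly c (k i) (cis t) * f t) : R[i]^o) @ \oo -->
    (symbol coord NM n * (r ^ n)%:C : R[i]^o).
  rewrite (_ : (fun i => _) = fun i => (r ^ n)%:C *: (coord (N (fejer coord (k i) (M (ee 0)))) n : R[i]^o)).
    rewrite mulrC; apply: (@cvg_scale R R[i]^o).
    have Mk := cvg_subseq ik (fejer_cvg (HE := HE) (x := M (ee 0))).
    by apply: coord_cvg; apply: (linear_cvg _ Mk); case: Nm.
  apply: funext => i; rewrite fejer_poly_mean// /fejer linearZ /= coordZ.
  rewrite -[_ *: _]/(_ * _) mulrCA; congr (_ * _).
  rewrite linear_sum coord_sum mulr_sumr; apply: eq_bigr => a _.
  rewrite linear_sum coord_sum mulr_sumr; apply: eq_bigr => b _.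
  set m := a%:Z - b%:Z; rewrite linearZ /= coordZ (mult_ee _ _ Nm).
  have -> : (fun t => cis t ^ m * f t) = (fun t => nu (cis t) ^+ j * cis t ^ (- (n - m))).
    apply: funext => t; rewrite /f mulrCA -expfzDr ?cis_neq0//.
    by congr (_ * _ ^ _); rewrite opprB.
  rewrite Nf /c /symbol -/(ee 0).
  have -> : (r ^ n)%:C = (r ^ m)%:C * (r ^ (n - m))%:C.
    by rewrite -rmorphM -expfzDr ?gt_eqF//= addrC subrK.
  by ring.
have := cvg_rnorm_unique lim1 lim2 => <-.
by congr cmean; apply: funext => t; rewrite exprS -mulrA.
Qed.

(** The Toeplitz inequality with a basis vector on one side and, on the other
    side, the coefficients of the trigonometric polynomial in reverse
    order. *)
Lemma toeplitz_pairing (d : int -> R[i]) (A : R) (g : R -> R[i]) (P : {poly R[i]}) (N : nat) :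
  toeplitz_bounded d A -> bmeas g ->
  (forall n, cmean (fun t => g t * cis t ^ (- n)) = d n) ->
  cn (cmean (fun t => g t * conjc (cis t ^ (- N%:Z) * P.[cis t]))) <=
  A * ((1 + rmean (fun t => cn (cis t ^ (- N%:Z) * P.[cis t]) ^+ 2)) / 2).
Proof.
move=> dA bg gd; pose a0 := size P; pose K := (a0 + N).+1.
have PE (t : R) : cis t ^ (- N%:Z) * P.[cis t] = \sum_(l < K) P`_l * cis t ^ (l%:Z - N%:Z).
  rewrite (@horner_coef_wide _ K); last by rewrite /K -/a0; lia.
  rewrite mulr_sumr; apply: eq_bigr => l _.
  by rewrite mulrCA exprnP -expfzDr ?cis_neq0// [- _ + _]addrC.
have -> : (fun t => cn (cis t ^ (- N%:Z) * P.[cis t]) ^+ 2) =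
    (fun t => cn (\sum_(l < K) P`_l * cis t ^ (l%:Z - N%:Z)) ^+ 2).
  by apply: funext => t; rewrite PE.
rewrite (parseval_circle _ _ (fun l => P`_l)).
have -> : (fun t => g t * conjc (cis t ^ (- N%:Z) * P.[cis t])) =
    (fun t => \sum_(l < K) conjc P`_l * (g t * cis t ^ (- (l%:Z - N%:Z)))).
  apply: funext => t; rewrite PE conj_sum mulr_sumr; apply: eq_bigr => l _.
  by rewrite conjM conjcXz conj_cis exprz_inv mulrCA.
have bt (l : 'I_K) : bmeas (fun t => g t * cis t ^ (- (l%:Z - N%:Z))).
  by apply: bmeasM => //; exact: bmeas_cisXz.
rewrite cmean_sum; last by move=> l; apply: bmeasM => //; exact: bmeas_cst.
under eq_bigr do rewrite cmeanZ// gd.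
have a0K : (a0 < K)%N by rewrite /K; lia.
have := dA K (fun i => (i == a0)%:R) (fun b => P`_(a0 + N - b)).
rewrite (bigD1 (Ordinal a0K))//= [X in cn (_ + X)]big1 ?addr0; last first.
  move=> i; rewrite -val_eqE /= => /negbTE ->; apply: big1 => b _.
  by rewrite !mul0r.
rewrite sum_cn_delta// eqxx.
congr (cn _ <= A * ((1 + _) / 2)).
  rewrite (reindex_inj rev_ord_inj) /=; apply: eq_bigr => l _.
  have lK := ltn_ord l; have lE : (a0 + N - (K - l.+1))%N = l by rewrite /K in lK *; lia.
  rewrite mul1r lE; congr (_ * d _).
  by rewrite /K in lK *; lia.
rewrite (reindex_inj rev_ord_inj) /=; apply: eq_bigr => l _.
have lK := ltn_ord l.
by rewrite (_ : (a0 + N - (K - l.+1))%N = l)//; rewrite /K in lK *; lia.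
Qed.

Lemma fejer_poly_horner i : exists P : {poly R[i]}, exists N : nat, forall t : R,
  fejer_poly c i (cis t) = cis t ^ (- N%:Z) * P.[cis t].
Proof.
exists (i.+1%:R^-1 *: \sum_(a < i.+1) \sum_(b < i.+1) c (a%:Z - b%:Z) *: 'X^(a + i.+1 - b)), i.+1 => t.
rewrite hornerZ mulrCA /fejer_poly; congr (_ * _).
rewrite horner_sum mulr_sumr; apply: eq_bigr => a _.
rewrite horner_sum mulr_sumr; apply: eq_bigr => b _.
rewrite hornerZ hornerXn mulrCA exprnP -expfzDr ?cis_neq0//; congr (_ * _ ^ _).
by have := ltn_ord b; lia.
Qed.

Let bnuX j : bmeas (fun t => nu (cis t) ^+ j). Proof. exact: bmeasX. Qed.

(** The powers of the Fejér means are trigonometric polynomials that converge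
    to [nu ^ j]. Pairing them with [nu ^ j], after a scaling by [l], gives
    [l Y <= A (1 + l^2 Y) / 2] for the energy [Y] of [nu ^ j], whence the
    bound with [l = Y^(-1/2)]. *)
Lemma power_energy j : rmean (fun t => cn (nu (cis t) ^+ j) ^+ 2) <= (C' * B ^+ j) ^+ 2.
Proof.
have [N [Nm NB _ Nf]] := fourier_power j.
have B0 : 0 <= B by exact: mult_norm_ge0 MB.
pose A := C' * B ^+ j; have A0 : 0 <= A by rewrite mulr_ge0// exprn_ge0.
have dA := toeplitz Nm NB.
pose Y := rmean (fun t => cn (nu (cis t) ^+ j) ^+ 2).
have Y0 : 0 <= Y by apply: rmean_ge0 => t; exact: sqr_ge0.
pose f i t := fejer_poly c (k i) (cis t) ^+ j.
have bf i : bmeas (f i) by apply: bmeasX; exact: bmeas_fejer_poly.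
have CB0 : 0 <= C' * B by rewrite mulr_ge0.
have f_le i t : cn (f i t) <= (C' * B) ^+ j.
  by rewrite /f cnX lerXn2r ?nnegrE ?rnorm_ge0.
have f_cvg : {ae mu, forall t, I t -> (fun i => f i t : R[i]^o) @ \oo --> (nu (cis t) ^+ j : R[i]^o)}.
  apply: ae_imp nu_cvg => t h It; have := h It => {}h.
  rewrite /f; elim: (j) => [|m IH]; first by under eq_fun do rewrite expr0; exact: cvg_cst.
  by under eq_fun do rewrite exprS; rewrite exprS; exact: cvg_prod h IH.
have pairing (l : R) i : 0 < l ->
    l * cn (cmean (fun t => nu (cis t) ^+ j * conjc (f i t))) <=
    A * ((1 + l ^+ 2 * rmean (fun t => cn (f i t) ^+ 2)) / 2).
  move=> l0; have [P [N' PE]] := fejer_poly_horner (k i).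
  have fE t : l%:C * f i t = cis t ^ (- (N' * j)%N%:Z) * (l%:C *: P ^+ j).[cis t].
    rewrite /f PE exprMn hornerZ horner_exp mulrCA; congr (_ * (_ * _)).
    by rewrite (exprnP _ j) exprz_exp mulNr PoszM.
  have := toeplitz_pairing (l%:C *: P ^+ j) (N' * j) dA (bnuX j) Nf.
  have -> : (fun t => nu (cis t) ^+ j * conjc (cis t ^ (- (N' * j)%N%:Z) * (l%:C *: P ^+ j).[cis t])) =
      (fun t => l%:C * (nu (cis t) ^+ j * conjc (f i t))).
    by apply: funext => t; rewrite -fE conjM conjc_real mulrCA.
  have -> : (fun t => cn (cis t ^ (- (N' * j)%N%:Z) * (l%:C *: P ^+ j).[cis t]) ^+ 2) =
      (fun t => l ^+ 2 * cn (f i t) ^+ 2).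
    by apply: funext => t; rewrite -fE cnM cn_real exprMn real_normK ?num_real.
  rewrite rmeanZ; last exact: bmeas_sqr_int.
  rewrite cmeanZ; last by apply: bmeasM => //; exact: bmeas_conj.
  by rewrite cnM cn_real gtr0_norm.
have [_ _ [K hK]] := bnuX j.
have K0 : 0 <= K by apply: le_trans (hK 0); exact: rnorm_ge0.
have lim1 : (fun i => cmean (fun t => nu (cis t) ^+ j * conjc (f i t)) : R[i]^o) @ \oo --> (Y%:C : R[i]^o).
  rewrite /Y rmean_sqr; apply: (@cmean_cvg _ _ _ (K * (C' * B) ^+ j)).
  - by move=> i; apply: bmeasM => //; exact: bmeas_conj.
  - by apply: bmeasM => //; exact: bmeas_conj.
  - by move=> i t; rewrite cnM cnC; apply: ler_pM; rewrite ?rnorm_ge0.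
  apply: ae_imp f_cvg => t h It; have := h It => {}h.
  apply: (@cvg_scale R R[i]^o); apply/cvg_rnormP => e e0.
  have /cvg_rnormP/(_ _ e0)[n hn] := h; exists n => m /hn.
  have cB' (a b : R[i]) : conjc a - conjc b = conjc (a - b).
    by case: a b => ? ? [? ?]; congr (_ +i* _); rewrite /= opprD.
  by rewrite (cB' (f m t) (nu (cis t) ^+ j)) cnC.
have lim2 : (fun i => rmean (fun t => cn (f i t) ^+ 2)) @ \oo --> Y.
  apply: (@rmean_cvg _ _ _ ((C' * B) ^+ j ^+ 2)).
  - by move=> i; exact: bmeas_sqr.
  - exact: bmeas_sqr.
  - move=> i t; rewrite ger0_norm ?sqr_ge0// lerXn2r ?nnegrE ?rnorm_ge0//.
    exact: exprn_ge0.
  apply: ae_imp f_cvg => t h It; have := h It => {}h.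
  have hn : (fun i => cn (f i t)) @ \oo --> cn (nu (cis t) ^+ j).
    apply/cvgrPdistC_lt => e e0; have /cvg_rnormP/(_ _ e0)[n hn] := h; exists n => // m /hn /=.
    apply: le_lt_trans; rewrite ler_norml; apply/andP; split.
      have := ler_rdist (f m t : R[i]^o) (nu (cis t) ^+ j : R[i]^o) 0; rewrite !subr0 rdistC; lra.
    have := ler_rdist (nu (cis t) ^+ j : R[i]^o) (f m t : R[i]^o) 0; rewrite !subr0; lra.
  by under eq_fun do rewrite expr2; rewrite expr2; exact: cvgM.
have ineq (l : R) : 0 < l -> l * Y <= A * ((1 + l ^+ 2 * Y) / 2).
  move=> l0.
  have c1 : (fun i => A * ((1 + l ^+ 2 * rmean (fun t => cn (f i t) ^+ 2)) / 2)) @ \oo -->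
      A * ((1 + l ^+ 2 * Y) / 2).
    by apply: cvgMr; apply: cvgMl; apply: cvgD; [exact: cvg_cst|exact: cvgMr].
  have c2 : (fun i => l * cn (cmean (fun t => nu (cis t) ^+ j * conjc (f i t)))) @ \oo --> l * Y.
    apply: cvgMr; apply/cvgrPdistC_lt => e e0; have /cvg_rnormP/(_ _ e0)[n hn] := lim1.
    exists n => // m /hn /=; apply: le_lt_trans; rewrite ler_norml; apply/andP; split.
      have := ler_rdist (cmean (fun t => nu (cis t) ^+ j * conjc (f m t)) : R[i]^o) (Y%:C : R[i]^o) 0.
      by rewrite !subr0 rdistC cn_real ger0_norm//; lra.
    have := ler_rdist (Y%:C : R[i]^o) (cmean (fun t => nu (cis t) ^+ j * conjc (f m t)) : R[i]^o) 0.
    by rewrite !subr0 cn_real ger0_norm//; lra.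
  by apply: (ler_cvg_to c2 c1); apply: nearW => i; exact: pairing.
rewrite -/Y -/A; have [->|Yn0] := eqVneq Y 0; first exact: sqr_ge0.
have {}Y0 : 0 < Y by rewrite lt_def Yn0.
pose s := Num.sqrt Y; have s0 : 0 < s by rewrite sqrtr_gt0.
have sY : s ^+ 2 = Y by rewrite sqr_sqrtr// ltW.
have := ineq s^-1; rewrite invr_gt0 => /(_ s0).
rewrite -sY exprVn mulVf; last by rewrite expf_neq0// gt_eqF.
rewrite [s ^+ 2]expr2 mulKf ?gt_eqF// -mulr2n divff ?pnatr_eq0// mulr1 => h.
by rewrite -expr2 lerXn2r// nnegrE// ltW.
Qed.

(** The spectral radius trick: the energy of [nu ^ j] is at most
    [C'^2 B^(2j)], so that the powers of [nu / (B + d)] have summable energies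
    and are bounded almost everywhere; the constant [C'] disappears. *)
Lemma symbol_function_le : {ae mu, forall t, I t -> cn (nu (cis t)) <= B}.
Proof.
have B0 : 0 <= B by exact: mult_norm_ge0 MB.
have step (d : R) : 0 < d -> {ae mu, forall t, I t -> cn (nu (cis t)) <= B + d}.
  move=> d0; have Bd : 0 < B + d by rewrite ltr_wpDl.
  pose h j t := ((B + d) ^+ j) ^- 2 * cn (nu (cis t) ^+ j) ^+ 2.
  have q01 : 0 <= (B / (B + d)) ^+ 2 < 1.
    rewrite sqr_ge0 /= exprn_ilt1 ?divr_ge0 ?(ltW Bd)//.
    by rewrite ltr_pdivrMr// mul1r ltrDl.
  have e0 j : 0 <= ((B + d) ^+ j) ^- 2 by rewrite invr_ge0 sqr_ge0.
  have hj j : rmean (h j) <= C' ^+ 2 * (B / (B + d)) ^+ 2 ^+ j.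
    rewrite rmeanZ; last exact: bmeas_sqr_int.
    apply: le_trans (ler_wpM2l (e0 j) (power_energy j)) _.
    rewrite le_eqVlt; apply/orP; left; apply/eqP.
    have -> : (B / (B + d)) ^+ 2 ^+ j = (B ^+ j / (B + d) ^+ j) ^+ 2.
      by rewrite -exprM mulnC exprM expr_div_n.
    have := expf_neq0 j (lt0r_neq0 Bd); move: (B ^+ j) ((B + d) ^+ j) => x y y0.
    by field.
  apply: ae_imp (ae_bounded q01 _ _ _ hj).
  - move=> t ht It; have [A hA] := ht It; rewrite leNgt; apply/negP => gt.
    have n0 : 0 < cn (nu (cis t)) by apply: lt_trans gt.
    have q2 : 0 <= ((B + d) / cn (nu (cis t))) ^+ 2 < 1.
      rewrite sqr_ge0 /= exprn_ilt1 ?divr_ge0 ?(ltW Bd) ?rnorm_ge0//.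
      by rewrite ltr_pdivrMr// mul1r.
    have [n hn] := geom_small A q2 ltr01.
    have := hA n; rewrite /h cnX leNgt => /negP; apply.
    move: hn; rewrite -exprM mulnC exprM expr_div_n.
    have p1 : 0 < (B + d) ^+ n by rewrite exprn_gt0.
    have p2 : 0 < cn (nu (cis t)) ^+ n by rewrite exprn_gt0.
    move: ((B + d) ^+ n) (cn (nu (cis t)) ^+ n) p1 p2 => x y x0 y0.
    rewrite expr_div_n mulrAC ltr_pdivrMr ?exprn_gt0// mul1r => h1.
    by rewrite [ltRHS]mulrC ltr_pdivlMr ?exprn_gt0// mulrC.
  - by move=> j; apply: measurable_funM; [exact: measurable_cst|exact: bmeas_sqr].
  - move=> j; have [_ _ [K hK]] := bnuX j.
    exists (((B + d) ^+ j) ^- 2 * K ^+ 2) => t.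
    rewrite ger0_norm; last by rewrite mulr_ge0 ?sqr_ge0.
    rewrite /h ler_wpM2l// lerXn2r ?nnegrE ?rnorm_ge0//.
    exact: le_trans (rnorm_ge0 _) (hK t).
  - by move=> j t; rewrite mulr_ge0 ?sqr_ge0.
have all_n : {ae mu, forall t, forall n : nat, I t -> cn (nu (cis t)) <= B + n.+1%:R^-1}.
  by apply: ae_foralln => n; apply: step; rewrite invr_gt0 ltr0n.
apply: ae_imp all_n => t h It; apply/ler_addgt0Pr => e e0.
have [n hn] := inv_natS_small e0.
by apply: le_trans (h n It) _; rewrite lerD2l ltW// hn.
Qed.

End Powers.

End SymbolPowers.

(** * Spaces of sequences satisfying the hypotheses *)

Section SequenceSpaces.
Variables (R : realType) (E : completeNormedModType R[i]).
Variable coord : {linear E -> (int -> R[i]^o)}.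
Local Notation cn z := (rnorm (z : R[i]^o)).

(** The continuity and boundedness hypotheses are turned into constants. *)
Lemma hom_space :
  injective coord -> (forall a : int -> R[i]^o, finsupp a -> exists x : E, coord x = a) ->
  dense [set x : E | finsupp (coord x)] ->
  (forall n : int, continuous (fun x : E => coord x n)) ->
  (forall z : R[i], circle 1 z -> maps_into coord (psi z)) ->
  (ereal_sup [set opnorm (restr coord (psi z)) | z in (circle 1 : set R[i])] < +oo)%E ->
  HomSpace coord.
Proof.
move=> inj ex dns cc pin pb; split=> //.
- by move=> x e; exact: dense_rnorm.
- move=> n; have ln : linear (fun x => coord x n) by move=> l x y; rewrite linearP.
  pose fm := GRing.isLinear.Build R[i] E R[i]^o _ (fun x => coord x n) ln.
  pose f : {linear E -> R[i]^o} := HB.pack (fun x => coord x n) fm.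
  by have /linear_continuousP := cc n : continuous f.
have fin_sup (s : \bar R) : (s < +oo)%E -> exists2 C : R, 0 <= C & (s <= C%:E)%E.
  case: s => [x _||_] //; last by exists 0; rewrite // leNye.
  by exists `|x| => //; rewrite lee_fin ler_norm.
have [C C0 sC] := fin_sup _ pb.
exists C => // z x /circleE z1; pose T := restr coord (psi z).
have TE y : coord (T y) = psi z (coord y).
  exact: (xgetPex 0 (P := [set u | coord u = psi z (coord y)])) (pin z z1 y).
have Tl : linear T.
  move=> l u v; apply: inj; rewrite linearP !TE linearP; apply: funext => n.
  by rewrite /psi -[RHS]/(l * (coord u n * z ^ n) + coord v n * z ^ n) mulrA -mulrDl.
pose Tm := GRing.isLinear.Build R[i] E E _ T Tl.
pose TL : {linear E -> E} := HB.pack T Tm.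
exists (T x) => //; apply: (opnorm_le (f := TL)).
by apply: le_trans sC; apply: ereal_sup_ubound; exists z.
Qed.

Context {HE : HomSpace coord}.
Hypothesis shift_bounded : maps_into coord (seq_translate 1) \/ maps_into coord (seq_translate (-1)).

(** By construction, [nu] is only bounded by a multiple of the norm of [M];
    its powers give the sharp bound. *)
Lemma symbol_bounded (M : {linear E -> E}) (r : R) : multiplier coord M -> 0 < r ->
  spec coord (seq_translate 1) r%:C ->
  exists nu : R[i] -> R[i],
    [/\ Linfty_circle nu, forall n, fourier nu n = symbol coord M n * (r ^ n)%:C &
        ae_circle (fun z => ((cn (nu z))%:E <= opnorm M)%E)].
Proof.
move=> Mm r0 rspec; have [Mc _] := Mm; have [B B0 nB] := opnorm_fin Mc.
have MB x : rnorm (M x) <= B * rnorm x by apply: opnorm_le; rewrite nB.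
have [C' C'0 toep] := toeplitz_spec shift_bounded r0 rspec.
have [nu [k [bnu ik nucv]]] := ex_symbol_function (toep M B Mm MB).
exists nu; split.
- have [mr mi [K hK]] := bnu; split=> //; exists K.
  by apply: aeW => t _; exact: hK.
- move=> n; have [N [_ _ Ni Nf]] := fourier_power shift_bounded Mm MB r0 toep bnu ik nucv 1.
  rewrite /symbol -[M _]/(iter 1 M _) -Ni -/(symbol coord N n) -Nf.
  by congr cmean; apply: funext => t; rewrite expr1.
apply: ae_imp (symbol_function_le shift_bounded Mm MB r0 C'0 toep bnu ik nucv) => t h It.
by rewrite nB lee_fin; exact: h.
Qed.

End SequenceSpaces.

Theorem theorem1 (R : realType) (E : completeNormedModType R[i])
    (coord : {linear E -> (int -> R[i]^o)})
    (coord_inj : injective coord)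
    (finsupp_in : forall a : int -> R[i]^o, finsupp a -> exists x : E, coord x = a)
    (finsupp_dense : dense [set x : E | finsupp (coord x)])
    (coord_continuous : forall n : int, continuous (fun x : E => coord x n))
    (psi_in : forall z : R[i], circle 1 z -> maps_into coord (psi z))
    (psi_bounded :
       (ereal_sup [set opnorm (restr coord (psi z)) | z in (circle 1 : set R[i])]
        < +oo)%E)
    (S_bounded : maps_into coord (@seq_shift R) \/ maps_into coord (@seq_unshift R)) :
  [/\ (~ maps_into coord (@seq_shift R) -> maps_into coord (@seq_unshift R) ->
         rho coord (@seq_shift R) = +oo%E) /\
      (maps_into coord (@seq_shift R) -> ~ maps_into coord (@seq_unshift R) ->
         rho coord (@seq_unshift R) = +oo%E),
      spec coord (@seq_shift R) =
        [set z : R[i] | ((rho coord (@seq_unshift R))^-1 <= (rnorm (z : R[i]^o))%:E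
                          <= rho coord (@seq_shift R))%E],
      forall M : {linear E -> E}, multiplier coord M ->
        forall r : R, 0 < r ->
          circle r `<=` spec coord (@seq_shift R) ->
          exists nu : R[i] -> R[i],
            [/\ Linfty_circle nu,
                forall n : int, fourier nu n = symbol coord M n * (r ^ n)%:C &
                ae_circle (fun z => ((rnorm (nu z : R[i]^o))%:E <= opnorm M)%E)] &
      ((rho coord (@seq_unshift R))^-1 < rho coord (@seq_shift R))%E ->
        forall M : {linear E -> E}, multiplier coord M ->
          laurent_holomorphic (symbol coord M)
            (interior (spec coord (@seq_shift R) : set R[i]^o))].
Proof.
have HE := hom_space coord_inj finsupp_in finsupp_dense coord_continuous psi_in psi_bounded.
rewrite shiftN1 shift1 in S_bounded *.
have rho1 : rho coord (seq_translate 1) = shift_radius coord 1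
  by exact: (shift_rho S_bounded (or_introl erefl)).
have rhoN1 : rho coord (seq_translate (-1)) = shift_radius coord (-1)
  by exact: (shift_rho S_bounded (or_intror erefl)).
split.
- by rewrite rho1 rhoN1; split=> [nb _|_ nb]; exact: shift_radius_pinfty.
- apply/seteqP; split=> z; rewrite /= rho1 rhoN1.
    by move/(shift_specP S_bounded z (mulr1 1)).
  by move=> h; apply/(shift_specP S_bounded z (mulr1 1)).
- move=> M Mm r r0 rspec; apply: symbol_bounded => //; apply: rspec.
  by apply/circleE; rewrite cn_real gtr0_norm.
- by move=> _ M Mm; exact: symbol_holomorphic.
Qed.
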